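(* Let $(X,\mu)$ be a standard probability space. The group $\mathrm{Aut}^*(X,\mu)$ has a unique Polish group topology, namely the weak topology.
   Context: A standard probability space is a standard Borel space equipped with a nonatomic Borel probability measure. A Borel bijection $T:X\to X$ is non-singular if for all Borel $A\subseteq X$, $\mu(A)=0$ if and only if $\mu(T^{-1}(A))=0$. $\mathrm{Aut}^*(X,\mu)$ is the group of all non-singular Borel bijections of $(X,\mu)$, two such bijections being identified if they coincide up to measure zero. The weak topology on $\mathrm{Aut}^*(X,\mu)$ is the metrizable group topology in which a sequence $(T_n)$ converges to $T$ if and only if $\mu(T_n(A)\bigtriangleup T(A))\to 0$ for every Borel $A\subseteq X$, and $$\left\lVert \frac{d(T_{n*}\mu)}{d\mu}-\frac{d(T_*\mu)}{d\mu}\right\rVert_1\to 0,$$ where $T_*\mu$ denotes the pushforward measure and $\lVert\cdot\rVert_1$ is the norm of $L^1(X,\mu)$. A Polish group topology on a group is a group topology which is Polish (separable and completely metrizable). *)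

(* Defs.v *)
From HB Require Import structures.
From mathcomp Require Import all_boot all_order all_algebra.
From mathcomp Require Import all_classical all_reals all_analysis.

Set Implicit Arguments.
Unset Strict Implicit.
Unset Printing Implicit Defensive.

Import Order.TTheory GRing.Theory Num.Theory.
Import numFieldNormedType.Exports.

Local Open Scope classical_set_scope.
Local Open Scope ring_scope.

(** Topologies on a fixed carrier, as families of open sets, so that two of
    them can be compared by equality. *)

Record topology (T : Type) := Topology {
  opens : set (set T);
  opensT : opens setT;
  opensI : setI_closed opens;
  opens_bigcup : forall D : set (set T), D `<=` opens ->
    opens (\bigcup_(U in D) U)
}.

Lemma topology_eq (T : Type) (tau tau' : topology T) :
  opens tau = opens tau' -> tau = tau'.
Proof.
case: tau => U p q r; case: tau' => V p' q' r' /= UV; subst V.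
by congr Topology; exact: Prop_irrelevance.
Qed.

Definition space (T : choiceType) (tau : topology T) : Type := T.

Section space_topological.
Variables (T : choiceType) (tau : topology T).

HB.instance Definition _ := Choice.on (space tau).

Let opens_bigU (I : Type) (f : I -> set T) :
  (forall i, opens tau (f i)) -> opens tau (\bigcup_i f i).
Proof.
move=> of_; have -> : \bigcup_i f i = \bigcup_(U in range f) U.
  by rewrite bigcup_image.
by apply: opens_bigcup => _ [i _ <-].
Qed.

HB.instance Definition _ := @isOpenTopological.Build (space tau)
  (opens tau) (opensT tau) (@opensI _ tau) opens_bigU.

Lemma open_spaceE : @open (space tau) = opens tau.
Proof. by []. Qed.

End space_topological.

Definition homeomorphic (S T : topologicalType) :=
  exists (f : S -> T) (g : T -> S),
    [/\ cancel f g, cancel g f, continuous f & continuous g].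

Definition complete_uniform (M : uniformType) :=
  forall F : set_system M, ProperFilter F -> cauchy F ->
    exists x : M, F --> x.

Definition metrizable (R : realType) (S : topologicalType) :=
  exists M : metricType R, homeomorphic S M.

Definition completely_metrizable (R : realType) (S : topologicalType) :=
  exists M : metricType R, homeomorphic S M /\ complete_uniform M.

Definition separable_space (S : topologicalType) :=
  exists D : set S, countable D /\ dense D.

Definition polish (R : realType) (S : topologicalType) :=
  separable_space S /\ completely_metrizable R S.

Definition group_topology (G : groupType) (tau : topology G) :=
  continuous (fun p : space tau * space tau =>
    ((p.1 : G) * (p.2 : G))%g : space tau) /\
  continuous (fun x : space tau => ((x : G)^-1)%g : space tau).

Definition polish_group_topology (R : realType) (G : groupType)
    (tau : topology G) :=
  group_topology tau /\ polish R (space tau).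

Definition standard_borel (R : realType) (d : measure_display)
    (X : measurableType d) :=
  exists tau : topology X,
    polish R (space tau) /\ @measurable d X = <<s opens tau >>.

Definition nonatomic (d : measure_display) (X : measurableType d)
    (R : realType) (mu : {measure set X -> \bar R}) :=
  forall A, measurable A -> (0 < mu A)%E ->
    exists B, [/\ measurable B, B `<=` A & (0 < mu B < mu A)%E].

Definition standard_probability_space (d : measure_display)
    (X : measurableType d) (R : realType) (mu : probability X R) :=
  standard_borel R X /\ nonatomic mu.

(** Bijections are taken to be measurable in both directions; on a standard
    Borel space measurability of the inverse is automatic (Lusin-Souslin). *)

Record nsbij (d : measure_display) (X : measurableType d) (R : realType)
    (mu : probability X R) := NSBij {
  nsfun : X -> X;
  nsinv : X -> X;
  nsfunK : cancel nsfun nsinv;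
  nsinvK : cancel nsinv nsfun;
  measurable_nsfun : measurable_fun setT nsfun;
  measurable_nsinv : measurable_fun setT nsinv;
  nonsingular : forall A, measurable A ->
    mu A = 0%E <-> mu (nsfun @^-1` A) = 0%E
}.

Section nsbij.
Context (d : measure_display) (X : measurableType d) (R : realType).
Variable mu : probability X R.
Implicit Types f g h : nsbij mu.

HB.instance Definition _ := gen_eqMixin (nsbij mu).
HB.instance Definition _ := gen_choiceMixin (nsbij mu).

HB.instance Definition _ f :=
  isMeasurableFun.Build _ _ _ _ (nsfun f) (measurable_nsfun f).

Lemma measurable_nspreimage f A :
  measurable A -> measurable (nsfun f @^-1` A).
Proof. by move=> mA; rewrite -[X in measurable X]setTI; exact: measurable_nsfun. Qed.

Lemma measurable_nsinv_preimage f A :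
  measurable A -> measurable (nsinv f @^-1` A).
Proof. by move=> mA; rewrite -[X in measurable X]setTI; exact: measurable_nsinv. Qed.

Lemma nonsingular_id A : measurable A ->
  mu A = 0%E <-> mu ((@id X) @^-1` A) = 0%E.
Proof. by rewrite preimage_id. Qed.

Definition nsid : nsbij mu := @NSBij d X R mu id id
  (fun=> erefl) (fun=> erefl) (@measurable_id _ _ _) (@measurable_id _ _ _)
  nonsingular_id.

Lemma nonsingular_comp f g A : measurable A ->
  mu A = 0%E <-> mu ((nsfun f \o nsfun g) @^-1` A) = 0%E.
Proof.
move=> mA; rewrite comp_preimage.
by apply: (iff_trans (nonsingular f mA)); exact/nonsingular/measurable_nspreimage.
Qed.

Definition nscomp f g : nsbij mu := @NSBij d X R mu
  (nsfun f \o nsfun g) (nsinv g \o nsinv f)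
  (can_comp (nsfunK f) (nsfunK g)) (can_comp (nsinvK g) (nsinvK f))
  (measurableT_comp (measurable_nsfun f) (measurable_nsfun g))
  (measurableT_comp (measurable_nsinv g) (measurable_nsinv f))
  (@nonsingular_comp f g).

Lemma nonsingular_inv f A : measurable A ->
  mu A = 0%E <-> mu (nsinv f @^-1` A) = 0%E.
Proof.
move=> mA.
have := nonsingular f (measurable_nsinv_preimage f mA).
rewrite -comp_preimage (_ : nsinv f \o nsfun f = id) ?preimage_id.
  exact: iff_sym.
by apply/funext => x /=; rewrite nsfunK.
Qed.

Definition nsinverse f : nsbij mu := @NSBij d X R mu (nsinv f) (nsfun f)
  (nsinvK f) (nsfunK f) (measurable_nsinv f) (measurable_nsfun f)
  (@nonsingular_inv f).

Definition ns_ae_eq f g := `[< nsfun f = nsfun g %[ae mu] >].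

Lemma ns_ae_eqP f g :
  reflect (exists N, [/\ measurable N, mu N = 0%E &
                         forall x, ~ N x -> nsfun f x = nsfun g x])
          (ns_ae_eq f g).
Proof.
apply: (iffP (asboolP _)) => [[N [mN N0 sN]]|[N [mN N0 fgN]]].
  exists N; split=> // x Nx; apply: contrapT => fg; apply/Nx/sN => /= e.
  exact/fg/e.
exists N; split=> // x /= fgx; apply: contrapT => Nx; apply: fgx => _.
exact: fgN.
Qed.

Lemma ns_ae_eq_refl : reflexive ns_ae_eq.
Proof. by move=> f; apply/ns_ae_eqP; exists set0; split. Qed.

Lemma ns_ae_eq_symW f g : ns_ae_eq f g -> ns_ae_eq g f.
Proof. by move=> /ns_ae_eqP[N [mN N0 e]]; apply/ns_ae_eqP; exists N; split=> // x /e. Qed.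

Lemma ns_ae_eq_sym : symmetric ns_ae_eq.
Proof. by move=> f g; apply/idP/idP; exact: ns_ae_eq_symW. Qed.

Lemma ns_ae_eq_trans : transitive ns_ae_eq.
Proof.
move=> g f h /ns_ae_eqP[N [mN N0 fg]] /ns_ae_eqP[M [mM M0 gh]].
apply/ns_ae_eqP; exists (N `|` M); split; first exact: measurableU.
  by rewrite measureU0.
by move=> x /not_orP[/fg -> /gh ->].
Qed.

Canonical ns_ae_eq_equiv := EquivRel ns_ae_eq ns_ae_eq_refl ns_ae_eq_sym ns_ae_eq_trans.

Lemma ns_ae_eq_comp f f' g g' :
  ns_ae_eq f f' -> ns_ae_eq g g' -> ns_ae_eq (nscomp f g) (nscomp f' g').
Proof.
move=> /ns_ae_eqP[N [mN N0 ff']] /ns_ae_eqP[M [mM M0 gg']].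
have mgN := measurable_nspreimage g mN.
apply/ns_ae_eqP; exists (nsfun g @^-1` N `|` M); split; first exact: measurableU.
  by rewrite measureU0//; apply: (nonsingular g mN).1.
by move=> x /not_orP[/= /ff' -> /gg' ->].
Qed.

Lemma ns_ae_eq_inverse f g : ns_ae_eq f g -> ns_ae_eq (nsinverse f) (nsinverse g).
Proof.
move=> /ns_ae_eqP[N [mN N0 fg]].
apply/ns_ae_eqP; exists (nsinv f @^-1` N); split.
- exact: measurable_nsinv_preimage.
- exact: (nonsingular_inv f mN).1.
- move=> x /fg /= e; apply: (can_inj (nsfunK g)) => /=.
  by rewrite -e !nsinvK.
Qed.

End nsbij.

Local Open Scope quotient_scope.

Definition Autstar (d : measure_display) (X : measurableType d) (R : realType)
    (mu : probability X R) : Type := {eq_quot (@ns_ae_eq d X R mu)}.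

Section Autstar.
Context (d : measure_display) (X : measurableType d) (R : realType).
Variable mu : probability X R.
Local Notation G := (Autstar mu).

HB.instance Definition _ := Choice.on G.
HB.instance Definition _ := EqQuotient.on G.

Definition Autstar_one : G := \pi_G (nsid mu).
Definition Autstar_mul (S T : G) : G := \pi_G (nscomp (repr S) (repr T)).
Definition Autstar_inv (T : G) : G := \pi_G (nsinverse (repr T)).

Lemma Autstar_eqP (f g : nsbij mu) : \pi_G f = \pi_G g <-> ns_ae_eq f g.
Proof. by split=> [/eqmodP|?]//; exact/eqmodP. Qed.

Lemma ns_ae_eq_repr (f : nsbij mu) : ns_ae_eq (repr (\pi_G f)) f.
Proof. by apply/Autstar_eqP; rewrite reprK. Qed.

Lemma Autstar_mul_pi (f g : nsbij mu) :
  Autstar_mul (\pi_G f) (\pi_G g) = \pi_G (nscomp f g).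
Proof. by apply/Autstar_eqP; apply: ns_ae_eq_comp; exact: ns_ae_eq_repr. Qed.

Lemma Autstar_inv_pi (f : nsbij mu) :
  Autstar_inv (\pi_G f) = \pi_G (nsinverse f).
Proof. exact/Autstar_eqP/ns_ae_eq_inverse/ns_ae_eq_repr. Qed.

Lemma ns_ae_eq_fun (f g : nsbij mu) : nsfun f =1 nsfun g -> ns_ae_eq f g.
Proof. by move=> fg; apply/ns_ae_eqP; exists set0; split. Qed.

Lemma Autstar_mulA : associative Autstar_mul.
Proof.
elim/quotW => f; elim/quotW => g; elim/quotW => h.
rewrite (Autstar_mul_pi g h) (Autstar_mul_pi f g).
rewrite (Autstar_mul_pi f (nscomp g h)) (Autstar_mul_pi (nscomp f g) h).
by apply/Autstar_eqP; apply: ns_ae_eq_fun.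
Qed.

Lemma Autstar_mul1g : left_id Autstar_one Autstar_mul.
Proof.
elim/quotW => f; rewrite (Autstar_mul_pi (nsid mu) f).
by apply/Autstar_eqP; apply: ns_ae_eq_fun.
Qed.

Lemma Autstar_mulg1 : right_id Autstar_one Autstar_mul.
Proof.
elim/quotW => f; rewrite (Autstar_mul_pi f (nsid mu)).
by apply/Autstar_eqP; apply: ns_ae_eq_fun.
Qed.

Lemma Autstar_mulVg : left_inverse Autstar_one Autstar_inv Autstar_mul.
Proof.
elim/quotW => f; rewrite (Autstar_inv_pi f) (Autstar_mul_pi (nsinverse f) f).
by apply/Autstar_eqP; apply: ns_ae_eq_fun => x /=; rewrite nsfunK.
Qed.

Lemma Autstar_mulgV : right_inverse Autstar_one Autstar_inv Autstar_mul.
Proof.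
elim/quotW => f; rewrite (Autstar_inv_pi f) (Autstar_mul_pi f (nsinverse f)).
by apply/Autstar_eqP; apply: ns_ae_eq_fun => x /=; rewrite nsinvK.
Qed.

HB.instance Definition _ := isGroup.Build G
  Autstar_mulA Autstar_mul1g Autstar_mulg1 Autstar_mulVg Autstar_mulgV.

End Autstar.

Local Open Scope charge_scope.

Section weak_topology.
Context (d : measure_display) (X : measurableType d) (R : realType).
Variable mu : probability X R.

Definition RN_pushforward (f : nsbij mu) : X -> \bar R :=
  'd (charge_of_finite_measure (distribution mu (nsfun f))) '/d mu.

Definition nsbij_cvg (f_ : nat -> nsbij mu) (f : nsbij mu) :=
  (forall A, measurable A ->
    (fun n => mu ((nsfun (f_ n) @` A) `+` (nsfun f @` A))) @ \oo --> 0%E) /\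
  (fun n => 'N[mu]_1[(RN_pushforward (f_ n) \- RN_pushforward f)]%E)
    @ \oo --> 0%E.

(** The choice of representatives is immaterial: both conditions of
    [nsbij_cvg] are invariant under almost everywhere equality. *)
Definition weak_cvg (T_ : nat -> Autstar mu) (T : Autstar mu) :=
  nsbij_cvg (fun n => repr (T_ n)) (repr T).

Definition is_weak_topology (tau : topology (Autstar mu)) :=
  [/\ metrizable R (space tau), group_topology tau &
      forall (T_ : nat -> space tau) (T : space tau),
        T_ @ \oo --> T <-> weak_cvg T_ T].

End weak_topology.

(* Main.v *)
(** Aut*(X,mu) acts by isometries on L^1(X,mu), a map T sending the density of
    a measure to that of its push-forward by T, and the weak topology is the
    strong operator topology of this action.  This makes it a separable
    metrizable group topology, and it is complete because a sequence of maps
    that is Cauchy together with its inverses has a limit in the measure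
    algebra, which is realized by a point map.

    For uniqueness, two Polish group topologies agree as soon as they satisfy a
    closed graph condition.  To check it, let U_n converge to 1 weakly and to S
    in another Polish group topology.  If S(A) is not contained in A, then along
    a subsequence some nonnull E in S(A) \ A is disjoint from all U_n(A), so
    U_n P U_n^-1 commutes with Q whenever P is supported in A and Q in E.  This
    passes to the limit: S P S^-1 commutes with Q.  But S P S^-1 can be any
    element supported in E, and such elements do not all commute. *)
From HB Require Import structures.
From mathcomp Require Import all_boot all_order all_algebra.
From mathcomp Require Import all_classical all_reals all_analysis.
From mathcomp Require Import measurable_realfun ring lra.
Require Import Defs.

Set Implicit Arguments.
Unset Strict Implicit.
Unset Printing Implicit Defensive.

Import Order.TTheory GRing.Theory Num.Theory.
Import numFieldNormedType.Exports.
Import HBSimple.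

Local Open Scope classical_set_scope.
Local Open Scope ring_scope.

(** * Metrics and Polish group topologies *)

(** Nothing relates the Borel sets of the two topologies, so uniqueness rests on completeness and
    separability alone. A game played in both metrics at once builds a sequence with a limit for
    each of them; Baire category lets every move be made, and the closed graph condition identifies
    the two limits. Translation reduces that condition to sequences tending to [1] for the weak
    topology.

    Sets are handled modulo null sets, but group elements come from point maps. To return to points,
    a point is coded by the indices of those balls of a countable base that contain it: for a
    complete metric the codes form a Borel set, so a measurable map into codes that almost
    everywhere takes its values in this set lifts to points.

    Elements that do not commute come from nonatomicity: a set of positive measure carries a
    variable uniform on an interval, and reflecting the interval gives a nontrivial involution of
    the set. A second involution, supported on a part that the first moves off itself, does not
    commute with it. *)

Record is_metric (R : realType) (T : Type) (D : T -> T -> R) : Prop := IsMetric {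
  metxx : forall x, D x x = 0;
  met0_eq : forall x y, D x y = 0 -> x = y;
  metC : forall x y, D x y = D y x;
  met_triangle : forall y x z, D x z <= D x y + D y z
}.

Section metric.
Context (R : realType).

Definition met_cvg (T : Type) (D : T -> T -> R) (u : nat -> T) (x : T) :=
  forall e, 0 < e -> exists N, forall n, (N <= n)%N -> D (u n) x < e.

Definition met_complete (T : Type) (D : T -> T -> R) :=
  forall u : nat -> T,
    (forall e, 0 < e -> exists N, forall m n, (N <= m)%N -> (N <= n)%N ->
       D (u m) (u n) < e) ->
    exists x, met_cvg D u x.

Definition met_separable (T : Type) (D : T -> T -> R) :=
  exists q : nat -> T, forall x e, 0 < e -> exists n, D x (q n) < e.

Definition met_open (T : Type) (D : T -> T -> R) (U : set T) :=
  forall x, U x -> exists2 e, 0 < e & forall y, D x y < e -> U y.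

Definition met_closure (T : Type) (D : T -> T -> R) (A : set T) : set T :=
  [set x | forall e, 0 < e -> exists2 y, A y & D x y < e].

Definition seq_continuous (S T : Type) (D : S -> S -> R) (D' : T -> T -> R)
    (f : S -> T) :=
  forall u x, met_cvg D u x -> met_cvg D' (f \o u) (f x).

Lemma archi_inv (e : R) : 0 < e -> exists N : nat,
  forall n, (N <= n)%N -> n.+1%:R^-1 < e.
Proof.
move=> e0; exists (Num.truncn e^-1) => n Nn.
rewrite -[ltRHS]invrK ltf_pV2 ?posrE ?invr_gt0//.
rewrite (lt_le_trans (truncnS_gt _))// ler_nat ltnS//.
Qed.

Lemma invS_gt0 (n : nat) : 0 < n.+1%:R^-1 :> R.
Proof. by rewrite invr_gt0. Qed.

Section one_metric.
Context (T : Type) (D : T -> T -> R).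
Hypothesis DM : is_metric D.

Lemma met_ge0 x y : 0 <= D x y.
Proof. by have := met_triangle DM y x x; rewrite (metxx DM) (metC DM y x); lra. Qed.

Lemma met_cvg_cst x : met_cvg D (fun=> x) x.
Proof. by move=> e e0; exists 0%N => n _; rewrite metxx. Qed.

Lemma met_cvg_unique u x y : met_cvg D u x -> met_cvg D u y -> x = y.
Proof.
move=> ux uy; apply: (met0_eq DM); apply/eqP; rewrite eq_le met_ge0 andbT.
apply/ler_addgt0Pr => e e0; rewrite add0r.
have [|N1 h1] := ux (e / 2); first by lra.
have [|N2 h2] := uy (e / 2); first by lra.
have := h1 (maxn N1 N2) (leq_maxl _ _); have := h2 (maxn N1 N2) (leq_maxr _ _).
by have := met_triangle DM (u (maxn N1 N2)) x y; rewrite (metC DM x (u _)); lra.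
Qed.

Lemma met_cvg_inv u x : (forall n, D (u n) x < n.+1%:R^-1) -> met_cvg D u x.
Proof.
move=> ux e /archi_inv[N hN]; exists N => n /hN; exact/lt_trans.
Qed.

Lemma met_cvg_subseq u x (k : nat -> nat) :
  (forall n, (n <= k n)%N) -> met_cvg D u x -> met_cvg D (u \o k) x.
Proof.
move=> kn ux e /ux[N hN]; exists N => n Nn; apply: hN.
exact: leq_trans Nn (kn n).
Qed.

Lemma met_open_ball x r : met_open D [set y | D x y < r].
Proof.
move=> y /= xy; exists (r - D x y); first by lra.
by move=> z yz; have := met_triangle DM y x z; lra.
Qed.

Lemma met_openI U V : met_open D U -> met_open D V -> met_open D (U `&` V).
Proof.
move=> oU oV x [/oU[e e0 eU] /oV[f f0 fV]]; exists (Num.min e f).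
  by rewrite lt_min e0.
by move=> y; rewrite lt_min => /andP[/eU ? /fV].
Qed.

Lemma met_closureP A x U : met_closure D A x -> met_open D U -> U x ->
  exists2 y, A y & U y.
Proof.
by move=> Ax oU /oU[e e0 eU]; have [y Ay xy] := Ax e e0; exists y => //; exact: eU.
Qed.

(** Each ball contains the next with room to spare. Only weak inequalities pass to the limit of the
    centres, and the room left at the next index makes them strict. *)
Lemma nested_balls (c : nat -> T) (r : nat -> R) : met_complete D ->
  (forall n, 0 < r n) -> (forall n, r n.+1 < n.+1%:R^-1) ->
  (forall n, D (c n) (c n.+1) + r n.+1 < r n) ->
  exists x, met_cvg D c x /\ forall n, D (c n) x < r n.
Proof.
move=> Dc r0 rn ccr.
have mono n k : D (c n) (c (n + k)%N) + r (n + k)%N <= r n.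
  elim: k => [|k IH]; first by rewrite addn0 metxx// add0r.
  rewrite addnS; have := ccr (n + k)%N.
  by have := met_triangle DM (c (n + k)%N) (c n) (c (n + k).+1); lra.
have mono' n m : (n <= m)%N -> D (c n) (c m) < r n.
  by move=> nm; have := mono n (m - n)%N; rewrite subnKC//; have := r0 m; lra.
have [|x cx] := Dc c.
  move=> e e0; have [|N hN] := @archi_inv (e / 2); first by lra.
  exists N.+1 => m n Nm Nn; have := lt_trans (rn N) (hN N (leqnn _)).
  have := mono' _ _ Nm; have := mono' _ _ Nn.
  by have := met_triangle DM (c N.+1) (c m) (c n); rewrite (metC DM (c m) (c N.+1)); lra.
exists x; split=> // n.
have cS m : D (c m) x <= r m.
  apply/ler_addgt0Pr => z z0; have [N hN] := cx z z0.
  have := hN _ (leq_maxl N m); have := mono' _ _ (leq_maxr N m).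
  by have := met_triangle DM (c (maxn N m)) (c m) x; lra.
have := cS n.+1; have := ccr n.
by have := met_triangle DM (c n.+1) (c n) x; lra.
Qed.

(** If no closure contained a ball, every ball would contain a smaller one missing [C n], and the
    limit of the nested balls would lie in no [C n]. *)
Lemma met_baire (C : nat -> set T) (x0 : T) : met_complete D ->
  (forall x, exists n, C n x) ->
  exists n x r, 0 < r /\ forall y, D x y < r -> met_closure D (C n) y.
Proof.
move=> Dc cov; apply: contrapT => H.
have step n (s : T * R) : exists s' : T * R, 0 < s.2 ->
    [/\ 0 < s'.2, s'.2 < n.+1%:R^-1, D s.1 s'.1 + s'.2 < s.2 &
        forall y, D s'.1 y < s'.2 -> ~ C n y].
  have [s0|] := boolP (0 < s.2); last by move=> _; exists s.
  have [y [sy]] : exists y, D s.1 y < s.2 /\ ~ met_closure D (C n) y.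
    apply: contrapT => h; apply: H; exists n, s.1, s.2; split=> // y sy.
    by apply: contrapT => ny; apply: h; exists y.
  move=> /existsNP[e /not_implyP[e0 h]].
  (* The three bounds keep the ball off [C n], make the radii shrink, and nest the ball strictly in
     the previous one. *)
  exists (y, Num.min (Num.min (e / 2) (n.+1%:R^-1 / 2)) ((s.2 - D s.1 y) / 2)).
  move=> _ /=; move: (n.+1%:R^-1) (invS_gt0 n) => w w0.
  set m := Num.min _ _.
  have [me mn ms] : [/\ m <= e / 2, m <= w / 2 & m <= (s.2 - D s.1 y) / 2].
    by rewrite /m; split; rewrite !ge_min lexx ?orbT.
  split.
  - by rewrite /m !lt_min; apply/andP; split; [apply/andP; split|]; lra.
  - by lra.
  - by lra.
  - by move=> z yz Cz; apply: h; exists z => //; lra.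
pose f n s := projT1 (cid (step n s)).
pose s := fix s n := if n is m.+1 then f m (s m) else (x0, 1 : R).
have sP n : 0 < (s n).2.
  elim: n => [|n IH] //=; rewrite /f; case: cid => s' /= /(_ IH).
  by case.
have sQ n : [/\ (s n.+1).2 < n.+1%:R^-1, D (s n).1 (s n.+1).1 + (s n.+1).2 < (s n).2
   & forall y, D (s n.+1).1 y < (s n.+1).2 -> ~ C n y].
  by rewrite /= /f; case: cid => s' /= /(_ (sP n))[].
have [|n|x [_ xs]] := @nested_balls (fst \o s) (snd \o s) Dc sP.
- by move=> n /=; case: (sQ n).
- by rewrite /=; case: (sQ n).
have [n Cnx] := cov x.
by have [_ _ /(_ x (xs n.+1))] := sQ n.
Qed.

End one_metric.

Lemma seq_continuous_open (S T : Type) (D : S -> S -> R) (D' : T -> T -> R)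
    (f : S -> T) U : is_metric D -> is_metric D' ->
  seq_continuous D D' f -> met_open D' U -> met_open D (f @^-1` U).
Proof.
move=> DM DM' cf oU x /= Ux; apply: contrapT => H.
have step n : exists y, D x y < n.+1%:R^-1 /\ ~ U (f y).
  apply: contrapT => h; apply: H; exists n.+1%:R^-1; first exact: invS_gt0.
  by move=> y xy; apply: contrapT => nU; apply: h; exists y.
have [u uP] := choice step.
have [|e e0 eU] := oU (f x) => //.
have [|N hN] := cf u x _ e e0.
  by apply: met_cvg_inv => n; rewrite (metC DM); case: (uP n).
have [_ []] := uP N; apply: eU; rewrite (metC DM'); exact: hN.
Qed.

End metric.

Record polish_group_metric (R : realType) (G : groupType) (D : G -> G -> R) :
    Prop := PolishGroupMetric {
  pgm_metric : is_metric D;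
  pgm_complete : met_complete D;
  pgm_separable : met_separable D;
  pgm_mul : forall u v x y, met_cvg D u x -> met_cvg D v y ->
    met_cvg D (fun n => u n * v n)%g (x * y)%g;
  pgm_inv : forall u x, met_cvg D u x -> met_cvg D (fun n => (u n)^-1)%g (x^-1)%g
}.

(** * Comparison of two Polish group topologies *)

Section closed_graph.
Context (R : realType) (G : groupType).

Section one_topology.
Context (D : G -> G -> R).
Hypothesis DG : polish_group_metric D.
Let DM := pgm_metric DG.

Lemma met_continuous_mull a : seq_continuous D D (fun x => a * x)%g.
Proof. by move=> u x ux; apply: (pgm_mul DG) => //; exact: met_cvg_cst. Qed.

Lemma met_open_preimage_mull U a :
  met_open D U -> met_open D [set x | U (a * x)%g].
Proof. exact: (seq_continuous_open DM DM (@met_continuous_mull a)). Qed.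

Lemma met_open_ball_mull x a r : met_open D [set y | D x (a * y)%g < r].
Proof. exact: (@met_open_preimage_mull [set y | D x y < r] a (met_open_ball DM (r:=r))). Qed.

Lemma met_open_div (O : set G) p : met_open D O -> O p ->
  exists2 e, 0 < e &
    forall x y, D 1%g x < e -> D 1%g y < e -> O (p * x^-1 * y)%g.
Proof.
move=> oO Op; apply: contrapT => H.
have step n : exists z : G * G, [/\ D 1%g z.1 < n.+1%:R^-1,
    D 1%g z.2 < n.+1%:R^-1 & ~ O (p * z.1^-1 * z.2)%g].
  apply: contrapT => h; apply: H; exists n.+1%:R^-1; first exact: invS_gt0.
  by move=> x y x1 y1; apply: contrapT => nO; apply: h; exists (x, y).
have [z zP] := choice step.
have cvg1 (u : nat -> G) : (forall n, D 1%g (u n) < n.+1%:R^-1) -> met_cvg D u 1%g.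
  by move=> h; apply: (met_cvg_inv) => n; rewrite (metC DM).
have c1 : met_cvg D (fun n => (z n).1) 1%g by apply: cvg1 => n; case: (zP n).
have c2 : met_cvg D (fun n => (z n).2) 1%g by apply: cvg1 => n; case: (zP n).
have := pgm_mul DG (pgm_mul DG (met_cvg_cst DM p) (pgm_inv DG c1)) c2.
rewrite invg1 !mulg1 => c; have [e e0 eO] := oO p Op.
have [N /(_ _ (leqnn N)) hN] := c e e0.
by have [_ _ []] := zP N; apply: eO; rewrite (metC DM).
Qed.

End one_topology.

Section two_topologies.
Context (D D' : G -> G -> R).
Hypothesis DG : polish_group_metric D.
Hypothesis DG' : polish_group_metric D'.
Let DM := pgm_metric DG.
Let DM' := pgm_metric DG'.

(* Countably many translates of any [D']-neighbourhood cover [G], so by Baire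
   the [D]-closure of such a neighbourhood has interior. *)
Lemma almost_open (O : set G) p : met_open D' O -> O p ->
  exists U, [/\ met_open D U, U p & U `<=` met_closure D O].
Proof.
move=> oO Op; have [e e0 eO] := met_open_div DG' oO Op.
pose V := [set x | D' 1%g x < e]; have oV : met_open D' V := met_open_ball DM' (x:=1%g) (r:=e).
have V1 : V 1%g by rewrite /V /= (metxx DM').
have [q qP] := pgm_separable DG'.
have [|n [x [r [r0 xr]]]] := met_baire DM (C := fun n => [set (q n * v)%g | v in V])
    1%g (pgm_complete DG).
  move=> g; have oVg : met_open D' [set x | V (x^-1 * g)%g].
    have -> : [set x | V (x^-1 * g)%g] = (fun x => (x^-1 * g)%g) @^-1` V by [].
    apply: (seq_continuous_open DM' DM') oV => u x ux.
    by apply: (pgm_mul DG' (pgm_inv DG' ux)); exact: met_cvg_cst.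
  have [|d d0 dV] := oVg g; first by rewrite /= mulVg.
  have [n gn] := qP g d d0; exists n, ((q n)^-1 * g)%g; first exact: dV.
  by rewrite mulgA mulgV mul1g.
have [|_ [v Vv <-] xv] := xr x _ r r0; first by rewrite metxx.
(* The ball around [x] contains [q n * v], which a left translation carries to [p]. The same
   translation carries a nearby [q n * v'] to [p * v^-1 * v'], which lies in [O] by the choice of
   [e]. *)
exists [set y | D x (q n * v * p^-1 * y)%g < r]; split.
- exact: (met_open_ball_mull DG).
- by rewrite /= -!mulgA mulVg mulg1.
- move=> y /= /xr cl f f0.
  have oW : met_open D [set w | D y (p * v^-1 * (q n)^-1 * w)%g < f].
    exact: (met_open_ball_mull DG).
  have [|_ [v' Vv' <-] yv'] := met_closureP cl oW.
    rewrite /= -!mulgA (mulgA (q n)^-1%g) mulVg mul1g (mulgA v^-1%g) mulVg mul1g.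
    by rewrite (mulgA p) mulgV mul1g metxx.
  exists (p * v^-1 * v')%g; first exact: eO.
  by move: yv' => /=; rewrite -!mulgA (mulgA (q n)^-1%g) mulVg mul1g.
Qed.

Hypothesis closed_graph : forall u x y, met_cvg D u x -> met_cvg D' u y -> x = y.

(** Points [z n] of the [D']-balls chosen ever [D]-closer to [y] converge to [y] for [D] and to [p]
    for [D'], so the closed graph condition applies to them. *)
Lemma shrinking_limit (o : nat -> G) (t : nat -> R) y p :
  met_cvg D' o p -> (forall n, t n.+1 < n.+1%:R^-1) ->
  (forall n, met_closure D [set z | D' (o n) z < t n] y) -> y = p.
Proof.
move=> op tn cl.
have step n : exists z, D' (o n.+1) z < n.+1%:R^-1 /\ D y z < n.+1%:R^-1.
  have [z oz yz] := cl n.+1 _ (invS_gt0 R n); exists z; split=> //.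
  exact: lt_trans oz (tn n).
have [z zP] := choice step; apply: (closed_graph (u := z)).
  by apply: met_cvg_inv => n; rewrite (metC DM); case: (zP n).
move=> e e0; have [|N hN] := op (e / 2); first by lra.
have [|M hM] := @archi_inv R (e / 2); first by lra.
exists (maxn N M) => n; rewrite geq_max => /andP[Nn Mn].
have := hN n.+1 (leqW Nn); have [zo _] := zP n.
have := lt_trans zo (hM n Mn).
by have := met_triangle DM' (o n.+1) (z n) p; rewrite (metC DM' (z n) (o n.+1)); lra.
Qed.

(* A nested sequence of states, whose balls shrink, yields y near 1 for [D'] with
   g^-1 y near 1 for [D'], so that g = y (g^-1 y)^-1 is near 1 for [D'].  Each ball
   around [gs_a] consists of [D]-limits of points of the [D']-ball around [gs_o],
   and its translate by g^-1 of [D]-limits of points of the one around [gs_o']. *)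
Record game_state := GameState {
  gs_a : G; gs_s : R; gs_o : G; gs_t : R; gs_o' : G; gs_t' : R }.

Let inv (g : G) (s : game_state) := [/\ 0 < gs_s s, 0 < gs_t s, 0 < gs_t' s &
  forall y, D (gs_a s) y < gs_s s ->
    met_closure D [set z | D' (gs_o s) z < gs_t s] y /\
    met_closure D [set z | D' (gs_o' s) z < gs_t' s] (g^-1 * y)%g].

Let small (n : nat) (s s' : game_state) :=
  [/\ gs_s s' < n.+1%:R^-1, gs_t s' < n.+1%:R^-1 & gs_t' s' < n.+1%:R^-1] /\
  [/\ D (gs_a s) (gs_a s') + gs_s s' < gs_s s,
      D' (gs_o s) (gs_o s') + gs_t s' < gs_t s &
      D' (gs_o' s) (gs_o' s') + gs_t' s' < gs_t' s].

Lemma small_radius (b c : R) : 0 < b -> 0 < c ->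
  exists r, [/\ 0 < r, r < b & r < c].
Proof.
move=> b0 c0; exists (Num.min (b / 2) (c / 2)).
have : Num.min (b / 2) (c / 2) <= b / 2 by rewrite ge_min lexx.
have : Num.min (b / 2) (c / 2) <= c / 2 by rewrite ge_min lexx orbT.
have : 0 < Num.min (b / 2) (c / 2) by rewrite lt_min; apply/andP; split; lra.
by move=> *; split; lra.
Qed.

(** One new centre must serve both closures. A point [q] near [a] becomes the new [o]; a point [q']
    approximating [g^-1 * q] becomes the new [o']; and [g * q'], still close to [q], becomes the new
    [a]. By [almost_open], a small ball around it lies in the closure at [q], and its translate by
    [g^-1] in the closure at [q']. *)
Lemma game_step g n s : inv g s -> exists s', inv g s' /\ small n s s'.
Proof.
case: s => a s o t o' t' []/= s0 t0 t'0 H; rewrite /small /=.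
have := invS_gt0 R n; move: (n.+1%:R^-1) => w w0.
have [|cl _] := H a; first by rewrite metxx.
have [q /= oq aq] := cl _ s0.
have [|t2 [t20 t2w t2t]] := small_radius (c := t - D' o q) w0; first by lra.
have [||U1 [oU1 U1q U1cl]] := @almost_open [set z | D' q z < t2] q.
- exact: met_open_ball.
- by move=> /=; rewrite (metxx DM').
have [s1 s10 s1U] := met_openI oU1 (met_open_ball DM (x := a) (r := s)) (conj U1q aq).
have [_ cl'] := H q aq.
have oW : met_open D [set z | D q (g * z)%g < s1].
  exact: (met_open_ball_mull DG).
have [|q' /= oq' qq'] := met_closureP cl' oW.
  by rewrite /= mulgA mulgV mul1g metxx.
have [|t2' [t20' t2w' t2t']] := small_radius (c := t' - D' o' q') w0.
  by lra.
have [||U2 [oU2 U2q U2cl]] := @almost_open [set z | D' q' z < t2'] q'.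
- exact: met_open_ball.
- by move=> /=; rewrite (metxx DM').
have [|s2 s20 s2U] := met_openI
    (met_open_preimage_mull DG (a := g^-1%g) oU2) (met_open_ball DM (x := q) (r := s1)) (x := (g * q')%g).
  by split => //=; rewrite mulgA mulVg mul1g.
have [_ /= agq'] := s1U _ qq'.
have [|s3 [s30 s3w s3s]] := small_radius (c := s - D a (g * q')%g) w0; first by lra.
have [s4 [s40 s4s2 s4s3]] := small_radius s20 s30.
exists (GameState (g * q') s4 q t2 q' t2'); split; split=> //=.
- move=> y ys4; have [U2y qy] := s2U y (lt_trans ys4 s4s2).
  have [U1y _] := s1U y qy; split; first exact: U1cl.
  exact: U2cl.
- by split=> //; lra.
- by split; lra.
Qed.

Lemma id_continuous_at1 e : 0 < e ->
  exists U, [/\ met_open D U, U 1%g & forall g, U g -> D' 1%g g < e].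
Proof.
move=> e0.
have [||r0 r00 rP] := met_open_div DG' (O := [set x | D' 1%g x < e]) (p := 1%g).
- exact: met_open_ball.
- by move=> /=; rewrite (metxx DM').
have [|r r_gt0 rP'] := seq_continuous_open DM' DM' (pgm_inv DG')
    (met_open_ball DM' (x := 1%g) (r := r0)) (x := 1%g).
  by rewrite /= invg1 (metxx DM').
have [||U [oU U1 Ucl]] := @almost_open [set z | D' 1%g z < r] 1%g.
- exact: met_open_ball.
- by move=> /=; rewrite (metxx DM').
have oU' : met_open D [set g | U (g^-1)%g].
  apply: (seq_continuous_open DM DM _ oU) => u x; exact: (pgm_inv DG).
(* Both [1] and [g^-1] lie in [U], so a small ball around [1] starts the game with the two
   [D']-balls centred at [1]. *)
exists [set g | U g^-1%g]; split=> //=; first by rewrite invg1.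
move=> g /= Ug.
have [|s s0 sU] := met_openI oU (met_open_preimage_mull DG (a := g^-1%g) oU) (x := 1%g).
  by split => //=; rewrite mulg1.
have S0 : inv g (GameState 1 s 1 r 1 r).
  by split => //= y /sU[/Ucl ? /Ucl].
pose f n (s : {s | inv g s}) : {s | inv g s} :=
  let: exist s' sP' := cid (game_step n (svalP s)) in exist _ s' sP'.1.
have fP n z : small n (sval z) (sval (f n z)).
  by rewrite /f; case: (cid (game_step n (svalP z))) => s' [].
pose S := fix S n : {s | inv g s} :=
  if n is m.+1 then f m (S m) else exist _ _ S0.
pose T n := sval (S n).
have TP n : inv g (T n) := svalP (S n).
have TS n : small n (T n) (T n.+1) := fP n (S n).
have [|n|n|n|y [ay ays]] := @nested_balls _ _ _ DM (gs_a \o T) (gs_s \o T).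
- exact: (pgm_complete DG).
- by case: (TP n).
- by case: (TS n) => -[].
- by case: (TS n) => _ [].
have [|n|n|n|p [op opt]] := @nested_balls _ _ _ DM' (gs_o \o T) (gs_t \o T).
- exact: (pgm_complete DG').
- by case: (TP n).
- by case: (TS n) => -[].
- by case: (TS n) => _ [].
have [|n|n|n|p' [op' opt']] := @nested_balls _ _ _ DM' (gs_o' \o T) (gs_t' \o T).
- exact: (pgm_complete DG').
- by case: (TP n).
- by case: (TS n) => -[].
- by case: (TS n) => _ [].
have yp : y = p.
  apply: (shrinking_limit op (t := gs_t \o T)) => n.
    by case: (TS n) => -[].
  by have [_ _ _ /(_ y (ays n))[]] := TP n.
have yp' : (g^-1 * y)%g = p'.
  apply: (shrinking_limit op' (t := gs_t' \o T)) => n.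
    by case: (TS n) => -[].
  by have [_ _ _ /(_ y (ays n))[]] := TP n.
(* This is [g = p * p'^-1] in the shape required by [met_open_div]. *)
have -> : g = (1 * p^-1^-1 * p'^-1)%g.
  by rewrite -yp' -yp mul1g invgK invgM invgK mulgA mulgV mul1g.
by apply: rP; apply: rP'; [exact: opt 0%N|exact: opt' 0%N].
Qed.

Lemma closed_graph_open U : met_open D' U -> met_open D U.
Proof.
move=> oU x Ux.
have [|e e0 eU] := met_open_preimage_mull DG' (a := x) oU (x := 1%g).
  by rewrite /= mulg1.
have [V [oV V1 VU]] := id_continuous_at1 e0.
have [|d d0 dV] := met_open_preimage_mull DG (a := x^-1%g) oV (x := x).
  by rewrite /= mulVg.
exists d => // y /dV /VU /eU /=.
by rewrite mulgA mulgV mul1g.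
Qed.

End two_topologies.
End closed_graph.

(** * Families of open sets and metrics that induce them *)

Section metric_space.
Context (R : realType) (T : choiceType) (D : T -> T -> R) (DM : is_metric D).

(** The alias is indexed by the proof that [D] is a metric, so that a metric structure can be
    attached to it. *)
Definition metric_space of is_metric D : Type := T.

HB.instance Definition _ := Choice.on (metric_space DM).
HB.instance Definition _ := @isMetric.Build R (metric_space DM) D
  (metxx DM) (met0_eq DM) (metC DM) (met_triangle DM).

Lemma metric_space_nbhsP (x : metric_space DM) (A : set T) :
  nbhs x A <-> exists2 e, 0 < e & forall y, D x y < e -> A y.
Proof.
split=> [/nbhs_ballP[e /= e0 eA]|[e e0 eA]].
  by exists e => // y xy; apply: eA; rewrite ballEmdist.
by apply/nbhs_ballP; exists e => // y; rewrite ballEmdist /=; exact: eA.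
Qed.

Lemma met_openT : met_open D setT.
Proof. by move=> x _; exists 1. Qed.

Lemma met_open_setI : setI_closed (met_open D).
Proof. by move=> U V; exact: met_openI. Qed.

Lemma met_open_bigcup (F : set (set T)) : F `<=` met_open D ->
  met_open D (\bigcup_(U in F) U).
Proof.
move=> FD x [U FU Ux]; have [e e0 eU] := FD U FU x Ux.
by exists e => // y /eU Uy; exists U.
Qed.

Definition metric_topology : topology T :=
  Topology met_openT met_open_setI met_open_bigcup.

End metric_space.

Section metrized_space.
Context (R : realType) (T : choiceType) (tau : topology T) (D : T -> T -> R).
Hypothesis DM : is_metric D.
Hypothesis tauD : opens tau = met_open D.

Lemma space_nbhsP (x : space tau) (A : set T) :
  nbhs x A <-> exists2 e, 0 < e & forall y, D x y < e -> A y.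
Proof.
split; rewrite nbhsE.
  move=> [U [oU Ux] UA]; have : met_open D U by rewrite -tauD.
  by move=> /(_ x Ux)[e e0 eU]; exists e => // y /eU /UA.
move=> [e e0 eA]; exists [set y | D x y < e] => //; split.
  by rewrite open_spaceE tauD; exact: met_open_ball.
by rewrite /= (metxx DM).
Qed.

Lemma space_cvgP (u : nat -> space tau) (x : space tau) :
  u @ \oo --> x <-> met_cvg D u x.
Proof.
split=> [ux e e0|ux A].
  have /ux[N _ hN] : nbhs x [set y | D y x < e].
    by apply/space_nbhsP; exists e => // y; rewrite (metC DM).
  by exists N => n Nn; exact: hN.
move=> /space_nbhsP[e e0 eA]; have [N hN] := ux e e0.
by exists N => // n /= Nn; apply: eA; rewrite (metC DM); exact: hN.
Qed.

Lemma space_homeomorphic : homeomorphic (space tau) (metric_space DM).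
Proof.
exists (fun x => x), (fun x => x); split => // x A /=.
  by move=> /metric_space_nbhsP h; apply/space_nbhsP.
by move=> /space_nbhsP h; apply/metric_space_nbhsP.
Qed.

Lemma metric_space_complete :
  met_complete D -> complete_uniform (metric_space DM).
Proof.
move=> Dc F FF /cauchyP Fc.
have step n : exists x : metric_space DM, F (ball x n.+1%:R^-1).
  exact/Fc/invS_gt0.
have [u uP] := choice step.
have uD m n : D (u m) (u n) < m.+1%:R^-1 + n.+1%:R^-1.
  have [z []] := filter_ex (filterI (uP m) (uP n)).
  rewrite !ballEmdist /= => um un.
  apply: (le_lt_trans (met_triangle DM z _ _)).
  by apply: ltrD => //; rewrite (metC DM).
have [|x ux] := Dc u.
  move=> e e0; have [|N hN] := @archi_inv R (e / 2); first by rewrite divr_gt0.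
  exists N => m n Nm Nn; rewrite [e]splitr.
  exact: lt_trans (uD m n) (ltrD (hN m Nm) (hN n Nn)).
exists x => A /metric_space_nbhsP[e e0 eA].
have [|N hN] := @archi_inv R (e / 2); first by lra.
have [|M hM] := ux (e / 2); first by lra.
have := hN _ (leq_maxl N M); have := hM _ (leq_maxr N M).
move: (uP (maxn N M)); move: (maxn N M) => k uk kx ke.
apply: filterS uk => y; rewrite ballEmdist /= => uy; apply: eA.
apply: le_lt_trans (met_triangle DM (u k) x y) _; rewrite [e]splitr.
by rewrite (metC DM x (u k)); apply: ltrD => //; exact: lt_trans uy ke.
Qed.

Lemma met_separable_space : met_separable D -> separable_space (space tau).
Proof.
move=> [q qP]; exists (range q); split; first exact/card_image_le.
move=> O [x Ox] oO; have : met_open D O by rewrite -tauD.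
move=> /(_ x Ox)[e e0 eO]; have [n xn] := qP x e e0.
by exists (q n); split; [exact: eO|exists n].
Qed.

Lemma polish_metrized :
  met_complete D -> met_separable D -> polish R (space tau).
Proof.
move=> Dc Ds; split; first exact: met_separable_space.
exists (metric_space DM); split; first exact: space_homeomorphic.
exact: metric_space_complete.
Qed.

End metrized_space.

Lemma polish_metric (R : realType) (T : choiceType) (tau : topology T) (x0 : T) :
  polish R (space tau) -> exists D : T -> T -> R,
    [/\ is_metric D, met_complete D, met_separable D & opens tau = met_open D].
Proof.
move=> [[S [/countable_injP[h hinj] Sd]] [M [[f [g [fK gK cf cg]]] Mc]]].
pose D x y : R := mdist (f x : M) (f y).
have DM : is_metric D.
  split=> [x|x y|x y|y x z]; rewrite /D.
  - exact: mdistxx.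
  - by move=> /mdist_positivity /(can_inj fK).
  - exact: metric_sym.
  - exact: metric_triangle.
have tauD : opens tau = met_open D.
  apply/seteqP; split=> U.
    move=> oU x Ux.
    have /nbhs_ballP[e /= e0 eU] : nbhs (f x) (g @^-1` U).
      by apply: (cg (f x) U); rewrite fK; apply: open_nbhs_nbhs; split.
    exists e => // y xy; have := eU (f y); rewrite /= fK; apply.
    by rewrite ballEmdist.
  move=> oU; rewrite -open_spaceE openE => x Ux; have [e e0 eU] := oU x Ux.
  have fb : nbhs (x : space tau) (f @^-1` ball (f x) e).
    exact: (cf x _ (nbhsx_ballx (f x) e e0)).
  by apply: filterS fb => y; rewrite /= ballEmdist; exact: eU.
exists D; split=> //.
- move=> u uC.
  have uF : cauchy (f \o u @ \oo).
    apply/cauchyP => e e0; have [N hN] := uC e e0.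
    exists (f (u N)); exists N => // n /= Nn.
    by rewrite ballEmdist /=; exact: hN.
  have [y fuy] := Mc _ _ uF; exists (g y) => e e0.
  have /fuy[N _ hN] : nbhs y (ball y e) by exact: nbhsx_ballx.
  exists N => n /hN /=; rewrite ballEmdist /D /= gK.
  by rewrite metric_sym.
(* The dense set as a sequence: [q n] is the point of [S] that the injection [h] numbers [n], and
   [x0] if there is none. *)
- exists (fun n => xget x0 [set x | S x /\ h x = n]) => x e e0.
  have oB : @open (space tau) [set y | D x y < e].
    by rewrite open_spaceE tauD; exact: met_open_ball.
  have [|y [xy Sy]] := Sd _ _ oB; first by exists x; rewrite /= (metxx DM).
  exists (h y); have [Sz] := @xgetPex _ x0 [set z | S z /\ h z = h y] (ex_intro _ y (conj Sy erefl)).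
  set z := xget _ _ => hz.
  by rewrite (hinj z y) ?inE.
Qed.

Lemma cvg_continuous2 (R : realType) (T : choiceType) (tau : topology T)
    (D : T -> T -> R) (op : T -> T -> T) :
  is_metric D -> opens tau = met_open D ->
  (forall u v x y, met_cvg D u x -> met_cvg D v y ->
    met_cvg D (fun n => op (u n) (v n)) (op x y)) <->
  continuous (fun p : space tau * space tau => op p.1 p.2 : space tau).
Proof.
move=> DM tauD; split=> [H [x y] A|H u v x y ux vy].
  move=> /(space_nbhsP DM tauD)[e e0 eA].
  apply: contrapT => nA.
  have step n : exists z : T * T, [/\ D x z.1 < n.+1%:R^-1,
      D y z.2 < n.+1%:R^-1 & ~ A (op z.1 z.2)].
    apply: contrapT => h; apply: nA.
    exists ([set z | D x z < n.+1%:R^-1], [set z | D y z < n.+1%:R^-1]).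
      by split; apply/(space_nbhsP DM tauD); exists n.+1%:R^-1.
    move=> [a b] [/= xa yb]; apply: contrapT => nA; apply: h.
    by exists (a, b).
  have [z zP] := choice step.
  have [||N /(_ N (leqnn N))] := H (fst \o z) (snd \o z) x y _ _ e e0.
  - by apply: met_cvg_inv => n; rewrite (metC DM); case: (zP n).
  - by apply: met_cvg_inv => n; rewrite (metC DM); case: (zP n).
  - by rewrite (metC DM) => /eA; case: (zP N).
move/(space_cvgP DM tauD) in ux; move/(space_cvgP DM tauD) in vy.
apply/(space_cvgP DM tauD).
have /= := cvg_comp _ _ (cvg_pair ux vy) (H (x, y)).
exact.
Qed.

Lemma cvg_continuous1 (R : realType) (T : choiceType) (tau : topology T)
    (D : T -> T -> R) (op : T -> T) :
  is_metric D -> opens tau = met_open D ->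
  (forall u x, met_cvg D u x -> met_cvg D (fun n => op (u n)) (op x)) <->
  continuous (fun x : space tau => op x : space tau).
Proof.
move=> DM tauD; split=> [H x A|H u x ux].
  move=> /(space_nbhsP DM tauD)[e e0 eA].
  have [|d d0 dA] := seq_continuous_open DM DM H
    (met_open_ball DM (x := op x) (r := e)) (x := x).
    by rewrite /= (metxx DM).
  by apply/(space_nbhsP DM tauD); exists d => // y /dA /eA.
move/(space_cvgP DM tauD) in ux; apply/(space_cvgP DM tauD).
exact: cvg_comp ux (H x).
Qed.

Section polish_group.
Context (R : realType) (G : groupType).

Lemma polish_group_metricP (tau : topology G) (D : G -> G -> R) :
  is_metric D -> opens tau = met_open D -> polish_group_metric D ->
  polish_group_topology R tau.
Proof.
move=> DM tauD [_ Dc Ds Dm Di]; split; last exact: polish_metrized tauD Dc Ds.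
split; first by apply/(cvg_continuous2 (fun x y => (x * y)%g) DM tauD).
by apply/(cvg_continuous1 (fun x => x^-1%g) DM tauD).
Qed.

Lemma polish_group_topologyP (tau : topology G) :
  polish_group_topology R tau ->
  exists2 D : G -> G -> R, polish_group_metric D & opens tau = met_open D.
Proof.
move=> [[tm ti] /(polish_metric 1%g)[D [DM Dc Ds tauD]]]; exists D => //.
split=> //.
  by apply/(cvg_continuous2 (fun x y => (x * y)%g) DM tauD).
by apply/(cvg_continuous1 (fun x => x^-1%g) DM tauD).
Qed.

End polish_group.

(** * Real-valued probabilities *)

Lemma measurableY (d : measure_display) (X : measurableType d) (A B : set X) :
  measurable A -> measurable B -> measurable (A `+` B).
Proof. by move=> mA mB; apply: measurableU; exact: measurableD. Qed.

Ltac meas := repeat first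
  [ assumption
  | match goal with H : forall _, measurable _ |- measurable _ => apply: H end
  | exact: measurableT | exact: measurable0
  | apply: measurableI | apply: measurableU | apply: measurableD
  | apply: measurableC | apply: measurableY
  | apply: measurable_nspreimage | apply: measurable_nsinv_preimage
  | apply: bigcup_measurable => ? _ | apply: bigcapT_measurable => ? ].

Ltac sets := rewrite /setY; intros ? => /=; tauto.

Section prob.
Context (d : measure_display) (X : measurableType d) (R : realType).
Variable mu : probability X R.

(** Real values put measure estimates within reach of [lra]. *)
Definition pr (A : set X) : R := fine (mu A).

Lemma prE A : measurable A -> mu A = (pr A)%:E.
Proof. by move=> mA; rewrite /pr fineK// fin_num_measure. Qed.

Lemma pr_ge0 A : 0 <= pr A.
Proof. exact: fine_ge0. Qed.

Lemma pr_eq0 A : measurable A -> mu A = 0%E <-> pr A = 0.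
Proof. by move=> mA; rewrite prE//; split=> [[]|->]. Qed.

Lemma pr_set0 : pr set0 = 0.
Proof. by rewrite /pr measure0. Qed.

Lemma pr_setT : pr setT = 1.
Proof. by rewrite /pr probability_setT. Qed.

Lemma pr_le A B : measurable A -> measurable B -> A `<=` B -> pr A <= pr B.
Proof.
move=> mA mB AB; rewrite -lee_fin -!prE//.
by apply: le_measure; rewrite ?inE.
Qed.

Lemma prID A B : measurable A -> measurable B ->
  pr A = pr (A `&` B) + pr (A `\` B).
Proof.
move=> mA mB; apply: EFin_inj; rewrite EFinD -!prE; [|by meas..].
by rewrite (measureDI mu mA mB) addeC.
Qed.

Lemma prU_le A B : measurable A -> measurable B ->
  pr (A `|` B) <= pr A + pr B.
Proof.
move=> mA mB; rewrite (@prID (A `|` B) A)//; last by meas.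
rewrite setUK lerD2l; apply: pr_le; meas; sets.
Qed.

Lemma pr_subU A B C : measurable A -> measurable B -> measurable C ->
  A `<=` B `|` C -> pr A <= pr B + pr C.
Proof.
move=> mA mB mC ABC; apply: le_trans (prU_le mB mC); apply: pr_le; meas.
Qed.

Lemma pr_eq0_sub A B : measurable A -> measurable B -> A `<=` B -> pr B = 0 ->
  pr A = 0.
Proof.
move=> mA mB AB B0; apply/eqP; rewrite eq_le pr_ge0 andbT -B0; exact: pr_le.
Qed.

Lemma prY_triangle B A C : measurable A -> measurable B -> measurable C ->
  pr (A `+` C) <= pr (A `+` B) + pr (B `+` C).
Proof.
move=> mA mB mC; apply: pr_subU; meas.
move=> x; rewrite /setY /=; have [|] := pselect (B x); tauto.
Qed.

Lemma prD_le A B : measurable A -> measurable B -> pr A - pr B <= pr (A `\` B).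
Proof.
move=> mA mB; rewrite (prID mA mB).
have : pr (A `&` B) <= pr B by apply: pr_le; meas; sets.
by lra.
Qed.

Lemma pr_setDS A B : measurable A -> measurable B -> B `<=` A ->
  pr (A `\` B) = pr A - pr B.
Proof. by move=> mA mB BA; rewrite (prID mA mB) setIidr//; ring. Qed.

Lemma prY_dist A B : measurable A -> measurable B ->
  `|pr A - pr B| <= pr (A `+` B).
Proof.
move=> mA mB; rewrite ler_norml; have := prD_le mA mB; have := prD_le mB mA.
have : pr (A `\` B) <= pr (A `+` B) by apply: pr_le; meas; sets.
have : pr (B `\` A) <= pr (A `+` B) by apply: pr_le; meas; sets.
by move=> *; apply/andP; split; lra.
Qed.

Lemma prIY_dist A B C : measurable A -> measurable B -> measurable C ->
  `|pr (A `&` B) - pr (A `&` C)| <= pr (B `+` C).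
Proof.
move=> mA mB mC; apply: le_trans (prY_dist _ _) _; meas.
by apply: pr_le; meas; sets.
Qed.

Lemma pr_nondecreasing_cvg (F : nat -> set X) e :
  (forall n, measurable (F n)) -> {homo F : m n / (m <= n)%N >-> m `<=` n} -> 0 < e ->
  exists N, forall n, (N <= n)%N -> pr ((\bigcup_k F k) `\` F n) < e.
Proof.
move=> mF hF e0; have mU : measurable (\bigcup_k F k) by meas.
have c : mu (F n) @[n --> \oo] --> mu (\bigcup_k F k).
  by apply: nondecreasing_cvg_mu => // m n mn; apply/subsetPset; exact: hF.
have c' : pr (F n) @[n --> \oo] --> pr (\bigcup_k F k).
  by rewrite (prE mU) in c; move/fine_cvg: c.
move/cvgrPdist_lt : c' => /(_ e e0)[N _ hN]; exists N => n /hN /=.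
rewrite pr_setDS//; last exact: bigcup_sup.
exact/le_lt_trans/ler_norm.
Qed.

Lemma pr_bigcup_tail (F : nat -> set X) e :
  (forall n, measurable (F n)) -> 0 < e ->
  exists N, pr ((\bigcup_k F k) `\` \bigcup_(k in `I_N) F k) < e.
Proof.
move=> mF e0.
have [||N hN] := @pr_nondecreasing_cvg (fun n => \bigcup_(k in `I_n) F k) e _ _ e0.
- by move=> n; meas.
- by move=> m n mn; apply: bigcup_subset => k /= km; exact: leq_trans km mn.
exists N; apply: le_lt_trans (hN N (leqnn N)).
have mU : measurable (\bigcup_k \bigcup_(i in `I_k) F i).
  by apply: bigcup_measurable => k _; meas.
apply: pr_le; meas.
by move=> x [[k _ Fk] nF]; split => //; exists k.+1 => //; exists k => //=.
Qed.

Lemma pr_nonincreasing_cvg (F : nat -> set X) e :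
  (forall n, measurable (F n)) -> {homo F : m n / (m <= n)%N >-> n `<=` m} -> 0 < e ->
  exists N, forall n, (N <= n)%N -> pr (F n `\` \bigcap_k F k) < e.
Proof.
move=> mF hF e0.
have [||N hN] := @pr_nondecreasing_cvg (fun n => ~` F n) e _ _ e0.
- by move=> n; meas.
- by move=> m n /hF; exact: subsetC.
exists N => n /hN; rewrite -setC_bigcap.
by congr (pr _ < _); rewrite !setDE setCK setIC.
Qed.

Lemma pr_bigcup_geom (F : nat -> set X) e : (forall n, measurable (F n)) ->
  (forall n, pr (F n) <= e * 2^-1 ^+ n.+1) -> pr (\bigcup_n F n) <= e.
Proof.
move=> mF he; have mU : measurable (\bigcup_n F n) by meas.
have e0 : 0 <= e by have := he 0%N; have := pr_ge0 (F 0%N); rewrite expr1; lra.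
have fin N : pr (\bigcup_(k in `I_N) F k) <= e * (1 - 2^-1 ^+ N).
  elim: N => [|N IH].
    rewrite (_ : \bigcup_(k in _) _ = set0) ?pr_set0 ?expr0 ?subrr ?mulr0//.
    by rewrite -subset0 => x [].
  apply: (@le_trans _ _ (pr (\bigcup_(k in `I_N) F k) + pr (F N))).
    apply: pr_subU; meas => x [k /= kN Fk].
    move: kN; rewrite ltnS leq_eqVlt => /orP[/eqP <-|kN]; [by right|left].
    by exists k.
  by have := he N; rewrite exprS; move: IH; lra.
apply/ler_addgt0Pr => f f0.
have [N hN] := pr_bigcup_tail mF f0.
have mV : measurable (\bigcup_(k in `I_N) F k) by meas.
have := prD_le mU mV; have := fin N.
have : 0 <= e * 2^-1 ^+ N by rewrite mulr_ge0// exprn_ge0.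
by lra.
Qed.

Lemma pr_bigcup0 (F : nat -> set X) : (forall n, measurable (F n)) ->
  (forall n, pr (F n) = 0) -> pr (\bigcup_n F n) = 0.
Proof.
move=> mF F0; apply/eqP; rewrite eq_le pr_ge0 andbT.
by apply: pr_bigcup_geom => // n; rewrite F0 mul0r.
Qed.

Lemma prU0 A B : measurable A -> measurable B -> pr A = 0 -> pr B = 0 ->
  pr (A `|` B) = 0.
Proof.
move=> mA mB A0 B0; apply/eqP; rewrite eq_le pr_ge0 andbT.
by have := prU_le mA mB; rewrite A0 B0; lra.
Qed.

End prob.

Lemma geom_lt (R : realType) (e : R) : 0 < e ->
  exists N, forall n, (N <= n)%N -> 2^-1 ^+ n < e.
Proof.
move=> /archi_inv[N hN]; exists N => n /hN; apply: le_lt_trans.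
rewrite exprVn lef_pV2 ?posrE ?exprn_gt0//.
by rewrite -natrX ler_nat ltn_expl.
Qed.

(** * Coding standard Borel spaces by sets of natural numbers *)

Lemma sigma_algebra_ind (T : Type) (G : set (set T)) (P : set T -> Prop) :
  P set0 -> (forall A, P A -> P (~` A)) ->
  (forall F : nat -> set T, (forall n, P (F n)) -> P (\bigcup_n F n)) ->
  G `<=` P -> <<s G >> `<=` P.
Proof.
move=> P0 PC PU GP; apply: smallest_sub => //.
by split=> // A PA; rewrite setTD; exact: PC.
Qed.

Definition cylinders : set (set (set nat)) :=
  range (fun j => [set w : set nat | w j]).

HB.instance Definition _ := isPointed.Build (set nat) set0.
(** The Cantor space with its Borel sets, a point being written as a subset of [nat]. *)
Definition codes := g_sigma_algebraType cylinders.

Lemma measurable_cylinder j : measurable ([set w : set nat | w j] : set codes).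
Proof. by apply: sub_sigma_algebra; exists j. Qed.

Section coding.
Context (d : measure_display) (X : measurableType d) (R : realType).
Variable mu : probability X R.
Local Notation P := (pr mu).

Definition code (B : nat -> set X) (x : X) : codes := [set j | B j x].

(** Separability would give the first two conditions; the measurable range comes from completeness
    of the metric, and it is what allows maps into [codes] to be lifted to [X]. *)
Definition coding (B : nat -> set X) :=
  [/\ @measurable d X = <<s range B >>,
      injective (code B) & measurable (range (code B))].

Lemma measurable_code_fun (e : X -> codes) :
  (forall j, measurable [set x | e x j]) -> measurable_fun setT e.
Proof.
move=> me; apply: (@measurability _ _ X codes setT e cylinders) => // _ [_ [j _ <-] <-].
by rewrite setTI; exact: me.
Qed.

End coding.

(** [B j] is the ball of radius [2^-1 ^+ n] around [q i], where [j] encodes [(n, i)]. The codes are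
    cut out of [codes] by countably many conditions on pairs of balls. *)
Lemma standard_borel_coding (d : measure_display) (X : measurableType d)
    (R : realType) (x0 : X) :
  standard_borel R X -> exists B : nat -> set X, coding B.
Proof.
move=> [tau [/(polish_metric x0)[D [DM Dc [q qP] tauD]] XE]].
pose dec (j : nat) : nat * nat := odflt (0, 0)%N (unpickle j).
pose pk n i : nat := pickle ((n, i) : nat * nat).
pose r j : R := 2^-1 ^+ (dec j).1; pose c j := q (dec j).2.
pose B j := [set y | D (c j) y < r j].
have Bdec n i : exists j, r j = 2^-1 ^+ n /\ c j = q i.
  by exists (pk n i); rewrite /r /c /dec /pk pickleK.
have r0 j : 0 < r j by rewrite /r exprn_gt0.
have small e : 0 < e -> exists n, 2^-1 ^+ n < e :> R.
  by move=> /geom_lt[n /(_ n (leqnn n))]; exists n.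
have dense x e : 0 < e -> exists j, r j < e /\ D (c j) x < r j.
  move=> /small[n ne]; have [i xi] := qP x (2^-1 ^+ n) ltac:(by rewrite exprn_gt0).
  by have [j [rj cj]] := Bdec n i; exists j; rewrite rj cj (metC DM).
have mB : @measurable d X = <<s range B >>.
  rewrite XE; apply/seteqP; split.
    apply: smallest_sub; first exact: smallest_sigma_algebra.
    move=> U; rewrite tauD => oU.
    have -> : U = \bigcup_j (if `[< B j `<=` U >] then B j else set0).
      apply/seteqP; split=> [x Ux|x [j _]]; last first.
        by case: ifPn => // /asboolP; apply.
      have [e e0 eU] := oU x Ux.
      have [|j [rj cj]] := dense x (e / 2); first by lra.
      exists j => //; case: ifPn => // /asboolP[] y; rewrite /B /= => cy.
      apply: eU; have := met_triangle DM (c j) x y; rewrite (metC DM x (c j)).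
      by lra.
    apply: sigma_algebra_bigcup => j; case: ifPn => _; last exact: sigma_algebra0.
    by apply: sub_sigma_algebra; exists j.
  apply: smallest_sub; first exact: smallest_sigma_algebra.
  move=> _ [j _ <-]; apply: sub_sigma_algebra; rewrite tauD.
  exact: met_open_ball.
have near_code (W : set nat) x :
    (forall j k, W j -> W k -> D (c j) (c k) < r j + r k) ->
    (forall j, W j <-> exists2 k, W k & D (c j) (c k) + 2 * r k < r j) ->
    (forall n, exists i, W (pk n i)) ->
    (forall j, W j -> D (c j) x <= r j) -> code B x = W.
  move=> W2 W3 W1 Wx; apply/seteqP; split=> j; rewrite /code /B /=.
    move=> jx; apply/W3.
    (* A ball [k] of [W] satisfies [D (c k) x <= r k], so [D (c j) (c k) + 2 * r k] is at most
       [D (c j) x + 3 * r k]; hence the third. *)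
    have [|n nj] := small ((r j - D (c j) x) / 3); first by lra.
    have [i Wi] := W1 n; exists (pk n i) => //.
    have := Wx _ Wi; have -> : r (pk n i) = 2^-1 ^+ n by rewrite /r /dec /pk pickleK.
    have := met_triangle DM x (c j) (c (pk n i)).
    rewrite (metC DM x); move: (D (c (pk _ _)) x) => t.
    by move: nj; move: (2^-1 ^+ n) => t'; lra.
  move=> /W3[k Wk]; have := Wx k Wk; have := met_triangle DM (c k) (c j) x.
  by have := r0 k; lra.
(* Compatibility makes the centres of the balls of radius [2^-1 ^+ n] in [W] a Cauchy sequence;
   completeness is used here. *)
have cl W : (forall j k, W j -> W k -> D (c j) (c k) < r j + r k) ->
    (forall n, exists i, W (pk n i)) ->
    exists x, forall j, W j -> D (c j) x <= r j.
  move=> W2 W1; have [i iP] := choice W1.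
  pose k n := pk n (i n).
  have rk n : r (k n) = 2^-1 ^+ n by rewrite /r /dec /pk pickleK.
  have kW n : W (k n) by exact: iP.
  have [|x ux] := Dc (c \o k).
    move=> e e0; have [|N hN] := @geom_lt R (e / 2); first by lra.
    exists N => m n Nm Nn; have := W2 _ _ (kW m) (kW n); rewrite !rk.
    by have := hN m Nm; have := hN n Nn; move: (2^-1 ^+ n) (2^-1 ^+ m) => s t /=; lra.
  exists x => j Wj; apply/ler_addgt0Pr => e e0.
  have [|N hN] := @geom_lt R (e / 2); first by lra.
  have [|M hM] := ux (e / 2); first by lra.
  pose n := maxn N M; have := hN n (leq_maxl _ _); have := hM n (leq_maxr _ _).
  have := W2 _ _ Wj (kW n); rewrite rk /=; move: (2^-1 ^+ n) => t.
  by have := met_triangle DM (c (k n)) (c j) x; lra.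
exists B; split=> //.
- move=> x y exy; apply: (met0_eq DM); apply/eqP; rewrite eq_le met_ge0// andbT.
  apply/ler_addgt0Pr => e e0; rewrite add0r.
  have [|j [rj cj]] := dense x (e / 2); first by lra.
  have : code B y j by rewrite -exy.
  rewrite /code /B /= => cj'.
  by have := met_triangle DM (c j) x y; rewrite (metC DM x (c j)); lra.
(* [W] is the code of a point iff it contains balls of every radius, any two
   compatible, and contains a ball iff it contains one well inside it. *)
have -> : range (code B) =
    (\bigcap_n \bigcup_i [set W : set nat | W (pk n i)]) `&`
    (\bigcap_j \bigcap_(k in [set k | ~ D (c j) (c k) < r j + r k])
       ~` ([set W : set nat | W j] `&` [set W : set nat | W k])) `&`
    (\bigcap_j ~` ([set W : set nat | W j] `+`
       \bigcup_(k in [set k | D (c j) (c k) + 2 * r k < r j])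
         [set W : set nat | W k])).
  apply/seteqP; split.
    move=> _ [x _ <-]; split; [split|].
    - move=> n _; have [i xi] := qP x (2^-1 ^+ n) ltac:(by rewrite exprn_gt0).
      by exists i => //; rewrite /code /B /= /r /c /dec /pk pickleK /= (metC DM).
    - move=> j _ k /= jk [xj xk]; apply: jk.
      have := met_triangle DM x (c j) (c k); rewrite (metC DM x).
      by move: xj xk; rewrite /code /B /=; lra.
    - move=> j _; rewrite /setY /= => -[[xj h]|[[k /= jk xk] nxj]].
        have [|k [rk ck]] := dense x ((r j - D (c j) x) / 3).
          by move: xj; rewrite /code /B /=; lra.
        apply: h; exists k => //=.
        have := met_triangle DM x (c j) (c k); rewrite (metC DM x).
        by move: xj; rewrite /code /B /=; lra.
      apply: nxj; move: xk; rewrite /code /B /=.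
      by have := met_triangle DM (c k) (c j) x; have := r0 k; lra.
  move=> W [[W1 W2] W3].
  have {}W1 n : exists i, W (pk n i).
    by have [i _ Wi] := W1 n I; exists i.
  have {}W2 j k : W j -> W k -> D (c j) (c k) < r j + r k.
    by move=> Wj Wk; apply: contrapT => /(W2 j I k); apply.
  have {}W3 j : W j <-> exists2 k, W k & D (c j) (c k) + 2 * r k < r j.
    have := W3 j I; rewrite /setY /= => /not_orP[/not_andP h1 /not_andP h2].
    split=> [Wj|[k Wk kj]].
      by case: h1 => // /contrapT[k kj Wk]; exists k.
    by case: h2 => [|/contrapT//]; case; exists k.
  by have [x xW] := cl W W2 W1; exists x => //; exact: near_code.
apply: measurableI; [apply: measurableI|].
- apply: bigcapT_measurable => n; apply: bigcup_measurable => i _.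
  exact: measurable_cylinder.
- apply: bigcapT_measurable => j; rewrite -setC_bigcup; apply: measurableC.
  apply: bigcup_measurable => k _.
  by apply: measurableI; exact: measurable_cylinder.
- apply: bigcapT_measurable => j; apply: measurableC; apply: measurableY.
    exact: measurable_cylinder.
  by apply: bigcup_measurable => k _; exact: measurable_cylinder.
Qed.

(** * Almost everywhere statements and realization by point maps *)

Section point_realization.
Context (d : measure_display) (X : measurableType d) (R : realType).
Variable mu : probability X R.
Local Notation P := (pr mu).

Lemma measurable_preimageT (d' : measure_display) (Y : measurableType d')
    (f : X -> Y) A :
  measurable_fun setT f -> measurable A -> measurable (f @^-1` A).
Proof. by move=> mf mA; rewrite -[X in measurable X]setTI; exact: mf. Qed.

Definition almost (Q : X -> Prop) :=
  exists N, [/\ measurable N, P N = 0 & forall x, ~ N x -> Q x].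

Lemma almost_forall (Q : nat -> X -> Prop) :
  (forall n, almost (Q n)) -> almost (fun x => forall n, Q n x).
Proof.
move=> /choice[N NP]; exists (\bigcup_n N n); split.
- by apply: bigcup_measurable => n _; case: (NP n).
- by apply: pr_bigcup0 => n; case: (NP n).
- move=> x Nx n; have [_ _] := NP n; apply => Nnx; apply: Nx; by exists n.
Qed.

Lemma almost_and (Q Q' : X -> Prop) :
  almost Q -> almost Q' -> almost (fun x => Q x /\ Q' x).
Proof.
move=> [N [mN N0 NQ]] [M [mM M0 MQ]]; exists (N `|` M); split.
- exact: measurableU.
- exact: prU0.
- by move=> x /not_orP[/NQ ? /MQ].
Qed.

Lemma almost_impl (Q Q' : X -> Prop) :
  (forall x, Q x -> Q' x) -> almost Q -> almost Q'.
Proof. by move=> h [N [mN N0 NQ]]; exists N; split=> // x /NQ /h. Qed.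

Lemma almost_pr_eq0 A : measurable A -> almost (fun x => ~ A x) -> P A = 0.
Proof.
move=> mA [N [mN N0 NA]]; apply: (pr_eq0_sub mA mN) N0.
by move=> x Ax; apply: contrapT => /NA.
Qed.

Lemma pr_eq0_almost A : measurable A -> P A = 0 -> almost (fun x => ~ A x).
Proof. by move=> mA A0; exists A. Qed.

Lemma pr_le_almost A B : measurable A -> measurable B ->
  almost (fun x => A x -> B x) -> P A <= P B.
Proof.
move=> mA mB [N [mN N0 NAB]]; rewrite -[leRHS]addr0 -N0.
apply: pr_subU => // x Ax; have [Nx|/NAB] := pselect (N x); first by right.
by move/(_ Ax); left.
Qed.

Lemma pr_eq_almost A B : measurable A -> measurable B ->
  almost (fun x => A x <-> B x) -> P A = P B.
Proof.
move=> mA mB h; apply/eqP; rewrite eq_le; apply/andP; split;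
  by apply: pr_le_almost => //; apply: almost_impl h => x [].
Qed.

Lemma prY_almost A B : measurable A -> measurable B -> P (A `+` B) = 0 <->
  almost (fun x => A x <-> B x).
Proof.
move=> mA mB; split=> [/pr_eq0_almost|] h.
  apply: almost_impl (h (measurableY mA mB)) => x /not_orP[/not_andP a /not_andP b].
  by split=> xx; [case: a => // /contrapT|case: b => // /contrapT].
rewrite -(pr_set0 mu); apply: pr_eq_almost; meas; apply: almost_impl h => x.
by rewrite /setY /=; tauto.
Qed.

Definition null_preserving (T : X -> X) :=
  forall A, measurable A -> P A = 0 -> P (T @^-1` A) = 0.

Lemma almost_preimage (T : X -> X) (Q : X -> Prop) :
  measurable_fun setT T -> null_preserving T ->
  almost Q -> almost (fun x => Q (T x)).
Proof.
move=> mT nT [N [mN N0 NQ]]; exists (T @^-1` N); split.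
- exact: measurable_preimageT.
- exact: nT.
- by move=> x /= /NQ.
Qed.

Lemma nsfun_null_preserving (f : nsbij mu) : null_preserving (nsfun f).
Proof.
move=> A mA A0; apply/(pr_eq0 mu (measurable_nspreimage f mA)).
by apply/(nonsingular f mA)/(pr_eq0 mu mA).
Qed.

Lemma nsinv_null_preserving (f : nsbij mu) : null_preserving (nsinv f).
Proof. exact: (@nsfun_null_preserving (nsinverse f)). Qed.

Lemma ns_ae_eq_almost (f g : nsbij mu) :
  ns_ae_eq f g <-> almost (fun x => nsfun f x = nsfun g x).
Proof.
split=> [/ns_ae_eqP[N [mN /(pr_eq0 mu mN) N0 h]]|[N [mN /(pr_eq0 mu mN) N0 h]]].
  by exists N.
by apply/ns_ae_eqP; exists N.
Qed.

(* Cut down to the points all of whose iterates behave well; the map is the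
   identity on the null remainder. *)
Lemma almost_bijection (T S : X -> X) :
  measurable_fun setT T -> measurable_fun setT S ->
  null_preserving T -> null_preserving S ->
  almost (fun x => S (T x) = x) -> almost (fun x => T (S x) = x) ->
  exists f : nsbij mu, almost (fun x => nsfun f x = T x).
Proof.
move=> mT mS nT nS ST TS.
have [N [mN N0 NQ]] := almost_and ST TS.
have mI (U : X -> X) n : measurable_fun setT U -> measurable_fun setT (iter n U).
  by move=> mU; elim: n => [|n]; [exact: measurable_id|exact: measurableT_comp mU].
pose Z := (\bigcap_n (iter n T @^-1` ~` N)) `&` (\bigcap_n (iter n S @^-1` ~` N)).
have mZ : measurable Z.
  apply: measurableI; apply: bigcapT_measurable => n;
    by apply: (measurable_preimageT (mI _ _ _)) => //; exact: measurableC.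
have aZ : almost Z.
  have aI (U : X -> X) : measurable_fun setT U -> null_preserving U ->
      almost (fun x => forall n, ~ N (iter n U x)).
    move=> mU nU; apply: almost_forall => n; elim: n => [|n IH]; first by exists N.
    apply: almost_impl (almost_preimage mU nU IH) => x.
    by rewrite -iterSr.
  apply: almost_impl (almost_and (aI T mT nT) (aI S mS nS)) => x [h1 h2].
  by split=> n _ /=.
have ZN x : Z x -> ~ N x by move=> [/(_ 0%N I)].
have ZT x : Z x -> Z (T x).
  move=> Zx; have [Z1 Z2] := Zx; split=> n _ /=.
    by have := Z1 n.+1 I; rewrite /= -iterS iterSr.
  case: n => [|n]; first exact: (Z1 1%N I).
  by rewrite iterSr (NQ x (ZN x Zx)).1; exact: (Z2 n I).
have ZS x : Z x -> Z (S x).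
  move=> Zx; have [Z1 Z2] := Zx; split=> n _ /=; last first.
    by have := Z2 n.+1 I; rewrite /= -iterS iterSr.
  case: n => [|n]; first exact: (Z2 1%N I).
  by rewrite iterSr (NQ x (ZN x Zx)).2; exact: (Z1 n I).
pose f x := if `[< Z x >] then T x else x.
pose g x := if `[< Z x >] then S x else x.
have fZ x : Z x -> f x = T x by move=> Zx; rewrite /f; case: ifPn => // /asboolP.
have gZ x : Z x -> g x = S x by move=> Zx; rewrite /g; case: ifPn => // /asboolP.
have fN x : ~ Z x -> f x = x by move=> Zx; rewrite /f; case: ifPn => // /asboolP.
have gN x : ~ Z x -> g x = x by move=> Zx; rewrite /g; case: ifPn => // /asboolP.
have fK : cancel f g.
  move=> x; have [Zx|nZ] := pselect (Z x); last by rewrite fN// gN.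
  by rewrite fZ// gZ ?(NQ x (ZN x Zx)).1//; exact: ZT.
have gK : cancel g f.
  move=> x; have [Zx|nZ] := pselect (Z x); last by rewrite gN// fN.
  by rewrite gZ// fZ ?(NQ x (ZN x Zx)).2//; exact: ZS.
have preE (U h : X -> X) A : (forall x, Z x -> h x = U x) ->
    (forall x, ~ Z x -> h x = x) ->
    h @^-1` A = (Z `&` U @^-1` A) `|` (~` Z `&` A).
  move=> h1 h2; apply/seteqP; split=> x /=.
    by have [Zx|nZ] := pselect (Z x); [rewrite h1//; left|rewrite h2//; right].
  by move=> [[Zx]|[Zx]]; [rewrite h1|rewrite h2].
have mh (U h : X -> X) : measurable_fun setT U -> (forall x, Z x -> h x = U x) ->
    (forall x, ~ Z x -> h x = x) -> measurable_fun setT h.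
  move=> mU h1 h2 _ A mA; rewrite setTI (preE U)//.
  by have := measurable_preimageT mU mA => ?; meas.
have mf : measurable_fun setT f := mh T f mT fZ fN.
have mg : measurable_fun setT g := mh S g mS gZ gN.
have nh (U h : X -> X) : measurable_fun setT U -> null_preserving U ->
    (forall x, Z x -> h x = U x) ->
    (forall x, ~ Z x -> h x = x) -> null_preserving h.
  move=> mU nU h1 h2 A mA A0; rewrite (preE U)//.
  have mUA := measurable_preimageT mU mA.
  apply: prU0; meas.
    by apply: (pr_eq0_sub _ mUA) (nU A mA A0); meas; sets.
  by apply: (pr_eq0_sub _ mA) A0; meas; sets.
have nf : null_preserving f := nh T f mT nT fZ fN.
have ng : null_preserving g := nh S g mS nS gZ gN.
have ns A : measurable A -> mu A = 0%E <-> mu (f @^-1` A) = 0%E.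
  move=> mA; have mfA := measurable_preimageT mf mA.
  split=> /(pr_eq0 mu _) A0; apply/pr_eq0 => //; first by apply: nf => //; apply: A0.
  have -> : A = g @^-1` (f @^-1` A) by apply/seteqP; split=> x /=; rewrite gK.
  by apply: ng => //; exact: A0.
exists (NSBij fK gK mf mg ns) => /=.
by apply: almost_impl aZ => x /fZ.
Qed.

Variable B : nat -> set X.
Hypothesis codingB : coding B.

Lemma measurable_codingB j : measurable (B j).
Proof. by case: codingB => -> _ _; apply: sub_sigma_algebra; exists j. Qed.

Lemma measurable_code : measurable_fun setT (code B).
Proof. by apply: measurable_code_fun => j; exact: measurable_codingB. Qed.

(** [T x] decodes [e x], with value [x0] where [e x] is not a code. The latter set is measurable
    because the range is, and so [T] is measurable. *)
Lemma code_realization (e : X -> codes) (x0 : X) :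
  (forall j, measurable [set x | e x j]) ->
  almost (fun x => range (code B) (e x)) ->
  exists2 T : X -> X, measurable_fun setT T & almost (fun x => code B (T x) = e x).
Proof.
move=> me ae; have [BE Binj mrange] := codingB.
have mE : measurable (e @^-1` range (code B)).
  exact: (measurable_preimageT (measurable_code_fun me)).
pose T x := xget x0 [set y | code B y = e x].
have TP x : range (code B) (e x) -> code B (T x) = e x.
  by move=> [y _ ye]; rewrite /T; exact: (@xgetPex _ x0 [set y | code B y = e x]
    (ex_intro _ y ye)).
exists T; last exact: almost_impl ae.
apply: (measurability (range B)) => // _ [_ [j _ <-] <-]; rewrite setTI.
have -> : T @^-1` B j = (e @^-1` range (code B) `&` [set x | e x j]) `|`
    (~` (e @^-1` range (code B)) `&` [set x | B j x0]).
  apply/seteqP; split=> x /=.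
    have [ex|nex] := pselect (range (code B) (e x)).
      by move=> BT; left; split=> //; rewrite -(TP x ex).
    rewrite /T; case: xgetP => [y _ /= ye|_]; last by right.
    by case: nex; exists y.
  move=> [[/TP]|[nex]].
    by move=> <-.
  by rewrite /T; case: xgetP => // y _ /= ye; case: nex; exists y.
apply: measurableU; first exact: measurableI.
apply: measurableI; first exact: measurableC.
have [h|h] := pselect (B j x0).
  by rewrite (_ : [set _ | _] = setT)//; apply/seteqP; split.
by rewrite (_ : [set _ | _] = set0)//; apply/seteqP; split.
Qed.

(** The sets [B j] separate points, and countably many null sets have a null union. *)
Lemma coding_almost_eq (S T : X -> X) :
  (forall j, almost (fun x => B j (S x) <-> B j (T x))) ->
  almost (fun x => S x = T x).
Proof.
move=> /almost_forall; apply: almost_impl => x h.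
have [_ inj _] := codingB; apply: inj; apply/seteqP; split=> j /=;
  by rewrite /code /= h.
Qed.

End point_realization.

(** * The measure algebra *)

Section measure_algebra.
Context (d : measure_display) (X : measurableType d) (R : realType).
Variable mu : probability X R.
Local Notation P := (pr mu).

Definition dense_sets (A : nat -> set X) := (forall k, measurable (A k)) /\
  forall E e, measurable E -> 0 < e -> exists k, P (E `+` A k) < e.

(** Stages of the countable algebra generated by [B]. The complement of a union alone generates all
    Boolean operations, so a single binary operation is enough; an [inr] index carries a set to the
    next stage unchanged. *)
Fixpoint nor_closure (B : nat -> set X) (n j : nat) : set X :=
  if n is m.+1 then
    match (unpickle j : option (nat * nat + nat)) with
    | Some (inl (i, k)) => ~` (nor_closure B m i `|` nor_closure B m k)
    | Some (inr i) => nor_closure B m i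
    | None => set0
    end
  else B j.

Lemma prYU A B C D : measurable A -> measurable B -> measurable C -> measurable D ->
  P ((A `|` B) `+` (C `|` D)) <= P (A `+` C) + P (B `+` D).
Proof.
move=> mA mB mC mD; apply: pr_subU; meas.
by sets.
Qed.

Lemma setYC2 (A B : set X) : (~` A) `+` (~` B) = A `+` B.
Proof.
by apply/seteqP; split=> x; rewrite /setY /=; have [|] := pselect (A x);
  have [|] := pselect (B x); tauto.
Qed.

(** The sets approximable by the countable algebra form a sigma-algebra: a countable union is
    replaced by a finite one up to a tail of small measure. *)
Lemma dense_sets_exists (B : nat -> set X) : @measurable d X = <<s range B >> ->
  exists A, dense_sets A.
Proof.
move=> BE; pose F := nor_closure B.
have lift n i k : exists j, F (n + k)%N j = F n i.
  elim: k => [|k [j jE]]; first by exists i; rewrite addn0.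
  by exists (pickle (inr j : nat * nat + nat)); rewrite addnS /F /= pickleK.
pose A k := let: (n, j) := odflt (0, 0)%N (unpickle k : option (nat * nat)) in F n j.
have AE n j : exists k, A k = F n j.
  by exists (pickle (n, j)); rewrite /A pickleK.
have Anor i j : exists k, A k = ~` (A i `|` A j).
  have AF i' : exists n k, A i' = F n k.
    by rewrite /A; case: (odflt _ _) => n k; exists n, k.
  have [n [a ->]] := AF i; have [m [b ->]] := AF j.
  have [a' <-] := lift n a m; have [b' <-] := lift m b n.
  have [k kE] := AE (n + m).+1 (pickle (inl (a', b') : nat * nat + nat)).
  by exists k; rewrite kE /F /= pickleK -/F (addnC m).
have AC i : exists k, A k = ~` A i.
  by have [k kE] := Anor i i; exists k; rewrite kE; rewrite setUid.
have AU i j : exists k, A k = A i `|` A j.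
  have [k kE] := Anor i j; have [l lE] := AC k.
  by exists l; rewrite lE kE setCK.
have mA k : measurable (A k).
  rewrite /A; case: (odflt _ _) => n j; rewrite /F; elim: n j => [|n IH] j /=.
    by rewrite BE; apply: sub_sigma_algebra; exists j.
  case: (unpickle j) => [[[a b]|a]|]; [|exact: IH|exact: measurable0].
  by apply: measurableC; apply: measurableU; exact: IH.
have A0 : exists k, A k = set0.
  have [k kE] := AC 0%N; have [l lE] := Anor 0%N k.
  by exists l; rewrite lE kE setUv setCT.
exists A; split=> // E e mE; move: e; rewrite BE in mE.
suff [] : measurable E /\ forall e, 0 < e -> exists k, P (E `+` A k) < e by [].
move: E mE; apply: sigma_algebra_ind.
- split=> // e e0; have [k kE] := A0; exists k; rewrite kE.
  by rewrite setYK pr_set0.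
- move=> E [mE h]; split; first exact: measurableC.
  move=> e /h[k kE]; have [l lE] := AC k; exists l; rewrite lE.
  by rewrite setYC2.
- move=> E /all_and2[mE h]; split; first by meas.
  have fin N e : 0 < e -> exists k, P ((\bigcup_(i in `I_N) E i) `+` A k) < e.
    elim: N e => [|N IH] e e0.
      have [k kE] := A0; exists k; rewrite kE.
      rewrite (_ : \bigcup_(_ in _) _ = set0) ?setYK ?pr_set0//.
      by rewrite -subset0 => x [].
    have [|k hk] := IH (e / 2); first by lra.
    have [|l hl] := h N (e / 2); first by lra.
    have [m mkl] := AU k l; exists m; rewrite mkl.
    have -> : \bigcup_(i in `I_N.+1) E i = (\bigcup_(i in `I_N) E i) `|` E N.
      by rewrite IIS bigcup_setU bigcup_set1.
    have mU : measurable (\bigcup_(i in `I_N) E i) by meas.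
    by have := prYU mU (mE N) (mA k) (mA l); lra.
  move=> e e0; have [|N hN] := pr_bigcup_tail mu mE (e := e / 2); first by lra.
  have [|k hk] := fin N (e / 2); first by lra.
  exists k; have mU : measurable (\bigcup_(i in `I_N) E i) by meas.
  have mUU : measurable (\bigcup_i E i) by meas.
  apply: le_lt_trans (prY_triangle _ mUU mU (mA k)) _.
  have -> : P ((\bigcup_i E i) `+` (\bigcup_(i in `I_N) E i)) =
            P ((\bigcup_i E i) `\` (\bigcup_(i in `I_N) E i)).
    congr (P _); rewrite /setY (_ : _ `\` \bigcup_i E i = set0) ?setU0//.
    by rewrite setD_eq0 => x [i _ Ei]; exists i.
  by lra.
- move=> _ [j _ <-]; split.
    by rewrite BE; apply: sub_sigma_algebra; exists j.
  by move=> e e0; have [k kE] := AE 0%N j; exists k; rewrite kE setYK pr_set0.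
Qed.

(** The limit is the lower limit of a fast subsequence. It agrees with [E (N k)] outside the union
    of the later consecutive symmetric differences, of measure at most [2^-1 ^+ k]. *)
Lemma prY_complete (E : nat -> set X) : (forall n, measurable (E n)) ->
  (forall e, 0 < e -> exists N, forall m n, (N <= m)%N -> (N <= n)%N ->
     P (E m `+` E n) < e) ->
  exists2 F, measurable F & forall e, 0 < e -> exists N, forall n, (N <= n)%N ->
     P (F `+` E n) < e.
Proof.
move=> mE Ec.
have step k : exists N, forall m n, (N <= m)%N -> (N <= n)%N ->
    P (E m `+` E n) < 2^-1 ^+ k.+1.
  by apply: Ec; rewrite exprn_gt0.
have [N0 N0P] := choice step.
(* Summing makes the indices nondecreasing while keeping [N0 k <= N k]. *)
pose N k := (\sum_(i < k.+1) N0 i)%N.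
have NS k : (N k <= N k.+1)%N by rewrite /N [X in (_ <= X)%N]big_ord_recr leq_addr.
have N0N k : (N0 k <= N k)%N by rewrite /N big_ord_recr leq_addl.
have Nmono m k : (N m <= N (m + k))%N.
  by elim: k => [|k IH]; rewrite ?addn0// addnS (leq_trans IH).
pose F := \bigcup_k \bigcap_j E (N (k + j)%N).
have mF : measurable F.
  by apply: bigcup_measurable => k _; apply: bigcapT_measurable => j.
exists F => // e e0.
have key k : P (F `+` E (N k)) <= 2^-1 ^+ k.
  pose G j := E (N (k + j)%N) `+` E (N (k + j).+1).
  have mG j : measurable (G j) by rewrite /G; meas.
  have mU : measurable (\bigcup_j G j) by meas.
  apply: (@le_trans _ _ (P (\bigcup_j G j))).
    apply: pr_le; meas.
    have inside x : (forall j, ~ G j x) -> forall j, E (N (k + j)%N) x <-> E (N k) x.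
      move=> h; elim=> [|j IH]; first by rewrite addn0.
      rewrite -IH addnS; have := h j; rewrite /G /setY /=.
      by have [|] := pselect (E (N (k + j)%N) x);
        have [|] := pselect (E (N (k + j).+1) x); tauto.
    move=> x Fx; apply: contrapT => nG.
    have {}nG j : ~ G j x by move=> Gx; apply: nG; exists j.
    have {}nG := inside x nG; move: Fx; rewrite /setY /F /= => -[[[l _ Fl] nE]|[Ex nF]].
      by apply: nE; rewrite -(nG l) addnC; exact: Fl k I.
    by apply: nF; exists k => // j _; exact/nG.
  apply: pr_bigcup_geom => // j; rewrite /G; apply: ltW.
  apply: (@lt_le_trans _ _ (2^-1 ^+ (k + j).+1)).
    by apply: N0P => //; apply: leq_trans (N0N _) _ => //; exact: NS.
  by rewrite -exprD addnS.
have [|k hk] := @geom_lt R (e / 2); first by lra.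
exists (N k) => n Nn; apply: le_lt_trans (prY_triangle mu mF (mE (N k)) (mE n)) _.
have := N0P k (N k) n (N0N k) (leq_trans (N0N k) Nn).
have := key k; have := hk k (leqnn k); rewrite exprS.
by move: (2^-1 ^+ k) => t; lra.
Qed.

End measure_algebra.

(** * Densities *)

Section densities.
Context (d : measure_display) (X : measurableType d) (R : realType).
Variable mu : probability X R.
Local Notation P := (pr mu).
Implicit Types f g h : nsbij mu.

Lemma pushforward_dominated f :
  charge_of_finite_measure (distribution mu (nsfun f)) `<< mu.
Proof.
by apply/null_content_dominatesP => A mA A0; apply: (nonsingular f mA).1.
Qed.

Definition density f (x : X) : R := fine (RN_pushforward f x).

Lemma EFin_density f : EFin \o density f = RN_pushforward f.
Proof.
apply/funext => x; rewrite /= /density fineK//.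
exact/Radon_Nikodym_fin_num/pushforward_dominated.
Qed.

Lemma density_integrable f : mu.-integrable setT (EFin \o density f).
Proof.
by rewrite EFin_density; exact/Radon_Nikodym_integrable/pushforward_dominated.
Qed.

Lemma Rintegral_density f B : measurable B ->
  \int[mu]_(x in B) density f x = P (nsfun f @^-1` B).
Proof.
move=> mB; rewrite /Rintegral /pr.
under eq_integral do rewrite -[(density f _)%:E]/((EFin \o density f) _) EFin_density.
by rewrite -(Radon_Nikodym_integral (pushforward_dominated f)).
Qed.

Section L1.
Variables u v : X -> R.
Hypothesis iu : mu.-integrable setT (EFin \o u).
Hypothesis iv : mu.-integrable setT (EFin \o v).

Let iB w B : mu.-integrable setT (EFin \o w) -> measurable B ->
  mu.-integrable B (EFin \o w).
Proof. by move=> iw mB; exact: integrableS iw. Qed.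

Lemma integrable_sub : mu.-integrable setT (EFin \o (u \- v)).
Proof.
have -> : EFin \o (u \- v) = ((EFin \o u) \- (EFin \o v))%E.
  by apply/funext.
exact: integrableB.
Qed.

Lemma integrable_dist : mu.-integrable setT (EFin \o (fun x => `|u x - v x|)).
Proof. exact: integrable_norm integrable_sub. Qed.

Lemma Rintegral_dist_le B : measurable B ->
  `|\int[mu]_(x in B) u x - \int[mu]_(x in B) v x| <= \int[mu]_x `|u x - v x|.
Proof.
move=> mB; rewrite -RintegralB//; [|exact: iB..].
apply: le_trans (le_normr_Rintegral mB (iB integrable_sub mB)) _.
rewrite Rintegral_mkcond; apply: le_Rintegral => //.
- have /(integrable_mkcond _ mB) := iB integrable_dist mB.
  by rewrite restrict_EFin.
- exact: integrable_dist.
- move=> x _; rewrite patchE; case: ifP => _; [exact: lexx|exact: normr_ge0].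
Qed.

(** The set where [v <= u] and its complement contribute at most [e] each. Thus the [L^1] distance
    of densities is equivalent to the uniform distance of the measures over all sets. *)
Lemma Rintegral_dist_ge e :
  (forall B, measurable B ->
    `|\int[mu]_(x in B) u x - \int[mu]_(x in B) v x| <= e) ->
  \int[mu]_x `|u x - v x| <= 2 * e.
Proof.
move=> h.
have mu_ (w : X -> R) : mu.-integrable setT (EFin \o w) -> measurable_fun setT w.
  by move=> /integrableP[/measurable_EFinP].
pose B := [set x | v x <= u x].
have mB : measurable B.
  rewrite -[B]setTI; exact: measurable_fun_le measurableT (mu_ _ iv) (mu_ _ iu).
have mBC : measurable (~` B) by exact: measurableC.
have i1 := integrable_dist.
rewrite -(setUv B) Rintegral_setU//; last 2 first.
- by rewrite setUv.
- by apply/disj_setPS => x [].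
have -> : \int[mu]_(x in B) `|u x - v x| = \int[mu]_(x in B) (u x - v x).
  by apply: eq_Rintegral => x; rewrite inE /B /= => vu; rewrite ger0_norm// subr_ge0.
have -> : \int[mu]_(x in ~` B) `|u x - v x| = \int[mu]_(x in ~` B) (v x - u x).
  apply: eq_Rintegral => x; rewrite inE /B /= => /negP; rewrite -ltNge => uv.
  by rewrite distrC ger0_norm// subr_ge0 ltW.
rewrite !RintegralB//; try exact: iB.
have := h B mB; have := h _ mBC; rewrite !ler_norml => /andP[a b] /andP[c e'].
by lra.
Qed.

End L1.

(** The signed measure whose density is a simple function with rational coefficients on the sets
    [A k]; there are only countably many of them. *)
Definition simple_measure (A : nat -> set X) (s : seq (rat * nat)) (B : set X) : R :=
  \sum_(p <- s) ratr p.1 * P (A p.2 `&` B).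

Lemma simple_measure_approx A (s : seq (R * set X)) e : dense_sets mu A ->
  (forall p, p \in s -> measurable p.2) -> 0 < e ->
  exists t, forall B, measurable B ->
    `|\sum_(p <- s) p.1 * P (p.2 `&` B) - simple_measure A t B| <= e.
Proof.
move=> [mA dA]; elim: s e => [|[c E] s IH] e ms e0.
  exists [::] => B mB; rewrite /simple_measure !big_nil subrr normr0; exact: ltW.
have [||t tP] := IH (e / 3).
- by move=> p ps; apply: ms; rewrite in_cons ps orbT.
- by lra.
have mE : measurable E by exact: (ms (c, E) (mem_head _ _)).
have [q /= ] := rat_in_itvoo (ltac:(lra) : c < c + e / 3).
rewrite in_itv /= => /andP[cq qc].
(* Adding 1 makes [w] a nonzero divisor that still dominates the coefficient. The three errors of
   [e / 3] come from the tail, the coefficient and the set. *)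
pose w := `|ratr q : R| + 1; have w0 : 0 < w by rewrite /w ltr_wpDl.
have [|k kE] := dA E (e / 3 / w) mE; first by rewrite !divr_gt0.
exists ((q, k) :: t) => B mB; rewrite /simple_measure !big_cons /=.
have := tP B mB; set S := \sum_(p <- s) _; rewrite /simple_measure.
set S' := \sum_(p <- t) _.
have -> : c * P (E `&` B) + S - (ratr q * P (A k `&` B) + S') =
   (S - S') + (c - ratr q) * P (E `&` B) +
     ratr q * (P (E `&` B) - P (A k `&` B)) by ring.
move=> SS.
have P1 : P (E `&` B) <= 1 by rewrite -(pr_setT mu); apply: pr_le; meas.
have h1 : `|(c - ratr q) * P (E `&` B)| <= e / 3.
  rewrite normrM (ger0_norm (pr_ge0 _ _)).
  apply: (@le_trans _ _ `|c - ratr q|); first by rewrite ler_piMr.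
  by rewrite ler_norml; apply/andP; split; lra.
have h2 : `|ratr q * (P (E `&` B) - P (A k `&` B))| <= e / 3.
  rewrite normrM; apply: (@le_trans _ _ (w * P (E `+` A k))).
    apply: ler_pM => //; first by rewrite /w; lra.
    by rewrite ![_ `&` B]setIC; apply: prIY_dist.
  by rewrite mulrC -ler_pdivlMr// ltW.
apply: le_trans (ler_normD _ _) _; apply: (@le_trans _ _ (e / 3 + e / 3 + e / 3)).
  by apply: lerD => //; apply: le_trans (ler_normD _ _) _; exact: lerD.
by lra.
Qed.

Lemma density_simple_approx f e : 0 < e -> exists s : seq (R * set X),
  (forall p, p \in s -> measurable p.2) /\
  forall B, measurable B ->
    `|P (nsfun f @^-1` B) - \sum_(p <- s) p.1 * P (p.2 `&` B)| <= e.
Proof.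
move=> e0.
have [g_ [ig _ cg]] := approximation_sfun_integrable measurableT (density_integrable f).
have [n ng] : exists n, \int[mu]_x `|density f x - g_ n x| <= e.
  have /fine_cvgP[_ /cvgrPdist_lt /(_ e e0)[n _ /(_ n (leqnn n))]] := cg.
  move=> /= h; exists n; move: h; rewrite sub0r normrN => h.
  exact: le_trans (ler_norm _) (ltW h).
have ign := ig n; set h := g_ n in ng ign.
set r : seq R := finmap.enum_fset (fset_set (range h)).
exists [seq (r`_i, h @^-1` [set r`_i]) | i <- iota 0 (size r)]; split.
  by move=> _ /mapP[i _ ->] /=; exact: measurable_funPTI.
move=> B mB; rewrite -Rintegral_density// big_map -{1}[size r]subn0 big_mkord.
have -> : \sum_(i < size r) r`_i * P (h @^-1` [set r`_i] `&` B) =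
          \int[mu]_(x in B) h x.
  have mh i : measurable (h @^-1` [set r`_i]) by exact: measurable_funPTI.
  have ii (i : nat) : mu.-integrable B (EFin \o (\1_(h @^-1` [set r`_i]) : X -> R)).
    by apply: (integrableS measurableT) => //; exact: integrable_indic.
  have key N : mu.-integrable B (EFin \o (fun x => \sum_(i < N) (r`_i * \1_(h @^-1` [set r`_i]) x))) /\
     \sum_(i < N) r`_i * P (h @^-1` [set r`_i] `&` B) =
     \int[mu]_(x in B) \sum_(i < N) (r`_i * \1_(h @^-1` [set r`_i]) x).
    elim: N => [|N [IH1 IH2]].
      rewrite big_ord0; split.
        apply: (eq_integrable _ (cst 0%E)) => //; last exact: integrable0.
        by move=> x _ /=; rewrite big_ord0.
      under eq_Rintegral do rewrite big_ord0.
      by rewrite Rintegral_cst// mul0r.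
    have iN : mu.-integrable B (EFin \o (fun x => r`_N * \1_(h @^-1` [set r`_N]) x)).
      have := integrableZl mB r`_N (ii N).
      by apply: eq_integrable => // x _ /=; rewrite EFinM.
    split.
      have := integrableD mB IH1 iN.
      by apply: eq_integrable => // x _ /=; rewrite big_ord_recr /= EFinD.
    rewrite big_ord_recr /= IH2.
    under [RHS]eq_Rintegral do rewrite big_ord_recr /=.
    rewrite RintegralD//; congr (_ + _).
    rewrite RintegralZl//; congr (_ * _).
    by rewrite /Rintegral /pr integral_indic.
  rewrite (key _).2; apply: eq_Rintegral => x _.
  by rewrite fimfunEord.
by apply: le_trans ng; apply: Rintegral_dist_le => //; exact: density_integrable.
Qed.

End densities.

(** * Uniform convergence of push-forwards *)

Section push.
Context (d : measure_display) (X : measurableType d) (R : realType).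
Variable mu : probability X R.
Local Notation P := (pr mu).
Implicit Types f g h : nsbij mu.

(* The push-forward by [f] of the restriction of [mu] to [A]. *)
Definition push f (A B : set X) : R := P (A `&` nsfun f @^-1` B).

(* Convergence in the strong operator topology of L^1, for the isometries
   that send the density of a measure to that of its push-forward. *)
Definition push_cvg (f_ : nat -> nsbij mu) f :=
  forall A, measurable A -> forall e, 0 < e -> exists N, forall n, (N <= n)%N ->
    forall B, measurable B -> `|push (f_ n) A B - push f A B| <= e.

Lemma push_ge0 f A B : 0 <= push f A B.
Proof. exact: pr_ge0. Qed.

Lemma push_le1 f A B : measurable A -> measurable B -> push f A B <= 1.
Proof. by move=> mA mB; rewrite -(pr_setT mu); apply: pr_le; meas. Qed.

Lemma push_dist_le1 f g A B : measurable A -> measurable B ->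
  `|push f A B - push g A B| <= 1.
Proof.
move=> mA mB; rewrite ler_norml.
have := push_le1 f mA mB; have := push_le1 g mA mB.
have := push_ge0 f A B; have := push_ge0 g A B.
by move=> *; apply/andP; split; lra.
Qed.

Lemma push_distl f A A' B : measurable A -> measurable A' -> measurable B ->
  `|push f A B - push f A' B| <= P (A `+` A').
Proof.
move=> mA mA' mB; rewrite /push ![_ `&` nsfun f @^-1` B]setIC.
by apply: prIY_dist; meas.
Qed.

Lemma push_ae f g A B : measurable A -> measurable B ->
  ns_ae_eq f g -> push f A B = push g A B.
Proof.
move=> mA mB /ns_ae_eq_almost fg; apply: pr_eq_almost; meas.
by apply: almost_impl fg => x /= ->.
Qed.

Lemma push_comp f g A B : push (nscomp g f) A B = push f A (nsfun g @^-1` B).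
Proof. by []. Qed.

Lemma push_cvg_ae (f_ g_ : nat -> nsbij mu) f g : (forall n, ns_ae_eq (f_ n) (g_ n)) ->
  ns_ae_eq f g -> push_cvg f_ f -> push_cvg g_ g.
Proof.
move=> fg_ fg c A mA e e0; have [N hN] := c A mA e e0; exists N => n Nn B mB.
by rewrite -(push_ae mA mB (fg_ n)) -(push_ae mA mB fg); exact: hN.
Qed.

Lemma push_cvg_cst f : push_cvg (fun=> f) f.
Proof. by move=> A mA e e0; exists 0%N => n _ B mB; rewrite subrr normr0 ltW. Qed.

(** Taking for [A] the complement of the preimage of [B j] under one map shows that its preimage
    under the other map exceeds the first only by a null set. *)
Lemma push_eq_ae (B : nat -> set X) f g : coding B ->
  (forall A C, measurable A -> measurable C -> push f A C = push g A C) ->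
  ns_ae_eq f g.
Proof.
move=> codB h; apply/ns_ae_eq_almost/(coding_almost_eq codB) => j.
have mB := measurable_codingB codB j.
have half f' g' : (forall A C, measurable A -> measurable C -> push f' A C = push g' A C) ->
    P (nsfun f' @^-1` B j `\` nsfun g' @^-1` B j) = 0.
  move=> h'; have := h' (~` (nsfun g' @^-1` B j)) (B j).
  rewrite /push setICl pr_set0 setIC -setDE; apply; meas.
apply/prY_almost; meas; apply: prU0; meas; apply: half => // A C mA mC.
by rewrite h.
Qed.

Section dense.
Variable A_ : nat -> set X.
Hypothesis dA : dense_sets mu A_.
Let mA_ k : measurable (A_ k) := dA.1 k.

Lemma push_cvg_dense (f_ : nat -> nsbij mu) f :
  (forall k e, 0 < e -> exists N, forall n, (N <= n)%N ->
    forall B, measurable B -> `|push (f_ n) (A_ k) B - push f (A_ k) B| <= e) ->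
  push_cvg f_ f.
Proof.
move=> h A mA e e0; have [|k hk] := dA.2 A (e / 3) mA; first by lra.
have [|N hN] := h k (e / 3); first by lra.
exists N => n Nn B mB; have := hN n Nn B mB.
have := push_distl (f_ n) mA (mA_ k) mB; have := push_distl f mA (mA_ k) mB.
rewrite !ler_norml => /andP[? ?] /andP[? ?] /andP[? ?].
by apply/andP; split; lra.
Qed.

(** [push f A] is the push-forward of [mu] restricted to the image of [A], so a simple density for
    the push-forward is cut down to that image. *)
Lemma push_simple f A e : measurable A -> 0 < e ->
  exists s, forall B, measurable B -> `|push f A B - simple_measure mu A_ s B| <= e.
Proof.
move=> mA e0; have [|s [ms sP]] := @density_simple_approx _ _ _ mu f (e / 2).
  by lra.
have mfA : measurable (nsinv f @^-1` A) by meas.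
have [||t tP] := @simple_measure_approx _ _ _ mu A_
    [seq (p.1, p.2 `&` nsinv f @^-1` A) | p <- s] (e / 2) dA.
- by move=> _ /mapP[p ps ->] /=; apply: measurableI => //; exact: ms.
- by lra.
exists t => B mB; have mC : measurable (nsinv f @^-1` A `&` B) by meas.
have := sP _ mC; have := tP B mB; rewrite big_map /=.
have -> : push f A B = P (nsfun f @^-1` (nsinv f @^-1` A `&` B)).
  congr (P _); apply/seteqP; split=> x /=; by rewrite nsfunK.
under eq_bigr do rewrite -setIA.
set S := \sum_(p <- s) _; set p := P _; set T := simple_measure _ _ _ _.
rewrite !ler_norml => /andP[? ?] /andP[? ?].
by apply/andP; split; lra.
Qed.

Lemma push_cvg_simple (f_ : nat -> nsbij mu) f s e : push_cvg f_ f -> 0 < e ->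
  exists N, forall n, (N <= n)%N -> forall B, measurable B ->
    `|simple_measure mu A_ s (nsfun (f_ n) @^-1` B) -
      simple_measure mu A_ s (nsfun f @^-1` B)| <= e.
Proof.
move=> c; elim: s e => [|[q k] s IH] e e0.
  by exists 0%N => n _ B mB; rewrite /simple_measure !big_nil subrr normr0 ltW.
pose w := `|ratr q : R| + 1; have w0 : 0 < w by rewrite /w ltr_wpDl.
have [|N hN] := IH (e / 2); first by lra.
have [|M hM] := c (A_ k) (mA_ k) (e / 2 / w); first by rewrite !divr_gt0.
exists (maxn N M) => n; rewrite geq_max => /andP[Nn Mn] B mB.
have := hN n Nn B mB; have := hM n Mn B mB.
rewrite /simple_measure !big_cons /= /push.
set S := \sum_(_ <- s) _; set S' := \sum_(_ <- s) _.
set p := P _; set p' := P _ => h1 h2.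
have -> : ratr q * p + S - (ratr q * p' + S') = ratr q * (p - p') + (S - S') by ring.
apply: le_trans (ler_normD _ _) _; rewrite [leRHS]splitr; apply: lerD => //.
rewrite normrM; apply: (@le_trans _ _ (w * `|p - p'|)).
  by apply: ler_wpM2r => //; rewrite /w; lra.
by rewrite mulrC -ler_pdivlMr.
Qed.

(** The convergence of [f_] is applied to the moving sets given by the preimages of [B] under
    [g_ n], which is why it must be uniform in the set. A simple measure close to [push f A] then
    carries the convergence of [g_]. *)
Lemma push_cvg_comp (f_ g_ : nat -> nsbij mu) f g : push_cvg f_ f -> push_cvg g_ g ->
  push_cvg (fun n => nscomp (g_ n) (f_ n)) (nscomp g f).
Proof.
move=> cf cg A mA e e0.
have [|s sP] := @push_simple f A (e / 4) mA; first by lra.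
have [|N hN] := push_cvg_simple s cg (e := e / 4); first by lra.
have [|M hM] := cf A mA (e / 4); first by lra.
exists (maxn N M) => n; rewrite geq_max => /andP[Nn Mn] B mB.
rewrite !push_comp.
have mB1 : measurable (nsfun (g_ n) @^-1` B) by meas.
have mB2 : measurable (nsfun g @^-1` B) by meas.
have := hM n Mn _ mB1; have := sP _ mB1; have := sP _ mB2; have := hN n Nn B mB.
rewrite !ler_norml => /andP[? ?] /andP[? ?] /andP[? ?] /andP[? ?].
by apply/andP; split; lra.
Qed.

Lemma push_inv f g A B :
  push (nsinverse f) A (nsfun f @^-1` B) - push (nsinverse g) A (nsfun f @^-1` B) =
  push (nsid mu) A B - push (nscomp f (nsinverse g)) A B.
Proof.
by congr (P (A `&` _) - _); apply/seteqP; split=> x /=; rewrite nsinvK.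
Qed.

(** For isometries, [T_n^-1 v - T^-1 v] has the norm of [v - T_n T^-1 v], and [T_n T^-1] tends to
    the identity. In terms of sets, every [B] is the preimage under [f_ n] of its image, and the
    bound is uniform in sets. *)
Lemma push_cvg_inverse (f_ : nat -> nsbij mu) f : push_cvg f_ f ->
  push_cvg (fun n => nsinverse (f_ n)) (nsinverse f).
Proof.
move=> cf.
have := push_cvg_comp (push_cvg_cst (nsinverse f)) cf.
have ff : ns_ae_eq (nscomp f (nsinverse f)) (nsid mu).
  by apply: ns_ae_eq_fun => x /=; rewrite nsinvK.
move=> /(push_cvg_ae (fun=> ns_ae_eq_refl _) ff) c A mA e e0.
have [N hN] := c A mA e e0; exists N => n Nn B mB.
have -> : B = nsfun (f_ n) @^-1` (nsinv (f_ n) @^-1` B).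
  by apply/seteqP; split=> x /=; rewrite nsfunK.
rewrite push_inv distrC; apply: hN => //; meas.
Qed.

End dense.

End push.

(** * The metric on the group of non-singular bijections *)

Section Autstar_metric.
Context (d : measure_display) (X : measurableType d) (R : realType).
Variable mu : probability X R.
Local Notation P := (pr mu).
Local Notation G := (Autstar mu).
Local Open Scope quotient_scope.

Lemma repr_mul (S T : G) :
  ns_ae_eq (nscomp (repr S) (repr T)) (repr (S * T)%g).
Proof. by rewrite ns_ae_eq_sym; exact: ns_ae_eq_repr. Qed.

Lemma repr_inv (T : G) : ns_ae_eq (nsinverse (repr T)) (repr (T^-1)%g).
Proof. by rewrite ns_ae_eq_sym; exact: ns_ae_eq_repr. Qed.

Lemma repr_one : ns_ae_eq (nsid mu) (repr (1%g : G)).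
Proof. by rewrite ns_ae_eq_sym; exact: ns_ae_eq_repr. Qed.

Lemma repr_ae_inj (S T : G) : ns_ae_eq (repr S) (repr T) -> S = T.
Proof. by move=> /Autstar_eqP; rewrite !reprK. Qed.

Definition signed (b : bool) (T : G) : nsbij mu :=
  if b then repr T else nsinverse (repr T).

Variable A_ : nat -> set X.
Hypothesis dA : dense_sets mu A_.
Let mA_ k : measurable (A_ k) := dA.1 k.

Definition gap (S T : G) k b B : R :=
  2^-1 ^+ k * `|push (signed b S) (A_ k) B - push (signed b T) (A_ k) B|.

(* The inverses are included for completeness of the metric: the metric without
   them induces the same topology. *)
Definition aut_dist (S T : G) : R :=
  sup [set r | exists k b B, measurable B /\ r = gap S T k b B].

Lemma gap_le S T k b B : measurable B -> gap S T k b B <= 2^-1 ^+ k.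
Proof.
move=> mB; rewrite /gap ler_piMr// ?exprn_ge0//; exact: push_dist_le1.
Qed.

Lemma gap_le_aut_dist S T k b B : measurable B -> gap S T k b B <= aut_dist S T.
Proof.
move=> mB; apply: ub_le_sup; last by exists k, b, B.
exists 1 => _ [l [c [C [mC ->]]]]; apply: le_trans (gap_le _ _ _ _ mC) _.
by rewrite exprn_ile1// invf_le1// ler1n.
Qed.

Lemma aut_dist_le S T e :
  (forall k b B, measurable B -> gap S T k b B <= e) -> aut_dist S T <= e.
Proof.
move=> h; apply: ge_sup; last by move=> _ [k [b [B [mB ->]]]]; exact: h.
by exists (gap S T 0%N true set0); exists 0%N, true, set0.
Qed.

Lemma push_le_aut_dist S T k b B e : measurable B ->
  aut_dist S T <= 2^-1 ^+ k * e ->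
  `|push (signed b S) (A_ k) B - push (signed b T) (A_ k) B| <= e.
Proof.
move=> mB h; have := le_trans (gap_le_aut_dist S T k b mB) h.
by rewrite /gap ler_pM2l// exprn_gt0.
Qed.

Lemma aut_dist_cvg_push (T_ : nat -> G) T b :
  met_cvg aut_dist T_ T -> push_cvg (fun n => signed b (T_ n)) (signed b T).
Proof.
move=> c; apply: (push_cvg_dense dA) => k e e0.
have [|N hN] := c (2^-1 ^+ k * e); first by rewrite mulr_gt0// exprn_gt0.
by exists N => n Nn B mB; apply: push_le_aut_dist => //; exact/ltW/hN.
Qed.

Lemma push_cvg_aut_dist (T_ : nat -> G) T :
  push_cvg (fun n => repr (T_ n)) (repr T) -> met_cvg aut_dist T_ T.
Proof.
move=> c e e0; have e20 : 0 < e / 2 by lra.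
have cs b : push_cvg (fun n => signed b (T_ n)) (signed b T).
  by case: b => //=; exact: (push_cvg_inverse dA).
have [K hK] := geom_lt e20.
(* The weights control all indices from [K] on, which leaves finitely many sets. *)
have fin k : exists N, forall n, (N <= n)%N -> forall l b B, (l < k)%N -> measurable B ->
    `|push (signed b (T_ n)) (A_ l) B - push (signed b T) (A_ l) B| <= e / 2.
  elim: k => [|k [N hN]]; first by exists 0%N.
  have [N1 hN1] := cs true (A_ k) (mA_ k) (e / 2) e20.
  have [N2 hN2] := cs false (A_ k) (mA_ k) (e / 2) e20.
  exists (maxn N (maxn N1 N2)) => n; rewrite !geq_max => /and3P[Nn N1n N2n] l b B.
  rewrite ltnS leq_eqVlt => /orP[/eqP -> mB|lk]; last exact: hN.
  by case: b; [exact: hN1|exact: hN2].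
have [N hN] := fin K; exists N => n Nn.
apply: (@le_lt_trans _ _ (e / 2)); last by lra.
apply: aut_dist_le => k b B mB; have [kK|Kk] := ltnP k K.
  apply: le_trans (hN n Nn k b B kK mB); rewrite /gap ler_piMl//.
  by rewrite exprn_ile1// invf_le1// ler1n.
exact: le_trans (gap_le _ _ _ _ mB) (ltW (hK k Kk)).
Qed.

Lemma aut_dist_cvgP (T_ : nat -> G) T :
  met_cvg aut_dist T_ T <-> push_cvg (fun n => repr (T_ n)) (repr T).
Proof.
split; [exact: (@aut_dist_cvg_push T_ T true)|exact: push_cvg_aut_dist].
Qed.

Variable B_ : nat -> set X.
Hypothesis codB : coding B_.

Lemma aut_dist_metric : is_metric aut_dist.
Proof.
have gapC S T k b B : gap S T k b B = gap T S k b B by rewrite /gap distrC.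
split.
- move=> x; apply/eqP; rewrite eq_le; apply/andP; split.
    by apply: aut_dist_le => k b B mB; rewrite /gap subrr normr0 mulr0.
  apply: le_trans (gap_le_aut_dist x x 0%N true measurable0).
  by rewrite /gap subrr normr0 mulr0.
- move=> S T ST; apply/repr_ae_inj/(push_eq_ae codB).
  have eqk k C : measurable C -> push (repr S) (A_ k) C = push (repr T) (A_ k) C.
    move=> mC; apply/eqP; rewrite -subr_eq0 -normr_le0.
    by apply: (@push_le_aut_dist _ _ _ true) => //; rewrite ST mulr0.
  move=> A C mA mC; apply/eqP; rewrite -subr_eq0 -normr_le0.
  apply/ler_addgt0Pr => e e0; rewrite add0r.
  have [|k hk] := dA.2 A (e / 2) mA; first by lra.
  have := push_distl (repr S) mA (mA_ k) mC.
  have := push_distl (repr T) mA (mA_ k) mC; rewrite (eqk k C mC).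
  rewrite !ler_norml => /andP[? ?] /andP[? ?].
  by apply/andP; split; lra.
- move=> S T; congr sup; apply/seteqP; split=> _ [k [b [B [mB ->]]]];
    by exists k, b, B; rewrite gapC.
- move=> T S U; apply: aut_dist_le => k b B mB.
  apply: le_trans (lerD (gap_le_aut_dist S T k b mB) (gap_le_aut_dist T U k b mB)).
  rewrite /gap -mulrDr ler_wpM2l ?exprn_ge0//.
  exact: ler_distD.
Qed.

Lemma aut_dist_mul (S_ T_ : nat -> G) S T :
  met_cvg aut_dist S_ S -> met_cvg aut_dist T_ T ->
  met_cvg aut_dist (fun n => S_ n * T_ n)%g (S * T)%g.
Proof.
move=> /aut_dist_cvgP cS /aut_dist_cvgP cT; apply/aut_dist_cvgP.
apply: push_cvg_ae (push_cvg_comp dA cT cS) => [n|]; exact: repr_mul.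
Qed.

Lemma aut_dist_inv (T_ : nat -> G) T :
  met_cvg aut_dist T_ T -> met_cvg aut_dist (fun n => (T_ n)^-1)%g (T^-1)%g.
Proof.
move=> /aut_dist_cvgP cT; apply/aut_dist_cvgP.
apply: push_cvg_ae (push_cvg_inverse dA cT) => [n|]; exact: repr_inv.
Qed.

(** Simple measures need not come from group elements, so each description [(n, w)] is given an
    element that it fits, if there is one. Two elements with the same description differ by at most
    [2 * 2^-1 ^+ n] on the first [size w] sets, and the weights handle the others. *)
Lemma aut_dist_separable : met_separable aut_dist.
Proof.
pose appr (n : nat) (S : G) (w : seq (seq (rat * nat) * seq (rat * nat))) :=
  forall k B, (k < size w)%N -> measurable B ->
    `|push (repr S) (A_ k) B - simple_measure mu A_ (nth ([::], [::]) w k).1 B| <= 2^-1 ^+ n /\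
    `|push (nsinverse (repr S)) (A_ k) B - simple_measure mu A_ (nth ([::], [::]) w k).2 B|
      <= 2^-1 ^+ n.
have apprE n S K : exists2 w, size w = K & appr n S w.
  have n0 : 0 < 2^-1 ^+ n :> R by rewrite exprn_gt0.
  have /choice[s sP] : forall k, exists s : seq (rat * nat) * seq (rat * nat),
      forall B, measurable B ->
      `|push (repr S) (A_ k) B - simple_measure mu A_ s.1 B| <= 2^-1 ^+ n /\
      `|push (nsinverse (repr S)) (A_ k) B - simple_measure mu A_ s.2 B| <= 2^-1 ^+ n.
    move=> k; have [s sP] := push_simple dA (repr S) (mA_ k) n0.
    have [t tP] := push_simple dA (nsinverse (repr S)) (mA_ k) n0.
    by exists (s, t) => B mB; split; [exact: sP|exact: tP].
  exists (mkseq s K); first exact: size_mkseq.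
  by move=> k B; rewrite size_mkseq => kK mB; rewrite nth_mkseq//; exact: sP.
pose q j : G := if (unpickle j : option (nat * seq (seq (rat * nat) * seq (rat * nat))))
  is Some (n, w) then xget 1%g [set S | appr n S w] else 1%g.
exists q => S e e0.
have [|n hn] := @geom_lt R (e / 4); first by lra.
have [|K hK] := @geom_lt R (e / 4); first by lra.
have [w wK wS] := apprE n S K.
exists (pickle ((n, w) : nat * seq (seq (rat * nat) * seq (rat * nat)))).
rewrite /q pickleK; set T := xget _ _.
have wT : appr n T w by exact: (@xgetPex _ 1%g [set S | appr n S w] (ex_intro _ S wS)).
apply: (@le_lt_trans _ _ (e / 2)); last by lra.
have hnn := hn n (leqnn n).
apply: aut_dist_le => k b B mB; have [kK|Kk] := ltnP k K; last first.
  by apply: le_trans (gap_le _ _ _ _ mB) _; have := hK k Kk; lra.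
apply: (@le_trans _ _ `|push (signed b S) (A_ k) B - push (signed b T) (A_ k) B|).
  by rewrite /gap ler_piMl// exprn_ile1// invf_le1// ler1n.
have [S1 S2] := wS k B ltac:(by rewrite wK) mB.
have [T1 T2] := wT k B ltac:(by rewrite wK) mB.
case: b => /=.
- move: S1 T1; rewrite !ler_norml => /andP[? ?] /andP[? ?].
  by apply/andP; split; lra.
- move: S2 T2; rewrite !ler_norml => /andP[? ?] /andP[? ?].
  by apply/andP; split; lra.
Qed.

End Autstar_metric.

(** * The weak topology in terms of push-forwards *)

Section weak_convergence.
Context (d : measure_display) (X : measurableType d) (R : realType).
Variable mu : probability X R.
Local Notation P := (pr mu).
Implicit Types f g h : nsbij mu.

(** Absolute continuity in epsilon-delta form. Were it to fail, sets of measure at most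
    [2^-1 ^+ n.+1] would have preimages of measure at least [e]; their upper limit would be null
    with a nonnull preimage. *)
Lemma null_preserving_uniform (T : X -> X) e : measurable_fun setT T ->
  null_preserving mu T -> 0 < e ->
  exists2 r, 0 < r & forall B, measurable B -> P B < r -> P (T @^-1` B) < e.
Proof.
move=> mT nT e0; apply: contrapT => H.
have /choice[B BP] : forall n, exists B, [/\ measurable B, P B <= 2^-1 ^+ n.+1 &
    e <= P (T @^-1` B)].
  move=> n; apply: contrapT => h; apply: H; exists (2^-1 ^+ n.+1).
    by rewrite exprn_gt0.
  move=> B mB B0; rewrite ltNge; apply/negP => eB; apply: h; exists B.
  by split=> //; exact: ltW.
have mB n : measurable (B n) by case: (BP n).
pose C n := \bigcup_k B (n + k)%N.
have mC n : measurable (C n) by apply: bigcup_measurable => k _.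
have CS : {homo C : m n / (m <= n)%N >-> n `<=` m}.
  move=> m n mn x [k _ Bk]; exists (n - m + k)%N => //.
  by rewrite addnA subnKC.
have C0 : P (\bigcap_n C n) = 0.
  apply/eqP; rewrite eq_le pr_ge0 andbT; apply/ler_addgt0Pr => r r0.
  rewrite add0r; have [N /(_ N (leqnn N)) hN] := geom_lt r0.
  apply: le_trans (ltW hN).
  apply: (@le_trans _ _ (P (C N))).
    by apply: pr_le; meas => x; apply.
  apply: pr_bigcup_geom => // k; rewrite -exprD addnS.
  by case: (BP (N + k)%N).
have mTC n : measurable (T @^-1` C n) by exact: measurable_preimageT.
have [|N hN] := @pr_nonincreasing_cvg _ _ _ mu (fun n => T @^-1` C n) e mTC _ e0.
  by move=> m n mn; apply: preimage_subset; exact: CS.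
have mTI : measurable (\bigcap_n T @^-1` C n) by exact: bigcapT_measurable.
have := hN N (leqnn N); apply/negP; rewrite -leNgt.
have -> : P (T @^-1` C N `\` \bigcap_n T @^-1` C n) = P (T @^-1` C N).
  rewrite pr_setDS//; last exact: bigcap_inf.
  have mCI : measurable (\bigcap_n C n) by exact: bigcapT_measurable.
  by rewrite -preimage_bigcap (nT _ mCI C0) subr0.
have [mBN _ eB] := BP N; apply: le_trans eB _; apply: pr_le => //.
  exact: measurable_preimageT.
by move=> x Bx; exists 0%N => //; rewrite addn0.
Qed.

(** Both halves of the symmetric difference are values of [push (f_ n)], with first argument the
    preimage of [A] under [f] or its complement; the corresponding values of [push f] vanish. *)
Lemma push_cvg_preimage (f_ : nat -> nsbij mu) f A e : push_cvg f_ f ->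
  measurable A -> 0 < e ->
  exists N, forall n, (N <= n)%N -> P (nsfun (f_ n) @^-1` A `+` nsfun f @^-1` A) < e.
Proof.
move=> c mA e0; have mfA : measurable (nsfun f @^-1` A) by meas.
have e30 : 0 < e / 3 by lra.
have [N hN] := c _ mfA _ e30.
have [M hM] := c _ (measurableC mfA) _ e30.
exists (maxn N M) => n; rewrite geq_max => /andP[Nn Mn].
have := hN n Nn _ (measurableC mA); have := hM n Mn _ mA.
rewrite {2 4}/push -preimage_setC setICr setICl pr_set0 !subr0 !ger0_norm ?push_ge0//.
rewrite /push => h1 h2; apply: (@le_lt_trans _ _ (e / 3 + e / 3)); last by lra.
apply: le_trans (lerD h1 h2); apply: pr_subU; meas; sets.
Qed.

Lemma nsfun_image f A : nsfun f @` A = nsinv f @^-1` A.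
Proof.
apply/seteqP; split=> [_ [x Ax <-]|x Ax] /=; first by rewrite nsfunK.
by exists (nsinv f x) => //; rewrite nsinvK.
Qed.

Lemma cvge0P (u : nat -> R) : (forall n, 0 <= u n) ->
  (fun n => (u n)%:E) @ \oo --> 0%E <->
  forall e, 0 < e -> exists N, forall n, (N <= n)%N -> u n < e.
Proof.
move=> u0; split=> [/fine_cvgP[_ /cvgrPdist_lt c] e /c[N _ hN]|h].
  by exists N => n /hN /=; rewrite sub0r normrN ger0_norm.
apply/fine_cvgP; split; first by near=> n.
apply/cvgrPdist_lt => e /h[N hN]; exists N => // n /hN /=.
by rewrite sub0r normrN ger0_norm.
Unshelve. all: by end_near. Qed.

Lemma Lnorm_density f g :
  ('N[mu]_1[(RN_pushforward f \- RN_pushforward g)])%E =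
  (\int[mu]_x `|density f x - density g x|)%:E.
Proof.
rewrite Lnorm1 -!EFin_density /Rintegral fineK//.
apply: integrable_fin_num => //.
by apply: integrable_dist; exact: density_integrable.
Qed.

(** [push g A B] is the measure of the preimage under [g] of the part of [B] in the image of [A].
    Changing the outer map from [f_ n] to [f] costs an [L^1] distance of densities; changing the
    image costs little by absolute continuity. Conversely, the case [A = setT] bounds the [L^1]
    distance. *)
Lemma nsbij_cvgP (f_ : nat -> nsbij mu) f (A_ : nat -> set X) :
  dense_sets mu A_ -> nsbij_cvg f_ f <-> push_cvg f_ f.
Proof.
move=> dA.
have mE n A : measurable A -> mu ((nsfun (f_ n) @` A) `+` (nsfun f @` A)) =
    (P (nsinv (f_ n) @^-1` A `+` nsinv f @^-1` A))%:E.
  by move=> mA; rewrite !nsfun_image prE//; meas.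
split=> [[c1 c2] A mA e e0|c]; last first.
  split=> [A mA|].
    under eq_fun do rewrite mE//.
    apply/cvge0P => [n|e e0]; first exact: pr_ge0.
    exact: (push_cvg_preimage (push_cvg_inverse dA c)).
  under eq_fun do rewrite Lnorm_density.
  apply/cvge0P => [n|e e0]; first by apply: Rintegral_ge0 => x _.
  have [|N hN] := c _ measurableT (e / 3); first by lra.
  exists N => n Nn; apply: (@le_lt_trans _ _ (2 * (e / 3))); last by lra.
  apply: Rintegral_dist_ge => [||B mB]; [exact: density_integrable..|].
  rewrite !Rintegral_density//; have := hN n Nn B mB.
  by rewrite /push !setTI.
have [|r r0 hr] := null_preserving_uniform (measurable_nsfun f)
  (@nsfun_null_preserving _ _ _ _ f) (e := e / 2); first by lra.
have c1' : (fun n => (P (nsinv (f_ n) @^-1` A `+` nsinv f @^-1` A))%:E) @ \oo --> 0%E.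
  by under eq_fun do rewrite -mE//; exact: c1.
have [N hN] := (cvge0P (fun n => pr_ge0 _ _)).1 c1' r r0.
have c2' : (fun n => (\int[mu]_x `|density (f_ n) x - density f x|)%:E) @ \oo --> 0%E.
  by under eq_fun do rewrite -Lnorm_density; exact: c2.
have [|M hM] := (cvge0P (fun n => Rintegral_ge0 mu (fun x _ => normr_ge0 _))).1 c2' (e / 2).
  by lra.
exists (maxn N M) => n; rewrite geq_max => /andP[Nn Mn] B mB.
have pE g : push g A B = P (nsfun g @^-1` (nsinv g @^-1` A `&` B)).
  by congr (P _); apply/seteqP; split=> x /=; rewrite nsfunK.
have mD g : measurable (nsinv g @^-1` A `&` B) by meas.
rewrite !pE; set D := _ `&` B; set D' := _ `&` B.
have -> : P (nsfun (f_ n) @^-1` D) - P (nsfun f @^-1` D') =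
   (P (nsfun (f_ n) @^-1` D) - P (nsfun f @^-1` D)) +
   (P (nsfun f @^-1` D) - P (nsfun f @^-1` D')) by ring.
apply: le_trans (ler_normD _ _) _; rewrite [leRHS]splitr; apply: lerD.
  apply: le_trans (ltW (hM n Mn)).
  rewrite -!Rintegral_density; [|exact: mD..].
  by apply: Rintegral_dist_le; [exact: density_integrable..|exact: mD].
apply: le_trans (prY_dist _ _ _) _; [by apply: measurable_nspreimage; exact: mD..|].
apply/ltW/(le_lt_trans _ (hr _ _ (hN n Nn))); last by meas.
by apply: pr_le; [rewrite /D /D'; meas..|rewrite /D /D' /setY; move=> x /=; tauto].
Qed.

End weak_convergence.

(** * Completeness *)

Section completeness.
Context (d : measure_display) (X : measurableType d) (R : realType).
Variable mu : probability X R.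
Local Notation P := (pr mu).

Definition push_cauchy (f_ : nat -> nsbij mu) :=
  forall A, measurable A -> forall e, 0 < e -> exists N, forall m n,
    (N <= m)%N -> (N <= n)%N ->
    forall B, measurable B -> `|push (f_ m) A B - push (f_ n) A B| <= e.

(** Absolute continuity uniform in [n]: the maps after [N] are compared with [f_ N], and each of the
    finitely many others has its own bound. *)
Lemma push_cauchy_uniform (f_ : nat -> nsbij mu) e : push_cauchy f_ -> 0 < e ->
  exists2 r, 0 < r & forall n B, measurable B -> P B < r ->
    P (nsfun (f_ n) @^-1` B) < e.
Proof.
move=> c e0; have e20 : 0 < e / 2 by lra.
have [N hN] := c _ measurableT _ e20.
have fin k : exists2 r, 0 < r & forall n B, (n <= k)%N -> measurable B -> P B < r ->
    P (nsfun (f_ n) @^-1` B) < e / 2.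
  elim: k => [|k [r r0 hr]].
    have [r r0 hr] := null_preserving_uniform (measurable_nsfun (f_ 0%N))
      (@nsfun_null_preserving _ _ _ _ (f_ 0%N)) e20.
    by exists r => // n B; rewrite leqn0 => /eqP ->; exact: hr.
  have [s s0 hs] := null_preserving_uniform (measurable_nsfun (f_ k.+1))
      (@nsfun_null_preserving _ _ _ _ (f_ k.+1)) e20.
  exists (Num.min r s); first by rewrite lt_min r0.
  move=> n B nk mB; rewrite lt_min => /andP[Br Bs].
  move: nk; rewrite leq_eqVlt => /orP[/eqP ->|nk]; first exact: hs.
  exact: hr.
have [r r0 hr] := fin N; exists r => // n B mB Br.
have [nN|/ltnW Nn] := leqP n N; first by apply: lt_trans (hr n B nN mB Br) _; lra.
have := hN n N Nn (leqnn N) B mB; have := hr N B (leqnn N) mB Br.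
by rewrite /push !setTI ler_norml => h /andP[_]; lra.
Qed.

(** With [C] the complement of the preimage of [A] under [f_ n], the image of [C] under [f_ n]
    misses [A]. Since the inverses are Cauchy, the image of [C] under [f_ m] almost misses [A];
    pulling back by [f_ m] keeps this small, uniformly in [m]. *)
Lemma push_cauchy_preimage (f_ : nat -> nsbij mu) A e :
  push_cauchy f_ -> push_cauchy (fun n => nsinverse (f_ n)) ->
  measurable A -> 0 < e ->
  exists N, forall m n, (N <= m)%N -> (N <= n)%N ->
    P (nsfun (f_ m) @^-1` A `+` nsfun (f_ n) @^-1` A) < e.
Proof.
move=> cf cg mA e0.
have [|r r0 hr] := push_cauchy_uniform cf (e := e / 2); first by lra.
have [|N hN] := cg A mA (r / 2); first by lra.
have half m n : (N <= m)%N -> (N <= n)%N ->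
    P (nsfun (f_ m) @^-1` A `\` nsfun (f_ n) @^-1` A) < e / 2.
  move=> Nm Nn; pose C := ~` (nsfun (f_ n) @^-1` A).
  have mC : measurable C by rewrite /C; meas.
  have := hN m n Nm Nn C mC.
  have -> : push (nsinverse (f_ n)) A C = 0.
    rewrite /push (_ : _ `&` _ = set0) ?pr_set0// -subset0 => x [Ax].
    by rewrite /C /= nsinvK.
  rewrite subr0 ger0_norm ?push_ge0// /push /= => h.
  have := hr m (A `&` nsinv (f_ m) @^-1` C) ltac:(meas) ltac:(lra).
  congr (P _ < _); apply/seteqP; split=> x; rewrite /C /= nsfunK; tauto.
exists N => m n Nm Nn; rewrite [ltRHS]splitr.
apply: le_lt_trans (ltrD (half m n Nm Nn) (half n m Nn Nm)).
by apply: prU_le; meas.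
Qed.

(** Meant for preimages of a countable union, [U] and [U'], and of a finite part of it, [K] and
    [K']. *)
Lemma prY_approx (U J K U' K' D : set X) :
  measurable U -> measurable J -> measurable K -> measurable U' -> measurable K' ->
  measurable D -> J `<=` K -> K `<=` U -> K' `<=` U' -> U' `\` K' `<=` D ->
  P (U `+` U') <= P (U `\` J) + P (K `+` K') + P D.
Proof.
move=> mU mJ mK mU' mK' mD JK KU K'U' D'.
apply: (@le_trans _ _ (P ((U `\` J) `|` (K `+` K')) + P D)); last first.
  by rewrite lerD2r; apply: prU_le; meas.
apply: pr_subU; meas => x; rewrite /setY /=.
have := JK x; have := KU x; have := K'U' x; have := D' x => /=.
by clear; have [|] := pselect (K x); have [|] := pselect (K' x); tauto.
Qed.

(** The sets on which preimages converge include the generators and are stable under complement. At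
    a countable union two limits are exchanged, which requires tails small uniformly in [n]. *)
Lemma sigma_limit (Y : Type) (G : set (set Y)) (u : nat -> X -> Y) (e : X -> Y) :
  (forall n A, <<s G >> A -> measurable (u n @^-1` A)) ->
  (forall F : nat -> set Y, (forall i, <<s G >> (F i)) -> forall r, 0 < r ->
    exists I, forall n, P (u n @^-1` ((\bigcup_i F i) `\` \bigcup_(i in `I_I) F i)) < r) ->
  let lim A := measurable (e @^-1` A) /\ forall r, 0 < r -> exists N, forall n,
    (N <= n)%N -> P (e @^-1` A `+` u n @^-1` A) < r in
  G `<=` lim -> <<s G >> `<=` lim.
Proof.
move=> mu_ tight lim Glim.
suff : <<s G >> `<=` [set A | <<s G >> A /\ lim A] by move=> h A /h[].
have sG := smallest_sigma_algebra setT G; have [sG0 sGC sGU] := sG.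
have sGU2 A B : <<s G >> A -> <<s G >> B -> <<s G >> (A `|` B).
  move=> sA sB; have -> : A `|` B = \bigcup_n (if n is 0%N then A else B).
    apply/seteqP; split=> [x [Ax|Bx]|x [[|n] _ xn]]; [by exists 0%N|by exists 1%N|by left|by right].
  by apply: sGU => -[].
apply: sigma_algebra_ind.
- split=> //; rewrite /lim preimage_set0; split=> // r r0; exists 0%N => n _.
  by rewrite preimage_set0 setYK pr_set0.
- move=> A [sA [meA lA]]; split; first by rewrite -setTD; exact: sGC.
  split; first by rewrite preimage_setC; exact: measurableC.
  by move=> r /lA[N hN]; exists N => n /hN; rewrite -setYC2.
- move=> F /all_and2[sF /all_and2[meF lF]]; split; first exact: sGU.
  have meU : measurable (e @^-1` \bigcup_n F n).
    by rewrite preimage_bigcup; exact: bigcup_measurable.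
  split=> // r r0.
  have fin I : <<s G >> (\bigcup_(i in `I_I) F i) /\ forall s, 0 < s -> exists N, forall n,
      (N <= n)%N -> P (e @^-1` (\bigcup_(i in `I_I) F i) `+`
        u n @^-1` (\bigcup_(i in `I_I) F i)) < s.
    elim: I => [|I [IH1 IH2]].
      rewrite (_ : \bigcup_(_ in _) _ = set0); last by rewrite -subset0 => x [].
      by split=> // s s0; exists 0%N => n _; rewrite !preimage_set0 setYK pr_set0.
    have -> : \bigcup_(i in `I_I.+1) F i = (\bigcup_(i in `I_I) F i) `|` F I.
      by rewrite IIS bigcup_setU bigcup_set1.
    split; first exact: sGU2.
    move=> s s0; have [|N hN] := IH2 (s / 2); first by lra.
    have [|M hM] := lF I (s / 2); first by lra.
    exists (maxn N M) => n; rewrite geq_max => /andP[Nn Mn].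
    rewrite [ltRHS]splitr; apply: le_lt_trans (ltrD (hN n Nn) (hM n Mn)).
    rewrite !preimage_setU; apply: prYU => //; try exact: mu_.
    by rewrite preimage_bigcup; exact: bigcup_measurable.
  have r30 : 0 < r / 4 by lra.
  have [I hI] := tight F sF _ r30.
  have [J hJ] := pr_bigcup_tail mu meF r30.
  (* [I] controls the tail along the sequence and [J] the tail of the limit. *)
  have [K [IK JK]] : exists K, (I <= K)%N /\ (J <= K)%N.
    by exists (maxn I J); rewrite leq_maxl leq_maxr.
  have [sK lK] := fin K; have [N hN] := lK _ r30.
  exists N => n Nn; have h1 := hI n; have h2 := hN n Nn.
  have sub L : (L <= K)%N -> \bigcup_(i in `I_L) F i `<=` \bigcup_(i in `I_K) F i.
    by move=> LK; apply: bigcup_subset => i /= iL; exact: leq_trans iL LK.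
  have sD : <<s G >> ((\bigcup_i F i) `\` \bigcup_(i in `I_I) F i).
    have [sI _] := fin I.
    rewrite setDE -[X in <<s _ >> X]setCK setCI setCK -setTD.
    apply: (sGC); apply: sGU2 => //; rewrite -setTD; apply: sGC; exact: sGU.
  have mE L : measurable (e @^-1` \bigcup_(i in `I_L) F i).
    by rewrite preimage_bigcup; exact: bigcup_measurable.
  have muU := mu_ n _ (sGU _ sF); have muK := mu_ n _ sK; have muD := mu_ n _ sD.
  have mK := mE K.
  apply: (@le_lt_trans _ _ (r / 4 + r / 4 + r / 4)); last by lra.
  apply: le_trans (lerD (lerD (ltW hJ) (ltW h2)) (ltW h1)).
  have -> : \bigcup_k e @^-1` F k = e @^-1` \bigcup_k F k by rewrite preimage_bigcup.
  have -> : \bigcup_(k in `I_J) e @^-1` F k = e @^-1` \bigcup_(k in `I_J) F k.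
    by rewrite preimage_bigcup.
  apply: (prY_approx meU (mE J) mK muU muK muD).
  - by move=> x; exact: sub.
  - by move=> x [i _ Fi]; exists i.
  - by move=> x [i _ Fi]; exists i.
  - by move=> x [Ux nKx]; split=> // Ix; apply: nKx; exact: sub Ix.
- move=> A GA; split; [exact: sub_sigma_algebra|exact: Glim].
Qed.

Variable B_ : nat -> set X.
Hypothesis codB : coding B_.

Lemma preimage_tail (f_ : nat -> nsbij mu) (F : nat -> set X) r : push_cauchy f_ ->
  (forall i, measurable (F i)) -> 0 < r -> exists I, forall n,
    P (nsfun (f_ n) @^-1` ((\bigcup_i F i) `\` \bigcup_(i in `I_I) F i)) < r.
Proof.
move=> cf mF r0; have [s s0 hs] := push_cauchy_uniform cf r0.
have [I hI] := pr_bigcup_tail mu mF s0; exists I => n; apply: hs hI.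
by apply: measurableD; meas.
Qed.

(** The limits [E j] of the preimages of [B_ j] define a map [e] into [codes], which is lifted to
    [X]. [sigma_limit] serves twice: in [codes] to place [e] in the range, and in [X] to pass from
    the [B_ j] to all measurable sets. *)
Lemma limit_map (f_ : nat -> nsbij mu) (x0 : X) :
  push_cauchy f_ -> push_cauchy (fun n => nsinverse (f_ n)) ->
  exists2 T : X -> X, measurable_fun setT T &
    forall A, measurable A -> forall e, 0 < e -> exists N, forall n, (N <= n)%N ->
      P (T @^-1` A `+` nsfun (f_ n) @^-1` A) < e.
Proof.
move=> cf cg; have [BE Binj mrange] := codB.
have mB := measurable_codingB codB.
have /choice[E EP] : forall j, exists E, measurable E /\ forall e, 0 < e -> exists N,
    forall n, (N <= n)%N -> P (E `+` nsfun (f_ n) @^-1` B_ j) < e.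
  move=> j; have [||E mE hE] := @prY_complete _ _ _ mu (fun n => nsfun (f_ n) @^-1` B_ j).
  - by move=> n; meas.
  - by move=> e e0; exact: push_cauchy_preimage.
  - by exists E.
have mE j : measurable (E j) by case: (EP j).
pose e x : codes := [set j | E j x].
have me : measurable_fun setT e by exact: measurable_code_fun.
have mcode := measurable_code codB.
pose lim (Y : Type) (u : nat -> X -> Y) (e : X -> Y) A :=
  measurable (e @^-1` A) /\ forall r, 0 < r -> exists N, forall n,
    (N <= n)%N -> P (e @^-1` A `+` u n @^-1` A) < r.
have limC : <<s cylinders >> `<=` lim _ (fun n => code B_ \o nsfun (f_ n)) e.
  apply: sigma_limit.
  - move=> n A mA.
    exact: (measurable_nspreimage (f_ n) (measurable_preimageT mcode mA)).
  - move=> F mF r r0.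
    have mcF i : measurable (code B_ @^-1` F i).
      exact: (measurable_preimageT mcode (mF i)).
    have [I hI] := preimage_tail cf mcF r0; exists I => n.
    by have := hI n; rewrite -2!preimage_bigcup.
  - move=> _ [j _ <-]; split; first exact: mE.
    by move=> r r0; have [_ /(_ r r0)] := EP j.
(* The preimages of the complement of the range are empty along the sequence, hence null in the
   limit. *)
have aerange : almost mu (fun x => range (code B_) (e x)).
  have mrC : <<s cylinders >> (~` range (code B_)) by exact: (@measurableC _ codes _ mrange).
  have [mN lN] := limC _ mrC; exists (e @^-1` (~` range (code B_))); split=> //.
    apply/eqP; rewrite eq_le pr_ge0 andbT; apply/ler_addgt0Pr => r r0; rewrite add0r.
    have [N /(_ N (leqnn N)) hN] := lN r r0; apply: le_trans (ltW hN).
    have -> : (code B_ \o nsfun (f_ N)) @^-1` (~` range (code B_)) = set0.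
      by rewrite -subset0 => x; apply; exists (nsfun (f_ N) x).
    by rewrite setY0.
  by move=> x /contrapT.
have [T mT TE] := code_realization codB x0 mE aerange.
have TB j : P (T @^-1` B_ j `+` E j) = 0.
  have mTB := measurable_preimageT mT (mB j).
  apply/(prY_almost mu mTB (mE j)); apply: almost_impl TE => x Te.
  have : code B_ (T x) j <-> e x j by rewrite Te.
  by [].
exists T => //.
suff h : @measurable d X `<=` lim _ (fun n => nsfun (f_ n)) T.
  by move=> A /h[].
rewrite BE; apply: sigma_limit.
- by move=> n A; rewrite -BE => mA; exact: measurable_nspreimage.
- move=> F mF r r0; apply: (preimage_tail cf) => // i; rewrite BE; exact: mF.
- move=> _ [j _ <-]; have mTB := measurable_preimageT mT (mB j); split=> // r r0.
  have [_ /(_ r r0)[N hN]] := EP j; exists N => n Nn.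
  have mfB := measurable_nspreimage (f_ n) (mB j).
  apply: le_lt_trans (prY_triangle mu mTB (mE j) mfB) _.
  by rewrite TB add0r; exact: hN.
Qed.

Lemma push_cauchy_limit (f_ : nat -> nsbij mu) :
  push_cauchy f_ -> push_cauchy (fun n => nsinverse (f_ n)) ->
  exists f, push_cvg f_ f.
Proof.
move=> cf cg.
have [x0 _] : [set: X] !=set0.
  apply/set0P/eqP => X0; have := pr_setT mu; rewrite X0 pr_set0.
  by move/eqP; rewrite eq_sym oner_eq0.
have cff : push_cauchy (fun n => nsinverse (nsinverse (f_ n))) by [].
have [T mT TP] := limit_map x0 cf cg.
have [S mS SP] := limit_map x0 cg cff.
have null (h_ : nat -> nsbij mu) (U : X -> X) : measurable_fun setT U ->
    (forall A, measurable A -> forall e, 0 < e -> exists N, forall n, (N <= n)%N ->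
      P (U @^-1` A `+` nsfun (h_ n) @^-1` A) < e) -> null_preserving mu U.
  move=> mU UP A mA A0.
  apply/eqP; rewrite eq_le pr_ge0 andbT; apply/ler_addgt0Pr => r r0; rewrite add0r.
  have [N /(_ N (leqnn N)) hN] := UP A mA r r0; apply: le_trans (ltW hN).
  have := prY_dist mu (measurable_preimageT mU mA) (measurable_nspreimage (h_ N) mA).
  by rewrite (@nsfun_null_preserving _ _ _ mu (h_ N) A mA A0) subr0 ger0_norm ?pr_ge0.
have nT := null _ T mT TP; have nS := null _ S mS SP.
(* The preimage of [B_ j] under [V], pulled back by [U], is close to its pull-back by [h_ n]. That
   is in turn close to [B_ j], because pulling back by [h_ n] keeps small sets small uniformly in
   [n]. *)
have inv (h_ : nat -> nsbij mu) (U V : X -> X) : push_cauchy h_ ->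
    measurable_fun setT U -> measurable_fun setT V ->
    (forall A, measurable A -> forall e, 0 < e -> exists N, forall n, (N <= n)%N ->
      P (U @^-1` A `+` nsfun (h_ n) @^-1` A) < e) ->
    (forall A, measurable A -> forall e, 0 < e -> exists N, forall n, (N <= n)%N ->
      P (V @^-1` A `+` nsinv (h_ n) @^-1` A) < e) ->
    almost mu (fun x => V (U x) = x).
  move=> ch mU mV UP VP.
  apply: (@coding_almost_eq _ _ _ mu _ codB (V \o U) id) => j.
  have mB := measurable_codingB codB j.
  have mVB := measurable_preimageT mV mB; have mUVB := measurable_preimageT mU mVB.
  apply/(prY_almost mu mUVB mB).
  apply/eqP; rewrite eq_le pr_ge0 andbT; apply/ler_addgt0Pr => r r0; rewrite add0r.
  have [|s s0 hs] := push_cauchy_uniform ch (e := r / 2); first by lra.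
  have [|N hN] := UP _ mVB (r / 2); first by lra.
  have [M hM] := VP _ mB s s0.
  pose n := maxn N M.
  have mhV := measurable_nspreimage (h_ n) mVB.
  have mB' := measurable_nsinv_preimage (h_ n) mB.
  apply: le_trans (prY_triangle mu mUVB mhV mB) _; rewrite [leRHS]splitr.
  apply: lerD; first exact/ltW/hN/leq_maxl.
  have := hs n _ (measurableY mVB mB') (hM n (leq_maxr _ _)).
  move/ltW; apply: le_trans; apply: pr_le; [by meas|by apply: measurable_nspreimage; meas|].
  by move=> x; rewrite /setY /= nsfunK.
have [f fT] := almost_bijection mT mS nT nS (inv f_ T S cf mT mS TP SP)
  (inv _ S T cg mS mT SP TP).
exists f => A mA e e0; have [|N hN] := cf A mA (e / 2); first by lra.
(* [M] depends on [B] but [N] does not: the Cauchy bound is uniform in the set, and [m] is only an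
   auxiliary index. *)
exists N => n Nn B mB; have [|M hM] := TP B mB (e / 2); first by lra.
pose m := maxn N M; have h1 := hN n m Nn (leq_maxl _ _) B mB.
have h2 := hM m (leq_maxr _ _).
have mTB := measurable_preimageT mT mB; have mfB := measurable_nspreimage (f_ m) mB.
have -> : push f A B = P (A `&` T @^-1` B).
  by apply: pr_eq_almost; meas; apply: almost_impl fT => x /= ->.
have := le_trans (prIY_dist mu mA mfB mTB) (ltW (_ : P (_ `+` _) < e / 2)).
rewrite setYC => /(_ h2); move: h1; rewrite /push !ler_norml => /andP[? ?] /andP[? ?].
by apply/andP; split; lra.
Qed.

Lemma aut_dist_complete (A_ : nat -> set X) : dense_sets mu A_ ->
  met_complete (@aut_dist _ _ _ mu A_).
Proof.
move=> dA T_ Tc.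
have cs b : push_cauchy (fun n => signed b (T_ n)).
  move=> A mA e e0; have [|k hk] := dA.2 A (e / 3) mA; first by lra.
  have [|N hN] := Tc (2^-1 ^+ k * (e / 3)).
    by rewrite mulr_gt0 ?exprn_gt0//; lra.
  exists N => m n Nm Nn B mB.
  have := push_le_aut_dist dA b mB (ltW (hN m n Nm Nn)).
  have := push_distl (signed b (T_ m)) mA (dA.1 k) mB.
  have := push_distl (signed b (T_ n)) mA (dA.1 k) mB.
  rewrite !ler_norml => /andP[? ?] /andP[? ?] /andP[? ?].
  by apply/andP; split; lra.
have [f cf] := push_cauchy_limit (cs true) (cs false).
exists (\pi_(Autstar mu) f)%qT; apply/(aut_dist_cvgP dA).
apply: push_cvg_ae cf => [n|]; first exact: ns_ae_eq_refl.
by rewrite ns_ae_eq_sym; exact: ns_ae_eq_repr.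
Qed.

End completeness.

(** * Non-singular bijections with prescribed support *)

Section ternary.
Context (R : realType) (X : Type) (B : nat -> set X).

(** Base 3 leaves a gap: the terms after the leading digit add up to at most [3^-1 * (3 / 2) < 1],
    so the digits can be read off. [J] is the index of the leading digit. *)
Definition ternary_partial (J n : nat) (x : X) : R :=
  \sum_(0 <= j < n) 3^-1 ^+ j * \1_(B (J + j)%N) x.

Definition ternary (J : nat) (x : X) : R := limn (ternary_partial J ^~ x).

Lemma ternary_partialS J n x : ternary_partial J n.+1 x =
  \1_(B J) x + 3^-1 * ternary_partial J.+1 n x.
Proof.
rewrite /ternary_partial big_nat_recl// expr0 mul1r addn0 mulr_sumr; congr (_ + _).
by apply: eq_bigr => j _; rewrite exprS mulrA addnS.
Qed.

Lemma ternary_partial_le J n x : ternary_partial J n x <= 3 / 2.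
Proof.
elim: n J => [|n IH] J; first by rewrite /ternary_partial big_nil; lra.
have B1 : \1_(B J) x <= 1 :> R by rewrite indicE lern1 leq_b1.
by rewrite ternary_partialS; have := IH J.+1; lra.
Qed.

Lemma ternary_partial_ge0 J n x : 0 <= ternary_partial J n x.
Proof. by apply: sumr_ge0 => j _; rewrite mulr_ge0// exprn_ge0. Qed.

Lemma ternary_partial_cvg J x : cvgn (ternary_partial J ^~ x).
Proof.
apply: nondecreasing_is_cvgn.
  apply/nondecreasing_seqP => n; rewrite /ternary_partial big_nat_recr//= lerDl.
  by rewrite mulr_ge0// exprn_ge0.
by exists (3 / 2) => _ [n _ <-]; exact: ternary_partial_le.
Qed.

Lemma ternary_ge0 J x : 0 <= ternary J x.
Proof.
apply: limr_ge; first exact: ternary_partial_cvg.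
by near=> n; exact: ternary_partial_ge0.
Unshelve. all: by end_near. Qed.

Lemma ternary_le J x : ternary J x <= 3 / 2.
Proof.
apply: limr_le; first exact: ternary_partial_cvg.
by near=> n; exact: ternary_partial_le.
Unshelve. all: by end_near. Qed.

Lemma ternaryS J x : ternary J x = \1_(B J) x + 3^-1 * ternary J.+1 x.
Proof.
have c1 : ternary_partial J n.+1 x @[n --> \oo] --> ternary J x.
  by rewrite (cvg_shiftS (ternary_partial J ^~ x)); exact: ternary_partial_cvg.
apply: (cvg_unique _ c1) => //.
rewrite (_ : (fun n => ternary_partial J n.+1 x) =
    (fun n => \1_(B J) x + 3^-1 * ternary_partial J.+1 n x)); last first.
  by apply/funext => n; rewrite ternary_partialS.
apply: cvgD; first exact: cvg_cst.
by apply: cvgM; [exact: cvg_cst|exact: ternary_partial_cvg].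
Qed.

Lemma ternary_digit J x : B J x <-> 1 <= ternary J x.
Proof.
rewrite ternaryS indicE; have := ternary_le J.+1 x; have := ternary_ge0 J.+1 x.
split=> [Bx|]; first by rewrite mem_set//= mulr1n; lra.
by move=> le1; apply: contrapT => nB; move: le1; rewrite memNset//= mulr0n; lra.
Qed.

Definition ternary_shift (r : R) : R := 3 * (r - \1_(`[1, +oo[%classic) r).

Lemma ternary_shiftE J x : ternary_shift (ternary J x) = ternary J.+1 x.
Proof.
rewrite /ternary_shift.
have -> : \1_(`[1, +oo[%classic) (ternary J x) = \1_(B J) x :> R.
  rewrite !indicE; congr (_%:R); congr nat_of_bool.
  apply/idP/idP; rewrite !inE /= in_itv /= andbT.
    by move/ternary_digit.
  by move/ternary_digit.
by rewrite ternaryS addrC addKr; lra.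
Qed.

Lemma ternary_iter J x : iter J ternary_shift (ternary 0%N x) = ternary J x.
Proof. by elim: J => [|J IH] //=; rewrite IH ternary_shiftE. Qed.

(** The reals with digit 1 at place [J]. Pulled back by [ternary 0] it gives [B J], so one real
    function recovers the whole coding. *)
Definition digit_set J : set R := iter J ternary_shift @^-1` `[1, +oo[%classic.

Lemma measurable_digit_set J : measurable (digit_set J).
Proof.
have ms : measurable_fun setT ternary_shift.
  by apply: measurable_funM => //; apply: measurable_funB => //.
have mi : measurable_fun setT (iter J ternary_shift).
  elim: J => [|J IH]; [exact: measurable_id|exact: measurableT_comp IH].
by rewrite -[X in measurable X]setTI; apply: mi => //; exact: measurable_itv.
Qed.

Lemma ternary_digit_set J x : B J x <-> digit_set J (ternary 0%N x).
Proof.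
by rewrite /digit_set /= ternary_iter in_itv /= andbT; exact: ternary_digit.
Qed.

End ternary.

Lemma measurable_ternary (R : realType) (d : measure_display) (X : measurableType d)
    (B : nat -> set X) J :
  (forall j, measurable (B j)) -> measurable_fun setT (ternary R B J).
Proof.
move=> mB; apply: (measurable_fun_cvg (h := ternary_partial R B J)) => //; last first.
  by move=> x _; exact: ternary_partial_cvg.
move=> n; rewrite /ternary_partial; apply: measurable_sum => j.
by apply: measurable_funM => //; exact: measurable_indic.
Qed.

(** * Equality of laws of real functions *)

Section law.
Context (d : measure_display) (X : measurableType d) (R : realType).
Variable mu : probability X R.
Local Notation P := (pr mu).

Lemma law_unique (D : set X) (g h : X -> R) : measurable D ->
  measurable_fun setT g -> measurable_fun setT h ->
  (forall t, P (D `&` [set x | t < g x]) = P (D `&` [set x | t < h x])) ->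
  forall C, measurable C -> P (D `&` g @^-1` C) = P (D `&` h @^-1` C).
Proof.
move=> mD mg mh gh C mC.
have mgC A : measurable A -> measurable (D `&` g @^-1` A).
  by move=> mA; apply: measurableI => //; exact: measurable_preimageT.
have mhC A : measurable A -> measurable (D `&` h @^-1` A).
  by move=> mA; apply: measurableI => //; exact: measurable_preimageT.
suff : mu (D `&` g @^-1` C) = mu (D `&` h @^-1` C) by rewrite /pr => ->.
have mRE : @measurable _ R = <<s @RGenOInfty.G R >> := RGenOInfty.measurableE R.
apply: (@dynkin_induction _ R (@RGenOInfty.G R)
  (fun C => mu (D `&` g @^-1` C) = mu (D `&` h @^-1` C)) mRE) => //.
- move=> _ _ [x ->] [y ->]; exists (Num.max x y).
  by apply/seteqP; split=> z /=; rewrite !in_itv /= !andbT gt_max => /andP.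
- move=> _ [t ->]; rewrite prE; last by apply: mgC; exact: measurable_itv.
  rewrite prE; last by apply: mhC; exact: measurable_itv.
  congr EFin; have := gh t; congr (P (D `&` _) = P (D `&` _));
    by apply/seteqP; split=> z /=; rewrite in_itv /= andbT.
- move=> S mS SE.
  have E (k : X -> R) : D `&` k @^-1` (~` S) = D `\` (D `&` k @^-1` S).
    by apply/seteqP; split=> z /=; tauto.
  have mgS := mgC S mS; have mhS := mhC S mS.
  rewrite !E !prE; [|by meas..]; rewrite !pr_setDS//; [|by sets..].
  by rewrite {2 4}/pr SE.
- move=> F mF tF FE.
  rewrite !preimage_bigcup !setI_bigcupr !measure_bigcup//.
  + by apply: eq_eseriesr => k _; exact: FE.
  + by move=> i _; exact: mhC.
  + apply/trivIsetP => i j _ _ ij; apply/seteqP; split=> // z [[_ Fi] [_ Fj]].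
    by have /trivIsetP /(_ i j I I ij) := tF; rewrite -subset0 => /(_ (h z)); apply.
  + by move=> i _; exact: mgC.
  + apply/trivIsetP => i j _ _ ij; apply/seteqP; split=> // z [[_ Fi] [_ Fj]].
    by have /trivIsetP /(_ i j I I ij) := tF; rewrite -subset0 => /(_ (g z)); apply.
- by rewrite -mRE.
Qed.

End law.

(** * A uniform variable on a set of positive measure *)

Section uniform.
Context (d : measure_display) (X : measurableType d) (R : realType).
Variable mu : probability X R.
Local Notation P := (pr mu).
Variables (B : nat -> set X) (D : set X).
Hypothesis codB : coding B.
Hypothesis mu_nonatomic : nonatomic mu.
Hypothesis mD : measurable D.
Hypothesis D0 : 0 < P D.

Let K := ternary R B 0.
Let m := P D.

Let mK : measurable_fun setT K.
Proof. by apply: measurable_ternary => j; exact: measurable_codingB. Qed.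

Lemma ternary_inj : injective K.
Proof.
move=> x y xy; have [_ inj _] := codB; apply: inj; apply/seteqP.
have h j : B j x <-> B j y.
  by split=> Bj; apply/(ternary_digit_set R); move/(ternary_digit_set R): Bj; rewrite -/K xy.
by split=> j /h.
Qed.

Lemma measurable_comp_le (g : X -> R) t : measurable_fun setT g ->
  measurable [set x | g x <= t].
Proof.
move=> mg; rewrite -[X in measurable X]setTI.
exact: (measurable_fun_le measurableT mg (measurable_cst t)).
Qed.

Lemma measurable_comp_gt (g : X -> R) t : measurable_fun setT g ->
  measurable [set x | t < g x].
Proof.
move=> mg; have -> : [set x | t < g x] = ~` [set x | g x <= t].
  by apply/seteqP; split=> x /=; rewrite ltNge => /negP.
exact/measurableC/measurable_comp_le.
Qed.

Lemma measurable_comp_lt (g : X -> R) t : measurable_fun setT g ->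
  measurable [set x | g x < t].
Proof.
move=> mg; have -> : [set x | g x < t] = [set x | - t < (- g) x].
  by apply/seteqP; split=> x /=; rewrite ltrN2.
exact/measurable_comp_gt/measurableT_comp.
Qed.

(** By injectivity a fibre has at most one point, so it has no nonempty proper subset of the kind
    that nonatomicity would provide. *)
Lemma pr_fiber s : measurable [set x | K x = s] /\ P [set x | K x = s] = 0.
Proof.
have mS : measurable [set x | K x = s].
  rewrite (_ : [set _ | _] = [set x | K x <= s] `\` [set x | K x < s]).
    by apply: measurableD; [exact: measurable_comp_le|exact: measurable_comp_lt].
  apply/seteqP; split=> x /=; first by move=> ->; rewrite lexx ltxx.
  by move=> [xs /negP]; rewrite -leNgt => sx; apply/eqP; rewrite eq_le xs.
split=> //; apply/(pr_eq0 mu mS); apply/eqP; rewrite -measure_le0 leNgt.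
apply/negP => S0; have [C [mC CS /andP[C0 CS0]]] := mu_nonatomic mS S0.
have [x Cx] : C !=set0 by apply/set0P/eqP => CE; rewrite CE measure0 ltxx in C0.
suff CE : [set x | K x = s] = C by rewrite CE ltxx in CS0.
apply/seteqP; split=> // y /= ys.
by have := CS x Cx => /= xs; rewrite (_ : y = x)//; apply: ternary_inj; rewrite xs.
Qed.

Let F s := P (D `&` [set x | K x <= s]).

Let mDK s : measurable (D `&` [set x | K x <= s]).
Proof. by apply: measurableI => //; exact: measurable_comp_le. Qed.

Let F_mono r s : r <= s -> F r <= F s.
Proof.
move=> rs; apply: pr_le => // x [Dx /= xr]; split=> //=; exact: le_trans rs.
Qed.

Let F_le s : F s <= m.
Proof. by apply: pr_le => // x []. Qed.

(** Intermediate values, at the supremum [s] of the points with [F < t]: left continuity, due to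
    null fibres, gives [F s <= t], and right continuity gives [t <= F s]. The values of [K] lie
    between 0 and [3 / 2], so [F] vanishes at [-1] and equals [m] at [3 / 2]. *)
Let F_surj t : 0 < t -> t < m -> exists s, F s = t.
Proof.
move=> t0 tm; pose S := [set r | F r < t]; pose s := sup S.
have FN : F (-1) = 0.
  rewrite /F (_ : _ `&` _ = set0) ?pr_set0// -subset0 => x [_ /=].
  by have := ternary_ge0 R B 0 x; rewrite -/K; lra.
have FT : F (3 / 2) = m.
  rewrite /F setIidl// => x _ /=; exact: ternary_le.
have S0 : S !=set0 by exists (-1); rewrite /S /= FN.
have Sub : has_ubound S.
  exists (3 / 2) => r Sr; rewrite leNgt; apply/negP => /ltW /F_mono.
  by rewrite FT; move: Sr; rewrite /S /=; lra.
have below n : F (s - n.+1%:R^-1) < t.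
  have [r Sr sr] := sup_adherent (invS_gt0 R n) (conj S0 Sub).
  by apply: le_lt_trans (F_mono (ltW sr)) _.
have above n : t <= F (s + n.+1%:R^-1).
  rewrite leNgt; apply/negP => h; have : s + n.+1%:R^-1 <= s by exact: ub_le_sup.
  by rewrite gerDl leNgt invS_gt0.
have [mS PS] := pr_fiber s.
have mlt : measurable (D `&` [set x | K x < s]).
  by apply: measurableI => //; exact: measurable_comp_lt.
exists s; apply/eqP; rewrite eq_le; apply/andP; split; apply/ler_addgt0Pr => e e0.
  apply: (@le_trans _ _ (P (D `&` [set x | K x < s]) + P [set x | K x = s])).
    apply: pr_subU => // x [Dx /=]; rewrite le_eqVlt => /orP[/eqP|]; by [right|left].
  rewrite PS addr0.
  pose G n := D `&` [set x | K x <= s - n.+1%:R^-1].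
  have GE : \bigcup_n G n = D `&` [set x | K x < s].
    apply/seteqP; split=> [x [n _ [Dx /= xs]]|x [Dx /= xs]].
      split=> //=; apply: le_lt_trans xs _; rewrite ltrBlDr ltrDl; exact: invS_gt0.
    have [|n /(_ n (leqnn n)) hn] := @archi_inv R (s - K x); first by lra.
    exists n => //; split=> //=; move: hn; move: (n.+1%:R^-1) => z; lra.
  have GS : {homo G : p q / (p <= q)%N >-> p `<=` q}.
    move=> p q pq x [Dx /= xs]; split=> //=; apply: le_trans xs _.
    by rewrite lerD2l lerN2 lef_pV2 ?posrE// ler_nat.
  have mG n : measurable (G n) by exact: mDK.
  have [N /(_ N (leqnn N)) hN] := pr_nondecreasing_cvg mu mG GS e0.
  have mU : measurable (\bigcup_n G n) by meas.
  rewrite -GE; have := prD_le mu mU (mG N).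
  by have : P (G N) < t := below N; lra.
pose G n := D `&` [set x | K x <= s + n.+1%:R^-1].
have GE : \bigcap_n G n = D `&` [set x | K x <= s].
  apply/seteqP; split=> [x h|x [Dx /= xs] n _]; last first.
    split=> //=; apply: le_trans xs _; rewrite lerDl; exact/ltW/invS_gt0.
  have [Dx _] := h 0%N I; split=> //=; apply/ler_addgt0Pr => z z0.
  have [n /(_ n (leqnn n)) hn] := archi_inv z0.
  by have [_ /= xs] := h n I; apply: le_trans xs _; rewrite lerD2l ltW.
have GS : {homo G : p q / (p <= q)%N >-> q `<=` p}.
  move=> p q pq x [Dx /= xs]; split=> //=; apply: le_trans xs _.
  by rewrite lerD2l lef_pV2 ?posrE// ler_nat.
have mG n : measurable (G n) by exact: mDK.
have [N /(_ N (leqnn N)) hN] := pr_nonincreasing_cvg mu mG GS e0.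
have mC : measurable (\bigcap_n G n) by exact: bigcapT_measurable.
rewrite /F -GE; have := prD_le mu (mG N) mC.
by have : t <= P (G N) := above N; lra.
Qed.

(* [g] is uniform on [0, m] for the restriction of [mu] to [D], since the
   distribution function [F] has no jump. *)
Let g x := F (K x).

Let mg : measurable_fun setT g.
Proof.
apply: (measurableT_comp (nondecreasing_measurable measurableT _) mK).
by move=> r s; exact: F_mono.
Qed.

Let g_ge0 x : 0 <= g x. Proof. exact: pr_ge0. Qed.
Let g_le x : g x <= m. Proof. exact: F_le. Qed.

Let mgle t : measurable (D `&` [set x | g x <= t]).
Proof. by apply: measurableI => //; exact: measurable_comp_le. Qed.
Let mglt t : measurable (D `&` [set x | g x < t]).
Proof. by apply: measurableI => //; exact: measurable_comp_lt. Qed.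

Let between t e : 0 < e -> t < m -> exists u, [/\ t < u, u <= t + e & u < m].
Proof.
move=> e0 tm; exists (Num.min (t + e) ((t + m) / 2)).
have h1 : Num.min (t + e) ((t + m) / 2) <= t + e by rewrite ge_min lexx.
have h2 : Num.min (t + e) ((t + m) / 2) <= (t + m) / 2 by rewrite ge_min lexx orbT.
by split=> //; [rewrite lt_min; apply/andP; split; lra|lra].
Qed.

Let P_g_le t : 0 <= t -> t < m -> P (D `&` [set x | g x <= t]) = t.
Proof.
move=> t0 tm; apply/eqP; rewrite eq_le; apply/andP; split.
  apply/ler_addgt0Pr => e e0; have [u [tu ue um]] := between e0 tm.
  have [||s sE] := @F_surj u; [by lra|by []|].
  apply: le_trans ue; rewrite -sE; apply: pr_le => // x [Dx /= xt]; split=> //=.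
  rewrite leNgt; apply/negP => /ltW /F_mono; rewrite -/(g x) sE.
  by move=> /le_trans /(_ xt); lra.
have [->|t0'] := eqVneq t 0; first exact: pr_ge0.
have {}t0 : 0 < t by rewrite lt_neqAle eq_sym t0'.
have [s sE] := F_surj t0 tm.
rewrite -[leLHS]sE; apply: pr_le => // x [Dx /= xs]; split=> //=.
by rewrite -sE; exact: F_mono.
Qed.

Let P_g_lt t : 0 < t -> t <= m -> P (D `&` [set x | g x < t]) = t.
Proof.
move=> t0 tm; apply/eqP; rewrite eq_le; apply/andP; split.
  have [->|tm'] := eqVneq t m; first by apply: pr_le => // x [].
  have {}tm : t < m by rewrite lt_neqAle tm'.
  rewrite -[leRHS](P_g_le (ltW t0) tm); apply: pr_le => // x [Dx /= xt].
  by split=> //=; exact: ltW.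
apply/ler_addgt0Pr => e e0; pose u := Num.max (t - e) (t / 2).
have ue : t - e <= u by rewrite /u le_max lexx.
have ut : u < t by rewrite /u gt_max; apply/andP; split; lra.
have u0 : 0 <= u by rewrite /u le_max; apply/orP; right; lra.
rewrite -lerBlDr; apply: le_trans ue _.
rewrite -[leLHS](P_g_le u0 (lt_le_trans ut tm)); apply: pr_le => // x [Dx /= xu].
by split=> //=; exact: le_lt_trans ut.
Qed.

(** These are the properties behind the reflection: [m - g] has the law of [g], [g] determines
    points of [D] up to a null set, and [g] is below its midpoint on a set of positive measure. *)
Lemma uniform_exists : exists g : X -> R,
  [/\ measurable_fun setT g,
      forall C, measurable C -> P (D `&` g @^-1` C) = P (D `&` (fun x => m - g x) @^-1` C),
      forall j, exists2 C : set R, measurable C &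
        P (D `&` (B j `+` g @^-1` C)) = 0 &
      P (D `&` [set x | g x <= m / 2]) = m / 2 /\ P (D `&` [set x | g x < m / 2]) = m / 2].
Proof.
have m0 : 0 < m := D0.
exists g; split=> //.
- apply: law_unique => // [|t]; first exact: measurable_funB.
  have E1 : D `&` [set x | t < g x] = D `\` (D `&` [set x | g x <= t]).
    apply/seteqP; split=> x /=; rewrite ltNge => -[Dx h]; split=> //.
      by move=> [_ gx]; move: h; rewrite gx.
    by apply/negP => gx; exact: h.
  have E2 : D `&` [set x | t < m - g x] = D `&` [set x | g x < m - t].
    by apply/seteqP; split=> x /= [Dx]; rewrite ltrBrDr ltrBrDl addrC.
  rewrite E1 E2 pr_setDS//.
  have [t0|t0] := ltP t 0.
    rewrite (_ : D `&` [set x | g x <= t] = set0); last first.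
      by rewrite -subset0 => x [_ /=]; have := g_ge0 x; lra.
    rewrite pr_set0 subr0 setIidl// => x _ /=; have := g_le x; lra.
  have [tm|mt] := ltP t m.
    by rewrite P_g_le// P_g_lt//; rewrite -/m; lra.
  rewrite setIidl; last by move=> x _ /=; exact: le_trans (g_le x) mt.
  rewrite (_ : _ `&` _ = set0) ?pr_set0 ?subrr// -subset0 => x [_ /=].
  by have := g_ge0 x; lra.
- move=> j.
  have mRE : @measurable _ R = <<s @RGenOInfty.G R >> := RGenOInfty.measurableE R.
  pose Q A := measurable A /\ exists2 C : set R, measurable C &
    P (D `&` (K @^-1` A `+` g @^-1` C)) = 0.
  suff QA : <<s @RGenOInfty.G R >> `<=` Q.
    have [|mj [C mC CE]] := QA (@digit_set R j).
      by rewrite -mRE; exact: measurable_digit_set.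
    exists C => //; rewrite -CE; congr (P (D `&` (_ `+` _))).
    by apply/seteqP; split=> x; [exact: (@ternary_digit_set R X B j x).1|exact: (@ternary_digit_set R X B j x).2].
  have mKA A := @measurable_preimageT _ _ _ _ K A mK.
  have mgA A := @measurable_preimageT _ _ _ _ g A mg.
  apply: sigma_algebra_ind.
  + split=> //; exists set0 => //; by rewrite !preimage_set0 setYK setI0 pr_set0.
  + move=> A [mA [C mC AC]]; split; first exact: measurableC.
    exists (~` C); first exact: measurableC.
    by rewrite -AC; congr (P (D `&` _)); exact: setYC2.
  + move=> A /all_and2[mA] h; split; first by meas.
    have /choice[C CP] : forall n, exists C : set R, measurable C /\
        P (D `&` (K @^-1` A n `+` g @^-1` C)) = 0.
      by move=> n; have [C mC C0] := h n; exists C.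
    have mC n : measurable (C n) by case: (CP n).
    have mU : measurable (\bigcup_n C n) by meas.
    have mA' : measurable (\bigcup_n A n) by meas.
    have mN n : measurable (D `&` (K @^-1` A n `+` g @^-1` C n)).
      have a := mKA _ (mA n); have b := mgA _ (mC n); by meas.
    have N0 : P (\bigcup_n (D `&` (K @^-1` A n `+` g @^-1` C n))) = 0.
      by apply: pr_bigcup0 => // n; case: (CP n).
    exists (\bigcup_n C n) => //; apply: pr_eq0_sub N0.
    * by have a := mKA _ mA'; have b := mgA _ mU; meas.
    * by meas.
    * move=> x [Dx]; rewrite /setY /= => -[[[n _ An] nC]|[[n _ Cn] nA]].
        by exists n => //; split=> //; left; split=> // Cn; apply: nC; exists n.
      by exists n => //; split=> //; right; split=> // An; apply: nA; exists n.
  + move=> _ [t ->]; split; first exact: measurable_itv.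
    (* By monotonicity the two sets differ only where [t < K x] and [g x <= F t], a set of measure
       [F t - F t]. The case [F t = m] is apart because [P_g_le] covers values below [m]. *)
    exists `]F t, +oo[%classic; first exact: measurable_itv.
    have -> : D `&` (K @^-1` `]t, +oo[%classic `+` g @^-1` `]F t, +oo[%classic) =
        (D `&` [set x | g x <= F t]) `\` (D `&` [set x | K x <= t]).
      have gK x : K x <= t -> g x <= F t by exact: F_mono.
      apply/seteqP; split=> x; rewrite /setY /= !in_itv /= !andbT.
        have [Kt|Kt] := leP (K x) t; have [gt|gt] := leP (g x) (F t).
        - by case=> _ [[]|[]].
        - by have := gK x Kt; rewrite leNgt gt.
        - by case=> Dx _; split=> // -[].
        - by case=> _ [[_ []]|[_ []]].
      have [Kt|Kt] := leP (K x) t; have [gt|gt] := leP (g x) (F t).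
      - by case=> -[Dx _] []; split.
      - by case=> -[].
      - by case=> -[Dx _] _; split=> //; left; split.
      - by case=> -[].
    rewrite pr_setDS//; last by move=> x [Dx /= xt]; split=> //=; exact: F_mono.
    have [Fm|Fm'] := eqVneq (F t) m; last first.
      have Fm : F t < m by rewrite lt_neqAle Fm' F_le.
      by rewrite P_g_le ?subrr//; exact: pr_ge0.
    rewrite [X in P X - _](_ : _ = D) -/(F t) ?Fm ?subrr//.
    by apply/setIidl => x _ /=; rewrite g_le.
- by split; [apply: P_g_le|apply: P_g_lt]; lra.
Qed.
End uniform.

Section support.
Context (d : measure_display) (X : measurableType d) (R : realType).
Variable mu : probability X R.
Local Notation P := (pr mu).
Variable B : nat -> set X.
Hypothesis codB : coding B.
Hypothesis mu_nonatomic : nonatomic mu.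

Definition supported (f : nsbij mu) (D : set X) :=
  almost mu (fun x => ~ D x -> nsfun f x = x).

Lemma code_preimage A : measurable A ->
  exists2 A' : set codes, measurable A' & A = code B @^-1` A'.
Proof.
have [BE _ _] := codB; rewrite BE; move: A; apply: sigma_algebra_ind.
- by exists set0; rewrite ?preimage_set0.
- by move=> A [A' mA' ->]; exists (~` A'); [exact: measurableC|].
- move=> F FP; have /choice[A' A'P] : forall n, exists A' : set codes,
      measurable A' /\ F n = code B @^-1` A'.
    by move=> n; have [A' mA' ->] := FP n; exists A'.
  exists (\bigcup_n A' n).
    by apply: bigcup_measurable => n _; case: (A'P n).
  by rewrite preimage_bigcup; apply: eq_bigcupr => n _; case: (A'P n).
- by move=> _ [j _ <-]; exists [set w | w j] => //; exact: measurable_cylinder.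
Qed.

(* [g] identifies [D] with an interval [0, m], which the reflection
   [t |-> m - t] maps to itself; pull this reflection back to [D]. *)
Lemma supported_nontrivial D : measurable D -> 0 < P D ->
  exists f, supported f D /\ ~ ns_ae_eq f (nsid mu).
Proof.
move=> mD D0; have [g [mg sym gB [gle glt]]] := uniform_exists codB mu_nonatomic mD D0.
set m := P D in sym gle glt D0; pose g' x := m - g x.
have mg' : measurable_fun setT g' by exact: measurable_funB.
have /choice[C CP] : forall j, exists C : set R, measurable C /\
    P (D `&` (B j `+` g @^-1` C)) = 0.
  by move=> j; have [C mC C0] := gB j; exists C.
have mC j : measurable (C j) by case: (CP j).
have mB := measurable_codingB codB.
(* [gam] inverts [g] up to coding: almost everywhere on [D], [gam (g x)] is the code of [x]. *)
pose gam (r : R) : codes := [set j | C j r].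
have mgam : measurable_fun setT gam by exact: measurable_code_fun.
have mcode := measurable_code codB.
have [_ _ mrange] := codB.
have mgP (A : set R) : measurable A -> measurable (g @^-1` A) by exact: measurable_preimageT.
have mgP' (A : set R) : measurable A -> measurable (g' @^-1` A) by exact: measurable_preimageT.
have gamP (A : set codes) : measurable A -> measurable (gam @^-1` A) by exact: measurable_preimageT.
have gamg : almost mu (fun x => D x -> gam (g x) = code B x).
  have : almost mu (fun x => forall j, ~ (D `&` (B j `+` g @^-1` C j)) x).
    apply: almost_forall => j; apply: pr_eq0_almost; last by case: (CP j).
    by have := mgP _ (mC j) => ?; have := mB j => ?; meas.
  apply: almost_impl => x h Dx; apply/seteqP; split=> j; rewrite /gam /code /=;
    by have := h j; rewrite /setY /=; have [|] := pselect (B j x);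
      have [|] := pselect (C j (g x)); tauto.
pose e x : codes := if `[< D x >] then gam (g' x) else code B x.
have eD x : D x -> e x = gam (g' x) by move=> Dx; rewrite /e; case: ifPn => // /asboolP.
have eN x : ~ D x -> e x = code B x by move=> Dx; rewrite /e; case: ifPn => // /asboolP.
have me j : measurable [set x | e x j].
  have -> : [set x | e x j] = (D `&` g' @^-1` C j) `|` (~` D `&` B j).
    apply/seteqP; split=> x /=.
      by have [Dx|nD] := pselect (D x); [rewrite eD//; left|rewrite eN//; right].
    by move=> [[Dx]|[Dx]]; [rewrite eD|rewrite eN].
  by have := mgP' _ (mC j) => ?; have := mB j => ?; meas.
(* Since [g] and [m - g] have the same law on [D], the reflected value yields a code almost
   everywhere, as [g] does. *)
have aerange : almost mu (fun x => range (code B) (e x)).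
  have mr := gamP _ (measurableC mrange).
  have : P (D `&` g' @^-1` (gam @^-1` ~` range (code B))) = 0.
    rewrite -sym//; apply: almost_pr_eq0; first by have := mgP _ mr => ?; meas.
    apply: almost_impl gamg => x h [Dx] /=; rewrite h//; apply; by exists x.
  move=> /(pr_eq0_almost (measurableI _ _ mD (mgP' _ mr))).
  apply: almost_impl => x h; have [Dx|nD] := pselect (D x); last by rewrite eN//; exists x.
  by rewrite eD//; apply: contrapT => nr; apply: h.
have [x0 Dx0] : D !=set0 by apply/set0P/eqP => DE; move: D0; rewrite /m DE pr_set0 ltxx.
have [T mT TE] := code_realization codB x0 me aerange.
have TN : almost mu (fun x => ~ D x -> T x = x).
  apply: almost_impl TE => x Tx nD; have [_ inj _] := codB; apply: inj.
  by rewrite Tx eN.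
have mTP A : measurable A -> measurable (T @^-1` A) by exact: measurable_preimageT.
(* The relation [g (T x) = m - g x], tested on one Borel set at a time. *)
have Tg (A : set R) : measurable A -> almost mu (fun x => D x -> (A (g (T x)) <-> A (g' x))).
  move=> mA; have [A' mA' AE] := code_preimage (mgP A mA).
  have mE := gamP _ mA'; set E := gam @^-1` A' in mE.
  have : P (D `&` g' @^-1` (E `+` A)) = 0.
    rewrite -sym; last exact: measurableY.
    apply: almost_pr_eq0.
      by have := mgP _ (measurableY mE mA) => ?; meas.
    apply: almost_impl gamg => x h [Dx]; have {}h := h Dx.
    have : (g @^-1` A) x <-> A' (code B x) by rewrite AE.
    by rewrite -h /setY /E /=; tauto.
  move=> /(pr_eq0_almost (measurableI _ _ mD (mgP' _ (measurableY mE mA)))) /(almost_and TE).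
  apply: almost_impl => x [Tx h] Dx.
  have : (g @^-1` A) (T x) <-> A' (code B (T x)) by rewrite AE.
  rewrite Tx eD//; move: h; rewrite /setY /E /=.
  by have [|] := pselect (A (g' x)); have [|] := pselect (A' (gam (g' x))); tauto.
have TD A : measurable A -> P (D `&` T @^-1` A) = P (D `&` A).
  move=> mA; have [A' mA' AE] := code_preimage mA.
  have mE := gamP _ mA'.
  have mTA := mTP A mA; have m1 := mgP' _ mE; have m2 := mgP _ mE.
  transitivity (P (D `&` g' @^-1` (gam @^-1` A'))).
    apply: pr_eq_almost; meas; apply: almost_impl TE => x Tx /=.
    rewrite AE /=; split=> -[Dx]; by rewrite Tx eD.
  rewrite -sym//; apply: pr_eq_almost; meas; apply: almost_impl gamg => x h /=.
  rewrite AE /=; split=> -[Dx]; by rewrite h.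
have nT : null_preserving mu T.
  move=> A mA A0; have mTA := mTP A mA.
  have h1 : P (D `&` T @^-1` A) = 0.
    by rewrite TD//; apply: pr_eq0_sub A0; meas; sets.
  have h2 : P (~` D `&` T @^-1` A) = 0.
    have := pr_eq0_almost mA A0 => /(almost_and TN) h.
    apply: almost_pr_eq0; first by meas.
    by apply: almost_impl h => x [h3 h4] [nD /=]; rewrite h3.
  apply: (pr_eq0_sub _ _ _ (prU0 _ _ h1 h2)); meas.
  by move=> x /=; have [|] := pselect (D x); [left|right].
have TinD : almost mu (fun x => D x -> D (T x)).
  have mTD := mTP D mD.
  have : P (D `\` (D `&` T @^-1` D)) = 0.
    by rewrite pr_setDS//; [rewrite TD// setIid subrr|meas].
  move=> /(pr_eq0_almost (measurableD mD (measurableI _ _ mD mTD))).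
  apply: almost_impl => x h Dx; apply: contrapT => nD.
  by apply: h; split=> // -[_].
have TT : almost mu (fun x => T (T x) = x).
  have mC' j : measurable ((fun r => m - r) @^-1` C j).
    have ms : measurable_fun setT (fun r : R => m - r) by exact: measurable_funB.
    by rewrite -[X in measurable X]setTI; exact: ms.
  have h1 := almost_forall (fun j => Tg _ (mC' j)).
  have h2 := almost_preimage mT nT TE.
  apply: almost_impl (almost_and (almost_and TN TinD) (almost_and (almost_and h1 h2) gamg)).
  move=> x [[xN xD] [[xC xE] xg]].
  have [Dx|nD] := pselect (D x); last by rewrite !xN.
  have [_ inj _] := codB; apply: inj; rewrite xE eD; last exact: xD.
  rewrite -(xg Dx); apply/seteqP.
  have E : m - (m - g x) = g x by ring.
  by split=> j; have := xC j Dx; rewrite /gam /g' /= E; tauto.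
have [f fT] := almost_bijection mT mT nT nT TT TT.
exists f; split.
  by apply: almost_impl (almost_and fT TN) => x [-> h] /h.
move=> /ns_ae_eq_almost /(almost_and fT) fid.
(* If the map were the identity, [g x < m / 2] would force [m - g x <= m / 2] almost everywhere on
   [D], so the set where [g x < m / 2] would be null. *)
have mray : measurable (`]-oo, m / 2]%classic : set R) by exact: measurable_itv.
have mmle : measurable (D `&` [set x | g x <= m / 2]).
  by apply: measurableI => //; exact: measurable_comp_le.
have mmlt : measurable (D `&` [set x | g x < m / 2]).
  by apply: measurableI => //; exact: measurable_comp_lt.
have : P (D `&` [set x | g x < m / 2]) = 0.
  apply: almost_pr_eq0 => //.
  apply: almost_impl (almost_and fid (Tg _ mray)) => x [[xT xid] h] [Dx /= xm].
  have := h Dx; rewrite -xT xid /g' /= !in_itv /= (ltW xm) => -[/(_ isT)].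
  by lra.
by rewrite glt; move: D0; lra.
Qed.

(** Otherwise each [B j] and its complement would be preserved up to a null set, and these sets
    determine points. *)
Lemma moved_set (f : nsbij mu) : ~ ns_ae_eq f (nsid mu) ->
  exists E, measurable E /\ 0 < P (E `\` nsfun f @^-1` E).
Proof.
move=> fid; apply: contrapT => nE; apply: fid; apply/ns_ae_eq_almost.
apply: (coding_almost_eq codB) => j; have mB := measurable_codingB codB j.
have z E : measurable E -> P (E `\` nsfun f @^-1` E) = 0.
  move=> mE; apply/eqP; rewrite eq_le pr_ge0 andbT leNgt; apply/negP => h.
  by apply: nE; exists E.
apply/prY_almost; meas; apply: prU0; meas; last exact: z.
have := z _ (measurableC mB); congr (P _ = _).
by apply/seteqP; split=> x /=; have [|] := pselect (B j (nsfun f x)); tauto.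
Qed.

(** [f] maps [D1] off [D1], and [h] is nontrivial with support in [D1]. If they commuted,
    [f (h x) = h (f x) = f x] on [D1] would make [h] trivial. *)
Lemma noncommuting D : measurable D -> 0 < P D ->
  exists f h, [/\ supported f D, supported h D &
    ~ ns_ae_eq (nscomp f h) (nscomp h f)].
Proof.
move=> mD D0; have [f [fD fid]] := supported_nontrivial mD D0.
have [E [mE E0]] := moved_set fid.
pose D1 := D `&` (E `\` nsfun f @^-1` E).
have mD1 : measurable D1 by rewrite /D1; meas.
have D10 : 0 < P D1.
  apply: lt_le_trans E0 _; apply: pr_le_almost; meas.
  apply: almost_impl fD => x h [Ex nE]; split=> //; apply: contrapT => nD.
  by apply: nE => /=; rewrite h.
have [h [hD1 hid]] := supported_nontrivial mD1 D10.
exists f, h; split=> //.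
  by apply: almost_impl hD1 => x hx nD; apply: hx => -[].
move=> /ns_ae_eq_almost /= comm; apply/hid/ns_ae_eq_almost.
have h2 := almost_preimage (measurable_nsfun f) (@nsfun_null_preserving _ _ _ mu f) hD1.
apply: almost_impl (almost_and (almost_and comm hD1) h2) => x [[c1 c2] c3] /=.
have [D1x|nD1] := pselect (D1 x); last exact: c2.
apply: (can_inj (nsfunK f)); rewrite c1 c3//.
by move: D1x => [_ [_ nE]] [_ [Ef _]].
Qed.

End support.

(** * Uniqueness *)

Section uniqueness.
Context (d : measure_display) (X : measurableType d) (R : realType).
Variable mu : probability X R.
Local Notation P := (pr mu).
Local Notation G := (Autstar mu).
Local Open Scope quotient_scope.

Lemma supported_ae (f h : nsbij mu) D : ns_ae_eq f h -> supported f D -> supported h D.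
Proof.
move=> /ns_ae_eq_almost fh /(almost_and fh); apply: almost_impl => x [e hx] nD.
by rewrite -e hx.
Qed.

(** Almost everywhere [f] keeps [D] invariant: if [x] is in [D] and [f x] is not, then
    [f (f x) = f x], and injectivity gives [f x = x]. The same holds for [h] and [D']. *)
Lemma supported_comm (f h : nsbij mu) D D' : supported f D -> supported h D' ->
  D `&` D' `<=` set0 -> ns_ae_eq (nscomp f h) (nscomp h f).
Proof.
move=> fD hD' DD'; apply/ns_ae_eq_almost => /=.
have mf := measurable_nsfun f; have mh := measurable_nsfun h.
have nf := @nsfun_null_preserving _ _ _ mu f; have nh := @nsfun_null_preserving _ _ _ mu h.
have := almost_and (almost_and fD hD') (almost_and
  (almost_and (almost_preimage mf nf fD) (almost_preimage mf nf hD'))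
  (almost_and (almost_preimage mh nh fD) (almost_preimage mh nh hD'))).
apply: almost_impl => x [[f1 h1] [[ff fh] [hf hh]]].
have dis y : D y -> ~ D' y by move=> Dy Dy'; exact: (DD' y).
have [Dx|nD] := pselect (D x).
  rewrite h1; last exact: dis.
  rewrite fh// => D'fx; have nDfx : ~ D (nsfun f x) by move=> /dis.
  by have := ff nDfx => /(can_inj (nsfunK f)) fx; apply: nDfx; rewrite fx.
rewrite [nsfun f x]f1// hf// => Dhx.
have := hh (dis _ Dhx) => /(can_inj (nsfunK h)) hx.
by apply: nD; rewrite -hx.
Qed.

Lemma supported_conj (f g : nsbij mu) D : supported f D ->
  supported (nscomp (nscomp g f) (nsinverse g)) (nsinv g @^-1` D).
Proof.
move=> /(almost_preimage (measurable_nsinv g) (@nsinv_null_preserving _ _ _ mu g)).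
by apply: almost_impl => x h /= /h ->; rewrite nsinvK.
Qed.

Lemma supported_repr_conj (T V : G) D : supported (repr T) D ->
  supported (repr (V * T * V^-1)%g) (nsinv (repr V) @^-1` D).
Proof.
move=> /(supported_conj (repr V)); apply: supported_ae.
apply: ns_ae_eq_trans (repr_mul (V * T)%g (V^-1)%g).
by apply: ns_ae_eq_comp; [exact: repr_mul|exact: repr_inv].
Qed.

Lemma supported_repr_comm (S T : G) D D' : supported (repr S) D ->
  supported (repr T) D' -> D `&` D' `<=` set0 -> (S * T = T * S)%g.
Proof.
move=> sS sT dis; apply: repr_ae_inj.
apply: ns_ae_eq_trans (repr_mul T S).
apply: (@ns_ae_eq_trans _ _ _ _ (nscomp (repr S) (repr T))).
  by rewrite ns_ae_eq_sym; exact: repr_mul.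
exact: supported_comm sS sT dis.
Qed.

Lemma supported_sub (f : nsbij mu) D D' :
  almost mu (fun x => D x -> D' x) -> supported f D -> supported f D'.
Proof.
move=> DD' /(almost_and DD'); apply: almost_impl => x [xDD' h] nD.
by apply: h => /xDD'.
Qed.

Variables B_ A_ : nat -> set X.
Hypothesis codB : coding B_.
Hypothesis dA : dense_sets mu A_.
Hypothesis mu_nonatomic : nonatomic mu.

Lemma aut_dist_polish : polish_group_metric (@aut_dist _ _ _ mu A_).
Proof.
split.
- by have := aut_dist_metric dA codB.
- by have := aut_dist_complete codB dA.
- by have := aut_dist_separable dA.
- by move=> u v x y; exact: (@aut_dist_mul _ _ _ _ _ dA u v x y).
- by move=> u x; exact: (@aut_dist_inv _ _ _ _ _ dA u x).
Qed.

Variable D' : G -> G -> R.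
Hypothesis DG' : polish_group_metric D'.

Lemma limit_one (U : nat -> G) S :
  met_cvg (@aut_dist _ _ _ mu A_) U 1%g -> met_cvg D' U S -> S = 1%g.
Proof.
move=> cU cS; apply: contrapT => S1.
have DM' := pgm_metric DG'.
have sid : ~ ns_ae_eq (nsinverse (repr S)) (nsid mu).
  move=> h; apply: S1; apply: repr_ae_inj.
  apply: ns_ae_eq_trans (repr_one mu).
  have := ns_ae_eq_inverse h => h'.
  apply: ns_ae_eq_trans (ns_ae_eq_trans h' _); first exact: ns_ae_eq_fun.
  exact: ns_ae_eq_fun.
have [E [mE E0]] := moved_set codB sid.
(* [E] is chosen for the inverse of [S], so that the image of [A] under [S] leaves [A] on a nonnull
   set. *)
pose A := ~` E; have mA : measurable A by exact: measurableC.
pose im (T : G) := nsinv (repr T) @^-1` A.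
have mim T : measurable (im T) by rewrite /im; meas.
have c0 : 0 < P (im S `\` A).
  apply: lt_le_trans E0 _; apply: pr_le; rewrite /im; meas.
  by move=> x [Ex /= nE]; split=> // /(_ Ex).
set c := P (im S `\` A) in c0.
have small r : 0 < r -> exists N, forall n, (N <= n)%N -> P (im (U n) `\` A) < r.
  move=> r0; move/(aut_dist_cvgP dA)/(push_cvg_inverse dA) in cU.
  have [N hN] := push_cvg_preimage cU mA r0; exists N => n /hN /=.
  apply: le_lt_trans.
  have aid : almost mu (fun x => nsinv (repr (1%g : G)) x = x).
    have := ns_ae_eq_inverse (repr_one mu) => /ns_ae_eq_almost.
    by apply: almost_impl => x /= <-.
  apply: pr_le_almost; rewrite /im; meas.
  by apply: almost_impl aid => x /= xid [h nA]; left; split=> //=; rewrite xid.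
(* The parts of the images under [U (k j)] outside [A] have total measure at most [c / 2], so
   removing them all leaves [D1] nonnull. The bound [j <= k j] is enough for convergence along
   [k]. *)
have /choice[k kP] : forall j, exists n, (j <= n)%N /\
    P (im (U n) `\` A) <= c / 2 * 2^-1 ^+ j.+1.
  move=> j; have [|N hN] := small (c / 2 * 2^-1 ^+ j.+1).
    by rewrite mulr_gt0 ?exprn_gt0//; lra.
  by exists (maxn j N); rewrite leq_maxl; split=> //; exact/ltW/hN/leq_maxr.
pose D1 := (im S `\` A) `\` \bigcup_j (im (U (k j)) `\` A).
have mN j : measurable (im (U (k j)) `\` A) by have := mim (U (k j)) => ?; meas.
have mU : measurable (\bigcup_j (im (U (k j)) `\` A)) by meas.
have mS := mim S.
have mD1 : measurable D1 by rewrite /D1; meas.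
have D10 : 0 < P D1.
  have h : P (\bigcup_j (im (U (k j)) `\` A)) <= c / 2.
    by apply: pr_bigcup_geom => // j; case: (kP j).
  have mSA : measurable (im S `\` A) by meas.
  by have := prD_le mu mSA mU; rewrite -/D1 -/c; lra.
have [f [h [fD hD fh]]] := noncommuting codB mu_nonatomic mD1 D10.
pose F : G := \pi f; pose H : G := \pi h.
have FD : supported (repr F) D1.
  by apply: supported_ae fD; rewrite ns_ae_eq_sym; exact: ns_ae_eq_repr.
have HD : supported (repr H) D1.
  by apply: supported_ae hD; rewrite ns_ae_eq_sym; exact: ns_ae_eq_repr.
(* [D1] lies in the image of [A] under [S], so conjugating by the inverse of [S] brings the support
   of [F] into [A]. *)
have FS : supported (repr (S^-1 * F * S)%g) A.
  have := supported_repr_conj (S^-1)%g FD; rewrite invgK.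
  apply: supported_sub.
  have := repr_inv S => /ns_ae_eq_inverse /ns_ae_eq_almost.
  apply: almost_impl => x /= <- [[]]; by rewrite /im /= nsfunK.
have DM := pgm_metric aut_dist_polish.
pose T := (S^-1 * F * S)%g; pose W j := (U (k j) * T * (U (k j))^-1)%g.
(* [W j] is supported in the image of [A] under [U (k j)]. That image misses [D1], which lies
   outside [A] and from which its part outside [A] was removed. *)
have comm j : (W j * H = H * W j)%g.
  apply: (supported_repr_comm (supported_repr_conj (U (k j)) FS) HD).
  by move=> x [xA [[_ nA]]]; apply; exists j.
have cV : met_cvg D' (U \o k) S.
  by apply: met_cvg_subseq cS => j; case: (kP j).
have cH := met_cvg_cst DM' H.
have cW : met_cvg D' W F.
  have -> : F = (S * T * S^-1)%g by rewrite /T -!mulgA mulgV mulg1 mulgA mulgV mul1g.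
  apply: (pgm_mul DG'); last exact: (pgm_inv DG').
  by apply: (pgm_mul DG') => //; exact: met_cvg_cst.
have FH : (F * H = H * F)%g.
  apply: (met_cvg_unique DM' (pgm_mul DG' cW cH)).
  rewrite (_ : (fun n => (W n * H)%g) = (fun n => (H * W n)%g)); last exact/funext.
  exact: (pgm_mul DG' cH cW).
by apply: fh; apply/Autstar_eqP; rewrite -!Autstar_mul_pi.
Qed.

Lemma Autstar_closed_graph (u : nat -> G) x y :
  met_cvg (@aut_dist _ _ _ mu A_) u x -> met_cvg D' u y -> x = y.
Proof.
move=> ux uy; have DG := aut_dist_polish; have DM := pgm_metric DG.
have c1 := pgm_mul DG (met_cvg_cst DM x^-1%g) ux.
have c2 := pgm_mul DG' (met_cvg_cst (pgm_metric DG') x^-1%g) uy.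
rewrite mulVg in c1; have := limit_one c1 c2 => /(congr1 (fun z => x * z)%g).
by rewrite mulgA mulgV mul1g mulg1.
Qed.

End uniqueness.

Theorem theorem1p4 (d : measure_display) (X : measurableType d) (R : realType)
    (mu : probability X R) (hmu : standard_probability_space mu) :
  exists tau : topology (Autstar mu),
    is_weak_topology tau /\
    unique (fun tau' => polish_group_topology R tau') tau.
Proof.
have [sb na] := hmu.
have [x0 _] : [set: X] !=set0.
  apply/set0P/eqP => X0; have := pr_setT mu; rewrite X0 pr_set0.
  by move/eqP; rewrite eq_sym oner_eq0.
have [B codB] := standard_borel_coding x0 sb.
have [BE _ _] := codB; have [A dA] := dense_sets_exists mu BE.
have DG := aut_dist_polish codB dA; have DM := pgm_metric DG.
pose tau : topology (Autstar mu) := metric_topology (@aut_dist _ _ _ mu A).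
have tauD : opens tau = met_open (@aut_dist _ _ _ mu A) by [].
have tauP := polish_group_metricP DM tauD DG.
exists tau; split; last first.
  split=> // tau' /polish_group_topologyP[D' DG' tauD'].
  have cg := Autstar_closed_graph codB dA na DG'.
  (* The closed graph condition is symmetric in the two metrics, so each topology contains the
     other. *)
  apply: topology_eq; rewrite tauD tauD'; apply/seteqP; split=> O oO.
    by apply: (closed_graph_open DG' DG _ oO) => u x y ux uy; apply/esym/(cg u).
  exact: (closed_graph_open DG DG' cg oO).
split.
- by exists (metric_space DM); exact: space_homeomorphic.
- by case: tauP.
- move=> T_ T; apply: (iff_trans (space_cvgP DM tauD T_ T)).
  apply: (iff_trans (aut_dist_cvgP dA T_ T)).
  by apply: iff_sym; exact: (nsbij_cvgP (fun n => repr (T_ n)) (repr T) dA).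
Qed.
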